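(* Let $X$ be a Banach space, $A:D(A)\subset X\to X$ a closed linear operator, $B\in\mathcal{B}(X)$, $r_1,\dots,r_n\ge0$, and $1\le p<\infty$. Suppose that for every $f\in L^p(\mathbb{T};X)$ there exists a unique $2\pi$-periodic strong $L^p$-solution of $$\frac{d}{dt}x(t)=Ax(t)+\sum_{j=1}^n Bx(t-r_j)+f(t),\qquad x(0)=x(2\pi).\tag{E}$$ Then (1) for every $k\in\mathbb{Z}$ the operator $\Delta_k=ikI-A-\sum_{j=1}^nB_{j,k}$ has a bounded inverse, and (2) the family $\{ik\Delta_k^{-1}\}_{k\in\mathbb{Z}}$ is $R$-bounded.
   Context: $\mathbb{T}=\mathbb{R}/2\pi\mathbb{Z}$; functions on $\mathbb{T}$ are identified with $2\pi$-periodic functions on $\mathbb{R}$. For $u\in L^1(\mathbb{T};X)$, $\hat u(k)=\frac{1}{2\pi}\int_0^{2\pi}e^{-iks}u(s)\,ds$. $B_{j,k}:=e^{-ikr_j}B$, $\Delta_k:=ikI-A-\sum_{j=1}^nB_{j,k}$ with domain $D(A)$. $H^{1,p}(\mathbb{T};X)=\{u\in L^p(\mathbb{T};X):\exists v\in L^p(\mathbb{T};X),\ \hat v(k)=ik\hat u(k)\ \forall k\}$. A function $x\in H^{1,p}(\mathbb{T};X)$ is a $2\pi$-periodic strong $L^p$-solution of (E) if $x(t)\in D(A)$ for all $t$ and (E) holds a.e. A family $\mathcal{T}\subset\mathcal{B}(X)$ is $R$-bounded if there are $C>0$, $p\in[1,\infty)$ with $\|\sum_{l=1}^m r_lT_lx_l\|_{L^p(0,1;X)}\le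 C\|\sum_{l=1}^m r_lx_l\|_{L^p(0,1;X)}$ for all $m$, $T_l\in\mathcal{T}$, $x_l\in X$ and independent symmetric $\{-1,1\}$-valued random variables $r_l$ on $[0,1]$. *)

(* Defs.v *)
From HB Require Import structures.
From mathcomp Require Import all_boot all_order all_algebra.
From mathcomp Require Import all_classical all_reals all_analysis.
From mathcomp Require Import complex.
Set Implicit Arguments. Unset Strict Implicit. Unset Printing Implicit Defensive.
Import Order.TTheory GRing.Theory Num.Theory.
Import numFieldNormedType.Exports.
Local Open Scope classical_set_scope.
Local Open Scope ring_scope.
Local Open Scope complex_scope.

Section PeriodicLp.
Context {R : realType} {X : completeNormedModType R[i]}.

Notation leb := (@lebesgue_measure R).

(* real-valued norm of X (the norm of a normed C-module is a nonnegative
   complex number; we take its real part). *)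
Definition nrm (x : X) : R := complex.Re `|x|.

Definition expi (t : R) : R[i] := (cos t) +i* (sin t).

Definition Tper : set R := `[0, 2 * pi]%classic.

(* functions on T = 2pi-periodic functions on R *)
Definition periodic2pi (u : R -> X) := forall t, u (t + 2 * pi) = u t.

Record sfun := SFun { sN : nat; sA : 'I_sN -> set R; sc : 'I_sN -> X }.
Arguments sA s i : clear implicits.
Arguments sc s i : clear implicits.

Definition sf_eval (s : sfun) (t : R) : X :=
  \sum_(i < sN s) (if `[< sA s i t >] then sc s i else 0).

Definition sf_adm (D : set R) (s : sfun) :=
  forall i, measurable (sA s i) /\ sA s i `<=` D /\ (leb (sA s i) < +oo)%E.

Definition sf_int (s : sfun) : X :=
  \sum_(i < sN s) (fine (leb (sA s i)))%:C *: sc s i.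

Definition strongly_measurable (D : set R) (u : R -> X) :=
  exists s : nat -> sfun, (forall n, forall i, measurable (sA (s n) i)) /\
    {ae leb, forall t, D t -> (fun n => sf_eval (s n) t) @ \oo --> u t}.

Definition bochner_integral (D : set R) (u : R -> X) (c : X) :=
  strongly_measurable D u /\
  exists s : nat -> sfun, (forall n, sf_adm D (s n)) /\
    (fun n => (\int[leb]_(t in D) (nrm (sf_eval (s n) t - u t))%:E)%E) @ \oo --> 0%E /\
    (fun n => sf_int (s n)) @ \oo --> c.

Definition Lp_per (p : R) (u : R -> X) :=
  periodic2pi u /\ strongly_measurable Tper u /\
  (\int[leb]_(t in Tper) ((nrm (u t)) `^ p)%:E < +oo)%E.

Definition fcoef (u : R -> X) (k : int) : X :=
  ((2 * pi)^-1)%:C *: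
    xget 0 [set c | bochner_integral Tper (fun s => expi (- (k%:~R * s)) *: u s) c].

Definition H1p_deriv (p : R) (u v : R -> X) :=
  Lp_per p u /\ Lp_per p v /\ forall k : int, fcoef v k = (0 +i* k%:~R) *: fcoef u k.

Definition H1p (p : R) (u : R -> X) := exists v, H1p_deriv p u v.

Definition is_linear_op (T : X -> X) :=
  forall (a : R[i]) (x y : X), T (a *: x + y) = a *: T x + T y.

Definition bounded_op (T : X -> X) := is_linear_op T /\ continuous T.

Definition closed_linear_op (DA : set X) (A : X -> X) :=
  DA 0 /\
  (forall (a : R[i]) x y, DA x -> DA y -> DA (a *: x + y)) /\
  (forall (a : R[i]) x y, DA x -> DA y -> A (a *: x + y) = a *: A x + A y) /\
  (forall (u : nat -> X) (x y : X), (forall m, DA (u m)) ->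
      u @ \oo --> x -> (A \o u) @ \oo --> y -> DA x /\ A x = y).

Definition strong_sol (p : R) (DA : set X) (A B : X -> X) (n : nat)
    (r : 'I_n -> R) (f x : R -> X) :=
  exists v, H1p_deriv p x v /\ (forall t, DA (x t)) /\
    {ae leb, forall t,
       v t = A (x t) + \sum_(j < n) B (x (t - r j)) + f t}.

Definition Delta (A B : X -> X) (n : nat) (r : 'I_n -> R) (k : int) (y : X) : X :=
  (0 +i* k%:~R) *: y - A y - \sum_(j < n) expi (- (k%:~R * r j)) *: B y.

Definition bounded_inverse (DA : set X) (T S : X -> X) :=
  bounded_op S /\ (forall x, DA (S x) /\ T (S x) = x) /\
  (forall y, DA y -> S (T y) = y).

Definition I01 : set R := `[0, 1]%classic.

Definition rademacher_family (m : nat) (rv : 'I_m -> R -> R) :=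
  (forall l, measurable_fun I01 (rv l)) /\
  (forall l t, I01 t -> rv l t = 1 \/ rv l t = -1) /\
  (forall l, leb (I01 `&` rv l @^-1` [set 1]) = leb (I01 `&` rv l @^-1` [set -1])) /\
  (forall (S : {set 'I_m}) (Bs : 'I_m -> set R), (forall l, measurable (Bs l)) ->
     leb (I01 `&` \bigcap_(l in [set l | l \in S]) (rv l @^-1` Bs l)) =
     (\prod_(l in S) leb (I01 `&` rv l @^-1` Bs l))%E).

Definition Lq01_norm (q : R) (g : R -> X) : R :=
  (fine (\int[leb]_(t in I01) ((nrm (g t)) `^ q)%:E)%E) `^ q^-1.

Definition R_bounded (F : set (X -> X)) :=
  exists C : R, 0 < C /\ exists q : R, 1 <= q /\
    forall (m : nat) (T : 'I_m -> X -> X) (x : 'I_m -> X) (rv : 'I_m -> R -> R),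
      (forall l, F (T l)) -> rademacher_family rv ->
      Lq01_norm q (fun t => \sum_(l < m) (rv l t)%:C *: T l (x l))
        <= C * Lq01_norm q (fun t => \sum_(l < m) (rv l t)%:C *: x l).

End PeriodicLp.

(* Main.v *)
Require Import Defs.
From HB Require Import structures.
From mathcomp Require Import all_boot all_order all_algebra.
From mathcomp Require Import all_classical all_reals all_analysis.
From mathcomp Require Import complex.
From mathcomp Require Import finmap measurable_realfun.
From mathcomp Require Import ring lra.
Set Implicit Arguments. Unset Strict Implicit. Unset Printing Implicit Defensive.
Import Order.TTheory GRing.Theory Num.Theory.
Import numFieldNormedType.Exports.
Local Open Scope classical_set_scope.
Local Open Scope ring_scope.
Local Open Scope complex_scope.

(** The solution relation [f |-> (x, x')] is linear with closed graph on [L^p], so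
    Baire's argument (the open mapping theorem) gives [|x|_p, |x'|_p <= C |f|_p].
    For [f = e^{ikt} y], both [x] and [e^{-iks} x(. + s)] solve the equation, so
    they agree a.e. for each [s]; by Fubini, [x = e^{ikt} x0] a.e., and comparing
    k-th Fourier coefficients gives [Delta_k x0 = y].  Injectivity of [Delta_k]
    is uniqueness for [f = 0].  Finally, the bound on [x'] for
    [f = sum_l eps_l e^{i k_l t} x_l], raised to the power p and summed over all
    signs [eps], yields R-boundedness once the unimodular factors [e^{i k_l t}]
    are removed by Kahane's contraction principle. *)

(** * The real-valued norm of [X] and the characters [expi] *)

Section Norm.
Context {R : realType} {X : completeNormedModType R[i]}.
Implicit Types (x y : X) (r s : R).

(** Functions are never identified modulo null sets, and this shapes much of the development.
    [Lpnorm] is only a seminorm on plain functions, so the open mapping argument is carried out for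
    a linear relation between seminormed spaces. A strongly measurable function is an a.e. limit of
    simple functions and need not be measurable itself; estimates therefore pass to a representative
    that is an everywhere limit ([Bmeas]). Solutions must lie in [DA] at every [t], so limits of
    solutions are modified on a null set.

    Uniqueness also holds only a.e., with an exceptional set that depends on the shift [s];
    Tonelli's theorem exchanges the two quantifiers. Once the solution is known to be an
    exponential, [A] and [B] act only on its values at points, and the exponential pulls out by
    linearity.

    The final constant is [4 * C]: [C] bounds the derivative, and the contraction principle for
    unimodular factors costs 2 (cosine and sine separately) each time it is used, once on the
    outputs and once on the inputs. *)

Lemma norm_nrm x : `|x| = (nrm x)%:C.
Proof.
have := normr_ge0 x; rewrite /nrm; case: (`|x|) => a b /=.
by rewrite lecE /= => /andP[/eqP-> _].
Qed.

Lemma nrm_ge0 x : 0 <= nrm x.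
Proof. by have := normr_ge0 x; rewrite norm_nrm lecE /= => /andP[]. Qed.

Lemma nrm0 : nrm (0 : X) = 0.
Proof. by rewrite /nrm normr0. Qed.

Lemma nrm_eq0 x : (nrm x == 0) = (x == 0).
Proof.
rewrite -[RHS]normr_eq0 norm_nrm.
by rewrite eq_complex /= eqxx andbT.
Qed.

Lemma nrmD x y : nrm (x + y) <= nrm x + nrm y.
Proof. by have := ler_normD x y; rewrite !norm_nrm -rmorphD lecR. Qed.

Lemma nrmN x : nrm (- x) = nrm x.
Proof. by rewrite /nrm normrN. Qed.

Lemma nrmB x y : nrm (x - y) = nrm (y - x).
Proof. by rewrite -nrmN opprB. Qed.

Lemma ler_nrmB x y : nrm (x - y) <= nrm x + nrm y.
Proof. by rewrite (le_trans (nrmD _ _))// nrmN. Qed.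

Lemma ler_dist_nrm x y : `|nrm x - nrm y| <= nrm (x - y).
Proof.
have h (z t : X) : nrm z - nrm t <= nrm (z - t).
  by rewrite lerBlDr -{1}[z](subrK t) nrmD.
by rewrite ler_norml; apply/andP; split; [rewrite lerNl opprB nrmB|]; exact: h.
Qed.

Lemma nrmZ (a : R[i]) x : nrm (a *: x) = complex.Re `|a| * nrm x.
Proof.
rewrite /nrm normrZ norm_nrm.
by case: a => a b; rewrite normc_def /=; ring.
Qed.

Lemma nrmZr r x : nrm (r%:C *: x) = `|r| * nrm x.
Proof. by rewrite nrmZ normc_def /= expr0n /= addr0 sqrtr_sqr. Qed.

Lemma norm_expi t : `|expi t : R[i]| = 1.
Proof. by rewrite normc_def /= cos2Dsin2 sqrtr1. Qed.

Lemma nrm_expi t x : nrm (expi t *: x) = nrm x.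
Proof. by rewrite nrmZ norm_expi mul1r. Qed.

Lemma nrm_sum (I : Type) (l : seq I) (P : pred I) (F : I -> X) :
  nrm (\sum_(i <- l | P i) F i) <= \sum_(i <- l | P i) nrm (F i).
Proof.
elim/big_ind2: _ => //; first by rewrite nrm0.
by move=> a b c d ab cd; rewrite (le_trans (nrmD _ _))// lerD.
Qed.

Lemma expi0 : expi 0 = 1 :> R[i].
Proof. by rewrite /expi cos0 sin0. Qed.

Lemma expiD r s : expi (r + s) = expi r * expi s.
Proof.
by rewrite /expi cosD sinD; apply/eqP; rewrite eq_complex /= eqxx /= addrC
  [cos r * sin s]mulrC eqxx.
Qed.

Lemma expiN_mul r : expi (- r) * expi r = 1.
Proof. by rewrite -expiD addNr expi0. Qed.

Lemma expi_mulN r : expi r * expi (- r) = 1.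
Proof. by rewrite -expiD addrN expi0. Qed.

Lemma expi_pi : expi pi = -1 :> R[i].
Proof.
by rewrite /expi cospi sinpi; apply/eqP; rewrite eq_complex /= oppr0 !eqxx.
Qed.

Lemma expi_2pi_int (k : int) : expi (k%:~R * (2 * pi)) = 1 :> R[i].
Proof.
have h (n : nat) : expi (n%:R * (2 * pi)) = 1 :> R[i].
  elim: n => [|n ih]; first by rewrite mul0r expi0.
  rewrite -natr1 mulrDl mul1r expiD ih mul1r mulr_natl mulr2n expiD expi_pi.
  by rewrite mulrNN mulr1.
case: k => n; first exact: h.
rewrite NegzE mulrNz mulNr -[LHS]mulr1 -[X in _ * X](h n.+1).
exact: expiN_mul.
Qed.

Lemma cvg_nrmP (u : nat -> X) (l : X) :
  (u @ \oo --> l) <-> ((fun n => nrm (u n - l)) @ \oo --> (0 : R)).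
Proof.
split => h.
  apply/cvgrPdist_lt => e e0.
  move/cvgrPdist_lt : h => /(_ e%:C); rewrite ltcR => /(_ e0).
  apply: filterS => n; rewrite norm_nrm ltcR sub0r normrN nrmB.
  by rewrite ger0_norm ?nrm_ge0.
apply/cvgrPdist_lt => e e0.
(* The topology of [X] uses radii in [R[i]]; a positive complex number has zero imaginary part, so
   such a radius is real. *)
have eE : e = (complex.Re e)%:C.
  by move: e0; case: (e) => a b; rewrite ltcE /= => /andP[/eqP-> _].
move: e0; rewrite eE ltcR => e0.
move/cvgrPdist_lt : h => /(_ _ e0).
apply: filterS => n; rewrite norm_nrm ltcR sub0r normrN nrmB.
by rewrite ger0_norm ?nrm_ge0.
Qed.

Lemma cvg_nrm (u : nat -> X) (l : X) :
  u @ \oo --> l -> (fun n => nrm (u n)) @ \oo --> nrm l.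
Proof.
move=> /cvg_nrmP h; apply/cvgrPdist_lt => e e0.
move/cvgrPdist_lt : h => /(_ _ e0); apply: filterS => n.
rewrite sub0r normrN ger0_norm ?nrm_ge0//; apply: le_lt_trans.
by rewrite nrmB ler_dist_nrm.
Qed.

Lemma cvg_nrm_squeeze (u : nat -> X) (l : X) (e : nat -> R) :
  (forall n, nrm (u n - l) <= e n) -> e @ \oo --> (0 : R) -> u @ \oo --> l.
Proof.
move=> ue e0; apply/cvg_nrmP; apply: (squeeze_cvgr _ (cvg_cst 0) e0).
by apply: nearW => n; rewrite nrm_ge0 ue.
Qed.

Lemma nrm_cauchy_cvg (u : nat -> X) :
  (forall e : R, 0 < e -> exists N, forall m n, (N <= m)%N -> (N <= n)%N ->
     nrm (u m - u n) < e) -> cvgn u.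
Proof.
move=> h; apply/cauchy_cvgP/cauchy_ballP => e e0.
have eE : e = (complex.Re e)%:C.
  by move: e0; case: (e) => a b; rewrite ltcE /= => /andP[/eqP-> _].
move: (e0); rewrite eE ltcR => /h[N hN].
exists (u @` [set m | (N <= m)%N], u @` [set m | (N <= m)%N]).
  by split; exists N => // m Nm; exists m.
move=> [_ _] /= [[m Nm <-] [n Nn <-]]; rewrite -ball_normE /= norm_nrm ltcR.
exact: hN.
Qed.

Lemma cvg_nrm_series (u : nat -> X) :
  cvgn (series (fun n => nrm (u n))) -> cvgn (series u).
Proof.
move=> /cauchy_cvgP/cauchy_seriesP h; apply: nrm_cauchy_cvg => e e0.
have [[A B] /= [[N _ AN] [M _ BM]] hAB] := h _ e0.
have key m n : (maxn N M <= m)%N -> (m <= n)%N -> nrm (series u n - series u m) < e.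
  move=> Nm mn; have /= := hAB (m, n).
  have -> : series u n - series u m = \sum_(m <= k < n) u k.
    by rewrite sub_series mn.
  have hm := leq_trans (leq_maxl _ _) Nm.
  have hn := leq_trans (leq_trans (leq_maxr _ _) Nm) mn.
  move=> /(_ (conj (AN m hm) (BM n hn))).
  by apply: le_lt_trans; rewrite (le_trans (nrm_sum _ _ _))// ler_norm.
exists (maxn N M) => m n Nm Nn.
have [mn|/ltnW nm] := leqP m n; last exact: key.
by rewrite nrmB key.
Qed.

End Norm.

(** * Integrals of nonnegative functions that may fail to be measurable *)

Section NonnegIntegral.
Local Open Scope ereal_scope.
Context d (T : measurableType d) (R : realType) (mu : {measure set T -> \bar R}).

(* The integral of a nonnegative function is a supremum over simple minorants,
   so monotonicity needs no measurability. *)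
Lemma ge0_le_integral_nomeas (D : set T) (f1 f2 : T -> \bar R) :
  (forall x, D x -> 0 <= f1 x) -> (forall x, D x -> f1 x <= f2 x) ->
  \int[mu]_(x in D) f1 x <= \int[mu]_(x in D) f2 x.
Proof.
move=> f10 f12.
have f20 x : D x -> 0 <= f2 x by move=> Dx; rewrite (le_trans (f10 _ Dx))// f12.
rewrite ge0_integralE// ge0_integralE//.
apply: le_ereal_sup => _ [h /= hf <-]; exists h => // x.
rewrite (le_trans (hf x))// /patch; case: ifPn => // /set_mem; exact: f12.
Qed.

(** [f] is squeezed between the modifications of [g] by [0] and by [+oo] on a measurable null set
    containing the exceptional points. Both modifications are measurable and have the integral of
    [g]. *)
Lemma ge0_ae_eq_integral_nomeas (D : set T) (f g : T -> \bar R) :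
  measurable D -> measurable_fun D g ->
  (forall x, D x -> 0 <= f x) -> (forall x, D x -> 0 <= g x) ->
  {ae mu, forall x, D x -> f x = g x} ->
  \int[mu]_(x in D) f x = \int[mu]_(x in D) g x.
Proof.
move=> mD mg f0 g0 [N [mN N0 subN]].
have fg x : D x -> ~ N x -> f x = g x.
  by move=> Dx Nx; apply: contrapT => fgx; apply: Nx; apply: subN => /(_ Dx).
pose g0' x := if x \in N then 0 else g x.
pose g1' x := if x \in N then +oo else g x.
have mN' : measurable_fun D (fun x => x \in N).
  by apply: measurable_funS measurableT _ _ => //;
    apply: (measurable_fun_bool true); rewrite setTI preimage_mem_true.
have mg0 : measurable_fun D g0'.
  by apply: measurable_fun_if => //; exact: measurable_funS mg.
have mg1 : measurable_fun D g1'.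
  by apply: measurable_fun_if => //; exact: measurable_funS mg.
have e0 : \int[mu]_(x in D) g0' x = \int[mu]_(x in D) g x.
  apply: ge0_ae_eq_integral => //.
    by move=> x Dx; rewrite /g0'; case: ifP => // _; exact: g0.
  exists N; split => // x /not_implyP[Dx]; rewrite /g0'.
  by case: ifPn => // /set_mem.
have e1 : \int[mu]_(x in D) g1' x = \int[mu]_(x in D) g x.
  apply: ge0_ae_eq_integral => //.
    by move=> x Dx; rewrite /g1'; case: ifP => // _; exact: g0.
  exists N; split => // x /not_implyP[Dx]; rewrite /g1'.
  by case: ifPn => // /set_mem.
apply/eqP; rewrite eq_le; apply/andP; split.
  rewrite -e1; apply: ge0_le_integral_nomeas => // x Dx; rewrite /g1'.
  by case: ifPn => [_|/negP Nx]; [rewrite leey|rewrite fg// => /mem_set].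
rewrite -e0; apply: ge0_le_integral_nomeas => x Dx; rewrite /g0'.
  by case: ifPn => // _; exact: g0.
by case: ifPn => [_|/negP Nx]; [exact: f0|rewrite fg// => /mem_set].
Qed.

End NonnegIntegral.

(** * Functions that factor through a finite type *)

Section FiniteValued.
Context d (T : measurableType d) (R : realType) (mu : {measure set T -> \bar R}).

Lemma fin_preimage_measurable (D : set T) (I : finType) (q : T -> I) :
  (forall i, measurable (D `&` q @^-1` [set i])) ->
  forall P : set I, measurable (D `&` q @^-1` P).
Proof.
move=> mq P.
have -> : D `&` q @^-1` P = \bigcup_(i in P) (D `&` q @^-1` [set i]).
  apply/seteqP; split => [t [Dt Pt]|t [i Pi [Dt /= qt]]].
    by exists (q t).
  by split=> //=; rewrite qt.
by apply: fin_bigcup_measurable => //; exact: finite_finset.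
Qed.

Lemma fin_measurable_fun d' (T' : measurableType d') (D : set T) (I : finType)
  (q : T -> I) (F : I -> T') :
  (forall i, measurable (D `&` q @^-1` [set i])) ->
  measurable_fun D (fun t => F (q t)).
Proof. by move=> mq _ B _; exact: (fin_preimage_measurable mq (F @^-1` B)). Qed.

Lemma fin_integral (D : set T) (I : finType) (q : T -> I) (F : I -> R) :
  measurable D -> (forall i, measurable (D `&` q @^-1` [set i])) ->
  (forall i, 0 <= F i) ->
  (\int[mu]_(t in D) (F (q t))%:E =
   \sum_(i : I) (F i)%:E * mu (D `&` q @^-1` [set i]))%E.
Proof.
move=> mD mq F0.
transitivity (\int[mu]_(t in D)
    (\sum_(i <- index_enum I) (F i)%:E * (\1_(D `&` q @^-1` [set i]) t)%:E))%E.
  apply: eq_integral => t /set_mem Dt.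
  rewrite (bigD1_seq (q t)) /= ?mem_index_enum ?index_enum_uniq//.
  rewrite indicE mem_set// mule1 big1 ?adde0// => i /eqP iq.
  by rewrite indicE memNset ?mule0// => -[_ /= /esym].
rewrite ge0_integral_sum//; last 2 first.
- move=> i; apply/measurable_EFinP; apply: measurable_funM => //.
- by move=> i x _; rewrite -EFinM lee_fin mulr_ge0.
apply: eq_bigr => i _.
rewrite ge0_integralZl//; last by rewrite lee_fin.
  by rewrite integral_indic// setIC setIA setIid.
exact/measurable_EFinP.
Qed.

End FiniteValued.

(** * Translation invariance of Lebesgue measure, and periodicity *)

Section Translation.
Context {R : realType}.
Notation leb := (@lebesgue_measure R).

Lemma leb_fin_integral (D : set R) (I : finType) (q : R -> I) (F : I -> R) :
  measurable D -> (forall i, measurable (D `&` q @^-1` [set i])) ->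
  (forall i, 0 <= F i) ->
  (\int[leb]_(t in D) (F (q t))%:E =
   \sum_(i : I) (F i)%:E * leb (D `&` q @^-1` [set i]))%E.
Proof. exact: (@fin_integral _ _ _ leb). Qed.

Lemma measurable_addr (a : R) (D : set R) : measurable_fun D (fun t : R => t + a).
Proof. exact: measurable_funD. Qed.

(** The pushforward under translation gives each interval []b, c]] its length, and these intervals
    determine Lebesgue measure. *)
Lemma lebesgue_measure_addr (a : R) (A : set R) : measurable A ->
  leb ((fun t : R => t + a) @^-1` A) = leb A.
Proof.
move=> mA; pose phi : measurableTypeR R -> measurableTypeR R := fun t => t + a.
have mphi : measurable_fun setT phi by exact: measurable_addr.
pose mphi' := isMeasurableFun.Build _ _ _ _ _ mphi.
pose phi' : {mfun measurableTypeR R >-> measurableTypeR R} := HB.pack phi mphi'.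
apply/esym; rewrite -[RHS]/(pushforward leb phi' A).
apply: lebesgue_measure_unique => //= _ [[b c]] _ <-.
rewrite /pushforward.
have -> : phi @^-1` [set` `]b, c]] = [set` `]b - a, c - a]].
  by apply/seteqP; split => t /=; rewrite !in_itv /= ltrBlDr lerBrDr.
rewrite !lebesgue_measure_itv /= !lte_fin ltrD2r.
by case: ifP => // _; rewrite -!EFinD; congr EFin; ring.
Qed.

Lemma measurable_preimage_addr (a : R) (A : set R) : measurable A ->
  measurable ((fun t : R => t + a) @^-1` A).
Proof. by move=> mA; rewrite -[X in measurable X]setTI; exact: measurable_addr. Qed.

Lemma ge0_integral_addr (a : R) (D : set R) (f : R -> \bar R) :
  measurable D -> measurable_fun D f -> (forall t, D t -> 0 <= f t)%E ->
  (\int[leb]_(t in (fun t : R => (t + a)%R) @^-1` D) f (t + a)%R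
   = \int[leb]_(t in D) f t)%E.
Proof.
move=> mD mf f0.
pose phi : measurableTypeR R -> measurableTypeR R := fun t => t + a.
have mphi : measurable_fun setT phi by exact: measurable_addr.
rewrite -[LHS](@ge0_integral_pushforward _ _ _ _ _ _ mphi leb)//; last first.
  by move=> y /set_mem; exact: f0.
apply: eq_measure_integral => //= A mA _; exact: lebesgue_measure_addr.
Qed.

Lemma ae_imp (P Q : R -> Prop) :
  (forall t, P t -> Q t) -> {ae leb, forall t, P t} -> {ae leb, forall t, Q t}.
Proof.
by move=> PQ [N [mN N0 sN]]; exists N; split => // t nQ; apply: sN => /PQ.
Qed.

Lemma ae_and (P Q : R -> Prop) :
  {ae leb, forall t, P t} -> {ae leb, forall t, Q t} ->
  {ae leb, forall t, P t /\ Q t}.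
Proof.
move=> [N [mN N0 sN]] [M [mM M0 sM]]; exists (N `|` M); split.
- exact: measurableU.
- by rewrite null_set_setU.
- move=> t /= /not_andP[nP|nQ]; [left; exact: sN|right; exact: sM].
Qed.

Lemma ae_addr (a : R) (P : R -> Prop) :
  {ae leb, forall t, P t} -> {ae leb, forall t, P (t + a)}.
Proof.
move=> [N [mN N0 sN]]; exists ((fun t : R => t + a) @^-1` N); split.
- exact: measurable_preimage_addr.
- by rewrite lebesgue_measure_addr.
- by move=> t /= nP; exact: sN.
Qed.

Lemma ae_int_addr (a : R) (P : R -> Prop) :
  {ae leb, forall t, P t} -> {ae leb, forall t, forall k : int, P (t + k%:~R * a)}.
Proof.
move=> aP; have h (n : nat) := ae_addr (n%:R * a) aP.
have h' (n : nat) := ae_addr (- (n%:R * a)) aP.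
have := ae_foralln h; have := ae_foralln h'.
apply: filterS2 => t h1 h2 [n|n]; first exact: h2.
by rewrite NegzE mulrNz mulNr; exact: h1.
Qed.

Lemma twopi_gt0 : 0 < 2 * pi :> R.
Proof. by rewrite mulr_gt0// pi_gt0. Qed.

Definition modT (t : R) : R := t - (Num.floor (t / (2 * pi)))%:~R * (2 * pi).

Lemma modT_itv t : 0 <= modT t < 2 * pi.
Proof.
have p0 := twopi_gt0; rewrite /modT subr_ge0 -ler_pdivlMr//.
have /andP[h1 h2] := floor_itv (t / (2 * pi)).
rewrite h1 /= ltrBlDr -[X in X + _]mul1r -mulrDl -ltr_pdivrMr//.
by rewrite intrD1 in h2; rewrite addrC.
Qed.

Lemma measurable_modT (D : set R) : measurable_fun D modT.
Proof.
apply: measurable_funTS; apply: measurable_funB => //; apply: measurable_funM => //.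
apply: nondecreasing_measurable => // s t st.
by rewrite ler_int le_floor// ler_wpM2r// invr_ge0 ltW// twopi_gt0.
Qed.

(** Every [t] is an integer translate of [modT t], a point of one period, so the bad points lie in
    countably many translates of a null set. *)
Lemma ae_periodic (P : R -> Prop) : (forall t, P (t + 2 * pi) -> P t) ->
  (forall t, P t -> P (t + 2 * pi)) ->
  {ae leb, forall t, Tper t -> P t} -> {ae leb, forall t, P t}.
Proof.
move=> P1 P2 aP; have Pk (k : nat) t : P (t + k%:R * (2 * pi)) <-> P t.
  elim: k t => [|k ih] t; first by rewrite mul0r addr0.
  rewrite -natr1 mulrDl mul1r addrA -(ih t); split; [exact: P1|exact: P2].
have Pz (k : int) t : P (t + k%:~R * (2 * pi)) <-> P t.
  case: k => k; first exact: Pk.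
  by rewrite NegzE mulrNz mulNr -(Pk k.+1 (_ - _)) subrK.
apply: ae_imp (ae_int_addr (2 * pi) aP) => t /(_ (- Num.floor (t / (2 * pi)))).
rewrite mulrNz mulNr -/(modT t) => h.
rewrite -(Pz (- Num.floor (t / (2 * pi)))) mulrNz mulNr; apply: h.
by rewrite /Tper /= in_itv /=; have /andP[-> /ltW ->] := modT_itv t.
Qed.

Lemma mTper : measurable (Tper : set R).
Proof. exact: measurable_itv. Qed.

Lemma leb_Tper : leb Tper = (2 * pi)%:E :> \bar R.
Proof.
by rewrite lebesgue_measure_itv /= lte_fin twopi_gt0 oppr0 adde0.
Qed.

Lemma periodic_int (V : Type) (u : R -> V) : (forall t, u (t + 2 * pi) = u t) ->
  forall (k : int) t, u (t + k%:~R * (2 * pi)) = u t.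
Proof.
move=> pu.
have pn (k : nat) t : u (t + k%:R * (2 * pi)) = u t.
  by elim: k => [|k ih]; rewrite ?mul0r ?addr0// -natr1 mulrDl mul1r addrA pu.
by case=> k t; [exact: pn|rewrite NegzE mulrNz mulNr -(pn k.+1 (_ - _)) subrK].
Qed.

Lemma modT_id t : 0 <= t < 2 * pi -> modT t = t.
Proof.
move=> /andP[t0 t1]; rewrite /modT (_ : Num.floor _ = 0) ?mul0r ?subr0//.
apply: floor_def; rewrite add0r mulr0z mulr1z.
by rewrite divr_ge0 ?(ltW twopi_gt0)//= ltr_pdivrMr ?twopi_gt0// mul1r.
Qed.

Lemma modTD t : modT (t + 2 * pi) = modT t.
Proof.
rewrite /modT [(t + _) / _]mulrDl divff ?gt_eqF ?twopi_gt0// floorDrz ?int_num1//.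
by rewrite floor1 intrD; ring.
Qed.

Lemma integral_periodic (f : R -> \bar R) (s : R) :
  measurable_fun setT f -> (forall t, 0 <= f t)%E ->
  (forall t, f (t + 2 * pi) = f t) ->
  (\int[leb]_(t in Tper) f (t + s)%R = \int[leb]_(t in Tper) f t)%E.
Proof.
move=> mf f0 pf.
wlog sT : s / 0 <= s < 2 * pi => [wl|].
  rewrite -[RHS](wl (modT s))//; last exact: modT_itv.
  apply: eq_integral => t _.
  by rewrite /modT addrA -mulNr -mulrNz periodic_int.
have mfD D : measurable_fun D f by exact: measurable_funS mf.
have mfa (D : set R) (a : R) : measurable_fun D (fun t => f (t + a)).
  by apply: measurableT_comp => //; exact: measurable_addr.
have p0 := twopi_gt0; have /andP[s0 s1] := sT.
(* Dropping the right endpoint lets the translated pieces below tile the period exactly. *)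
have bndc (g : R -> \bar R) : measurable_fun setT g -> (forall t, 0 <= g t)%E ->
    (\int[leb]_(t in Tper) g t = \int[leb]_(t in `[0%R, (2 * pi)%R[) g t)%E.
  move=> mg g0.
  rewrite /Tper (_ : [set` `[0, 2 * pi]] = [set` `[0%R, 2 * pi[] `|` [set (2 * pi : R)]); last first.
    by rewrite setUitv1// bnd_simp ltW.
  rewrite ge0_integral_setU//=; last 2 first.
  - exact: measurable_funS mg.
  - by apply/disj_setPRL => t /= ->; rewrite in_itv /= ltxx andbF.
  by rewrite integral_set1 adde0.
rewrite !bndc//.
have E : [set` `[0%R, (2 * pi : R)[] =
  [set` `[0%R, (2 * pi - s)[] `|` [set` `[(2 * pi - s), (2 * pi : R)[].
  by rewrite -itv_bndbnd_setU// bnd_simp; lra.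
(* The shifted period wraps around: the part before [2 * pi - s] moves to [[s, 2 * pi[], and the
   rest moves, after subtracting a period, to [[0, s[]. *)
have I1 : (\int[leb]_(t in `[0%R, (2 * pi - s)%R[) f (t + s)%R =
    \int[leb]_(t in `[s, (2 * pi)%R[) f t)%E.
  rewrite -(@ge0_integral_addr s `[s, (2 * pi)%R[)//.
  congr integral; apply/seteqP; split => t /=; rewrite !in_itv /= => /andP[? ?];
    apply/andP; split; lra.
have I2 : (\int[leb]_(t in `[(2 * pi - s)%R, (2 * pi)%R[) f (t + s)%R =
    \int[leb]_(t in `[0%R, s[) f t)%E.
  rewrite -(@ge0_integral_addr (s - 2 * pi) `[0%R, s[)//.
  rewrite (_ : _ @^-1` _ = [set` `[2 * pi - s, 2 * pi[]); last first.
    by apply/seteqP; split => t /=; rewrite !in_itv /= => /andP[? ?];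
      apply/andP; split; lra.
  by apply: eq_integral => t _; rewrite -[RHS]pf; congr f; ring.
rewrite [in LHS]E ge0_integral_setU//=; first last.
- by apply: lt_disjoint => x y; rewrite !in_itv /= => /andP[_ xs] /andP[sy _]; exact: lt_le_trans sy.
- exact: mfa.
rewrite I1 I2 addeC -ge0_integral_setU//=; first last.
- by apply: lt_disjoint => x y; rewrite !in_itv /= => /andP[_ xs] /andP[sy _]; exact: lt_le_trans sy.
- exact: mfD.
by rewrite -itv_bndbnd_setU// bnd_simp ltW.
Qed.

End Translation.

Arguments sA {R X} s i.
Arguments sc {R X} s i.

(** * Strong measurability and everywhere measurable representatives *)

Section StrongMeasurability.
Context {R : realType} {X : completeNormedModType R[i]}.
Notation leb := (@lebesgue_measure R).
Implicit Types (u v : R -> X) (s : @Defs.sfun R X).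

(* Factoring simple functions through a finite type makes them stable under
   arbitrary pointwise operations. *)
Definition fsimple (Y : Type) (phi : R -> Y) :=
  exists (I : finType) (q : R -> I) (c : I -> Y),
    (forall i, measurable (q @^-1` [set i])) /\ forall t, phi t = c (q t).

Lemma fsimple_comp2 (Y1 Y2 Y : Type) (F : Y1 -> Y2 -> Y) phi psi :
  fsimple phi -> fsimple psi -> fsimple (fun t => F (phi t) (psi t)).
Proof.
move=> [I [q [c [mq cq]]]] [J [r [e [mr er]]]].
exists (I * J)%type, (fun t => (q t, r t)), (fun ij => F (c ij.1) (e ij.2)).
split=> [[i j]|t]; last by rewrite cq er.
rewrite (_ : _ @^-1` _ = q @^-1` [set i] `&` r @^-1` [set j]).
  exact: measurableI.
by apply/seteqP; split => t /= [-> ->].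
Qed.

Lemma fsimple_cst (Y : Type) (y : Y) : fsimple (fun _ => y).
Proof.
exists unit, (fun _ => tt), (fun _ => y); split => // -[].
by rewrite (_ : _ @^-1` _ = setT)//; apply/seteqP.
Qed.

Lemma fsimple_set (A : set R) : measurable A -> fsimple (fun t => `[< A t >]).
Proof.
move=> mA; exists bool, (fun t => `[< A t >]), id; split => // -[].
  by rewrite (_ : _ @^-1` _ = A)//; apply/seteqP; split => t /= /asboolP.
rewrite (_ : _ @^-1` _ = ~` A); first exact: measurableC.
by apply/seteqP; split => t /= => [/asboolPn|/asboolPn/negbTE].
Qed.

Lemma fsimple_precomp (Y : Type) (phi : R -> Y) (g : R -> R) :
  measurable_fun setT g -> fsimple phi -> fsimple (fun t => phi (g t)).
Proof.
move=> mg [I [q [c [mq cq]]]]; exists I, (q \o g), c; split => // i.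
by rewrite -[X in measurable X]setTI comp_preimage; apply: mg => //; exact: mq.
Qed.

(** The pieces of an [sfun] may overlap, so its value at [t] depends on the whole set of indices
    whose pieces contain [t]. This set takes finitely many values, and its level sets are
    disjoint. *)
Definition sf_pattern s (t : R) : {set 'I_(sN s)} := [set i | `[< sA s i t >]]%SET.

Lemma measurable_sf_pattern s P : (forall i, measurable (sA s i)) ->
  measurable (sf_pattern s @^-1` [set P]).
Proof.
move=> ms; rewrite (_ : _ @^-1` _ =
  \bigcap_(i in [set: 'I_(sN s)]) (if i \in P then sA s i else ~` sA s i)).
  apply: fin_bigcap_measurable; first exact: finite_finset.
  by move=> i _; case: ifP => _; [exact: ms|apply: measurableC; exact: ms].
apply/seteqP; split => [t /= <- i _|t h /=].
  by rewrite inE; case: asboolP.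
apply/setP => i; rewrite inE; have := h i I.
by case: ifP => _ /=; [move/asboolT|move/asboolF].
Qed.

Lemma sf_eval_pattern s t : sf_eval s t = \sum_(i in sf_pattern s t) sc s i.
Proof. by rewrite /sf_eval [RHS]big_mkcond; apply: eq_bigr => i _; rewrite inE. Qed.

Lemma fsimple_sf_eval s : (forall i, measurable (sA s i)) -> fsimple (sf_eval s).
Proof.
move=> ms; exists {set 'I_(sN s)}, (sf_pattern s),
  (fun P : {set _} => \sum_(i in P) sc s i).
by split => [P|t]; [exact: measurable_sf_pattern|exact: sf_eval_pattern].
Qed.

Lemma sfun_of_fsimple (D : set R) (phi : R -> X) : measurable D -> fsimple phi ->
  exists s, (forall i, measurable (sA s i) /\ sA s i `<=` D) /\
    forall t, D t -> sf_eval s t = phi t.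
Proof.
move=> mD [I [q [c [mq cq]]]].
exists (SFun (fun i : 'I_#|I| => D `&` q @^-1` [set enum_val i])
  (fun i => c (enum_val i))); split => /=.
  by move=> i; split; [exact: measurableI|exact: subIsetl].
move=> t Dt; rewrite cq /sf_eval /= (bigD1 (enum_rank (q t))) //=.
rewrite asboolT /=; last by split => //=; rewrite enum_rankK.
rewrite enum_rankK big1 ?addr0// => i iq.
rewrite asboolF// => -[_ /= qi]; move: iq; rewrite qi enum_valK eqxx//.
Qed.

(** Convergence is required everywhere, unlike in [strongly_measurable]. This version survives
    composition with any measurable map and makes [nrm (u t)] measurable; by [strongly_measurableP],
    every strongly measurable function agrees a.e. on its domain with one of this kind. *)
Definition Bmeas u := exists phi : nat -> R -> X,
  (forall n, fsimple (phi n)) /\ forall t, (fun n => phi n t) @ \oo --> u t.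

Lemma Bmeas_fsimple u : fsimple u -> Bmeas u.
Proof. by move=> su; exists (fun=> u); split => // t; exact: cvg_cst. Qed.

Lemma Bmeas_comp2 (F : X -> X -> X) u v :
  (forall (a b : nat -> X) (x y : X), a @ \oo --> x -> b @ \oo --> y ->
     (fun n => F (a n) (b n)) @ \oo --> F x y) ->
  Bmeas u -> Bmeas v -> Bmeas (fun t => F (u t) (v t)).
Proof.
move=> cF [phi [sphi phiu]] [psi [spsi psiv]].
exists (fun n t => F (phi n t) (psi n t)); split => [n|t].
  exact: fsimple_comp2.
exact: cF.
Qed.

Lemma BmeasD u v : Bmeas u -> Bmeas v -> Bmeas (fun t => u t + v t).
Proof. by apply: Bmeas_comp2 => a b x y ax bx; exact: cvgD. Qed.

Lemma BmeasZ (a : R[i]) u : Bmeas u -> Bmeas (fun t => a *: u t).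
Proof.
move=> bu; apply: (@Bmeas_comp2 (fun x _ => a *: x) u u) => // b e x y bx _.
exact: cvgZl_tmp.
Qed.

Lemma BmeasB u v : Bmeas u -> Bmeas v -> Bmeas (fun t => u t - v t).
Proof.
by apply: (@Bmeas_comp2 (fun x y => x - y)) => a b x y ax bx; exact: cvgB.
Qed.

Lemma Bmeas_precomp u (g : R -> R) :
  measurable_fun setT g -> Bmeas u -> Bmeas (fun t => u (g t)).
Proof.
move=> mg [phi [sphi phiu]]; exists (fun n t => phi n (g t)).
by split => // n; exact: fsimple_precomp.
Qed.

Import HBSimple.

Lemma Bmeas_scale (g : R -> R) u : measurable_fun setT g -> Bmeas u ->
  Bmeas (fun t => (g t)%:C *: u t).
Proof.
move=> mg [phi [sphi phiu]].
have /measurable_EFinP/(approximation_sfun measurableT)[h hg] := mg.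
exists (fun n t => (h n t)%:C *: phi n t); split => [n|t].
  apply: (@fsimple_comp2 _ _ _ (fun (r : R) (x : X) => r%:C *: x)) => //.
  pose l := fset_set (range (h n)).
  have lP t : h n t \in l by rewrite in_fset_set//; apply/mem_set; exists t.
  exists l, (fun t => [` lP t]%fset), val; split => // i.
  rewrite (_ : _ @^-1` _ = h n @^-1` [set val i]).
    exact: measurable_funPTI.
  by apply/seteqP; split => t /= => [<-//|hi]; exact/val_inj.
have {}hg : (fun n => h n t) @ \oo --> g t.
  by have /fine_cvgP[] := hg t I.
apply/cvg_nrmP.
apply: (@squeeze_cvgr _ _ _ _ (fun=> 0)
  (fun n => `|h n t - g t| * nrm (phi n t) + `|g t| * nrm (phi n t - u t))).
- apply: nearW => n; rewrite nrm_ge0 /= -!nrmZr.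
  rewrite (_ : _ - _ = (h n t - g t)%:C *: phi n t + (g t)%:C *: (phi n t - u t)).
    exact: nrmD.
  by rewrite rmorphB scalerBl scalerBr addrA subrK.
- exact: cvg_cst.
rewrite (_ : 0 = 0 * nrm (u t) + `|g t| * 0); last by rewrite mul0r mulr0 addr0.
apply: cvgD; apply: cvgM; [|exact/cvg_nrm/phiu|exact: cvg_cst|exact/cvg_nrmP/phiu].
rewrite (_ : 0 = `|g t - g t|); last by rewrite subrr normr0.
by apply: cvg_norm; apply: cvgB => //; exact: cvg_cst.
Qed.

(** Splits a unimodular scalar into two real ones, the form that both [Bmeas_scale] and the real
    contraction principle can handle. *)
Lemma expi_scale (th : R) (x : X) :
  expi th *: x = (cos th)%:C *: x + (sin th)%:C *: ((0 +i* 1) *: x).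
Proof.
rewrite scalerA -scalerDl; congr (_ *: _).
by apply/eqP; rewrite eq_complex /=; apply/andP; split; apply/eqP; ring.
Qed.

Lemma Bmeas_expi (a : R) u : Bmeas u -> Bmeas (fun t => expi (a * t) *: u t).
Proof.
move=> bu.
rewrite (_ : (fun _ => _) = (fun t => (cos (a * t))%:C *: u t +
   (sin (a * t))%:C *: ((0 +i* 1) *: u t))); last first.
  by apply/funext => t; rewrite expi_scale.
apply: BmeasD; apply: Bmeas_scale => //; last exact: BmeasZ.
  apply: continuous_measurable_fun => t.
  by apply: continuous_comp; [exact: mulrl_continuous|exact: continuous_cos].
apply: continuous_measurable_fun => t.
by apply: continuous_comp; [exact: mulrl_continuous|exact: continuous_sin].
Qed.

Lemma measurable_nrm_Bmeas u (D : set R) : Bmeas u ->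
  measurable_fun D (fun t => nrm (u t)).
Proof.
move=> [phi [sphi phiu]]; apply: measurable_funTS.
apply: (@measurable_fun_cvg _ _ _ setT (fun n t => nrm (phi n t))).
  move=> n; have [I [q [c [mq cq]]]] := sphi n.
  rewrite (_ : (fun _ => _) = (fun t => nrm (c (q t)))).
    by apply: (fin_measurable_fun (fun i => nrm (c i))) => i; rewrite setTI.
  by apply/funext => t; rewrite cq.
by move=> t _; exact: cvg_nrm.
Qed.

Lemma strongly_measurableP (D : set R) u : measurable D ->
  strongly_measurable D u <->
  exists u', Bmeas u' /\ {ae leb, forall t, D t -> u t = u' t}.
Proof.
move=> mD; split.
  move=> [s [ms [N [mN N0 sN]]]].
  (* Setting everything to [0] outside [D] and on the null set turns a.e. convergence into
     convergence everywhere. *)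
  exists (fun t => if `[< (D `\` N) t >] then u t else 0); split.
    exists (fun n t => if `[< (D `\` N) t >] then sf_eval (s n) t else 0).
    split => [n|t].
      apply: (@fsimple_comp2 _ _ _ (fun (b : bool) (x : X) => if b then x else 0)).
        by apply: fsimple_set; exact: measurableD.
      exact: fsimple_sf_eval.
    case: asboolP => [[Dt Nt]|_]; last exact: cvg_cst.
    by apply: contrapT => h; apply: Nt; apply: sN => /= /(_ Dt).
  exists N; split => // t /= /not_implyP[Dt].
  by case: asboolP => // + _ => /not_andP[//|/contrapT].
move=> [u' [[phi [sphi phiu]] [N [mN N0 sN]]]].
have /choice[s hs] n := sfun_of_fsimple mD (sphi n).
exists s; split; first by move=> n i; have [/(_ i)[]] := hs n.
exists N; split => // t /= /not_implyP[Dt h].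
apply: sN => /= /(_ Dt) uu'; apply: h.
rewrite uu' (_ : (fun _ => _) = (fun n => phi n t))//.
by apply/funext => n; have [_ ->] := hs n.
Qed.

Lemma Bmeas_strongly_measurable (D : set R) u : measurable D -> Bmeas u ->
  strongly_measurable D u.
Proof. by move=> mD bu; apply/strongly_measurableP => //; exists u; split => //; exact: aeW. Qed.

Lemma ae_neq (a : R) : {ae leb, forall t, t <> a}.
Proof.
exists [set a]; split; [exact: measurable_set1|exact: lebesgue_measure_set1|].
by move=> t /= /contrapT.
Qed.

Lemma periodic_Bmeas u : periodic2pi u -> strongly_measurable Tper u ->
  exists u', [/\ Bmeas u', periodic2pi u' & {ae leb, forall t, u t = u' t}].
Proof.
move=> pu /(strongly_measurableP _ mTper)[w [bw uw]].
exists (fun t => w (modT t)); split.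
- exact: Bmeas_precomp (@measurable_modT _ _) bw.
- by move=> t; rewrite modTD.
apply: ae_periodic; try by move=> t; rewrite pu modTD.
(* The endpoint is excluded because [modT] sends [2 * pi] to [0], where [w] need not take the value
   it has at [2 * pi]. *)
apply: ae_imp (ae_and uw (ae_neq (2 * pi))) => t [h t2] Tt.
rewrite modT_id ?h//; move: Tt; rewrite /Tper /= in_itv /= => /andP[-> +] /=.
by rewrite le_eqVlt => /orP[/eqP//|].
Qed.

End StrongMeasurability.

(** * The Bochner integral over one period *)

Section Bochner.
Context {R : realType} {X : completeNormedModType R[i]}.
Notation leb := (@lebesgue_measure R).
Implicit Types (u v : R -> X) (s : @Defs.sfun R X).

Definition L1norm u : \bar R := (\int[leb]_(t in Tper) (nrm (u t))%:E)%E.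

Lemma le_leb (A B : set R) : measurable A -> measurable B -> A `<=` B ->
  (leb A <= leb B)%E.
Proof. by move=> mA mB AB; apply: le_measure => //; exact/mem_set. Qed.

Lemma int_Tper_indic (A : set R) : measurable A -> A `<=` Tper ->
  (\int[leb]_(t in Tper) (\1_A t)%:E)%E = leb A.
Proof. by move=> mA AT; rewrite integral_indic//; [rewrite setIidl|exact: mTper]. Qed.

Lemma sf_admP s : sf_adm Tper s <->
  forall i, measurable (sA s i) /\ sA s i `<=` Tper.
Proof.
split=> h i; first by have [? [? _]] := h i.
have [mi si] := h i; split=> //; split => //.
apply: (@le_lt_trans _ _ (leb Tper)); last by rewrite leb_Tper ltry.
by apply: le_leb => //; exact: mTper.
Qed.

Lemma leb_Tper_lty (A : set R) : measurable A -> (leb (Tper `&` A) < +oo)%E.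
Proof.
move=> mA; apply: (@le_lt_trans _ _ (leb Tper)); last by rewrite leb_Tper ltry.
have mT := @mTper R.
by apply: le_leb => //; exact: measurableI.
Qed.

(** Overlapping pieces are refined into the disjoint level sets of [sf_pattern]. On these the
    integral is a sum of values weighted by measures, and the triangle inequality applies term by
    term. *)
Lemma nrm_sf_int_le s : sf_adm Tper s ->
  ((nrm (sf_int s))%:E <= L1norm (sf_eval s))%E.
Proof.
move=> /sf_admP as_.
have ms i : measurable (sA s i) by have [] := as_ i.
pose q := sf_pattern s.
have mq P : measurable (q @^-1` [set P]) by exact: measurable_sf_pattern.
have mTq P : measurable (Tper `&` q @^-1` [set P]).
  by apply: measurableI => //; exact: mTper.
pose c (P : {set 'I_(sN s)}) := \sum_(i in P) sc s i.
have cq t : sf_eval s t = c (q t) by exact: sf_eval_pattern.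
pose m P := fine (leb (Tper `&` q @^-1` [set P])).
have mE P : leb (Tper `&` q @^-1` [set P]) = (m P)%:E.
  by rewrite /m fineK// ge0_fin_numE// leb_Tper_lty.
have m0 P : 0 <= m P by rewrite fine_ge0.
have lA i : fine (leb (sA s i)) = \sum_(P : {set 'I_(sN s)} | i \in P) m P.
  have -> : leb (sA s i) = (\int[leb]_(t in Tper) ((i \in q t)%:R)%:E)%E.
    rewrite -int_Tper_indic//; last by have [] := as_ i.
    apply: eq_integral => t _; rewrite indicE inE; congr ((_ : bool)%:R%:E).
  have -> : (\int[leb]_(t in Tper) ((i \in q t)%:R)%:E =
      \sum_(P : {set 'I_(sN s)}) ((i \in P)%:R)%:E * (m P)%:E)%E.
    rewrite (eq_bigr _ (fun P _ => congr1 _ (esym (mE P)))).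
    apply: (leb_fin_integral (F := fun P : {set 'I_(sN s)} => (i \in P)%:R)) => //.
    exact: mTper.
  under eq_bigr do rewrite -EFinM.
  rewrite sumEFin /= [RHS]big_mkcond /=; apply: eq_bigr => P _.
  by case: ifP; rewrite ?mul1r ?mul0r.
have -> : sf_int s = \sum_P (m P)%:C *: c P.
  rewrite /sf_int; under eq_bigr do rewrite lA rmorph_sum /= scaler_suml.
  rewrite (exchange_big_dep predT) //=; apply: eq_bigr => P _.
  by rewrite /c scaler_sumr; apply: eq_bigl => i.
have -> : L1norm (sf_eval s) = (\sum_(P : {set 'I_(sN s)}) nrm (c P) * m P)%:E.
  rewrite -sumEFin; under [RHS]eq_bigr do rewrite EFinM -mE.
  rewrite /L1norm; under eq_integral do rewrite cq.
  apply: (leb_fin_integral (F := fun P => nrm (c P))) => //; first exact: mTper.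
  by move=> P; exact: nrm_ge0.
rewrite lee_fin (le_trans (nrm_sum _ _ _))//.
by apply: ler_sum => P _; rewrite nrmZr ger0_norm// mulrC.
Qed.

Definition sf_lin (a : R[i]) s1 s2 : @Defs.sfun R X :=
  @SFun R X (sN s1 + sN s2)
    (fun i => match fintype.split i with inl j => sA s1 j | inr j => sA s2 j end)
    (fun i => match fintype.split i with inl j => a *: sc s1 j | inr j => sc s2 j end).

Lemma sf_lin_eval a s1 s2 t :
  sf_eval (sf_lin a s1 s2) t = a *: sf_eval s1 t + sf_eval s2 t.
Proof.
rewrite /sf_eval /= big_split_ord /= scaler_sumr; congr (_ + _);
  apply: eq_bigr => i _.
  by rewrite (unsplitK (inl i)); case: ifP => //; rewrite scaler0.
by rewrite (unsplitK (inr i)).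
Qed.

Lemma sf_lin_int a s1 s2 : sf_int (sf_lin a s1 s2) = a *: sf_int s1 + sf_int s2.
Proof.
rewrite /sf_int /= big_split_ord /= scaler_sumr; congr (_ + _);
  apply: eq_bigr => i _.
  by rewrite (unsplitK (inl i)) !scalerA mulrC.
by rewrite (unsplitK (inr i)).
Qed.

Lemma sf_lin_adm D a s1 s2 : sf_adm D s1 -> sf_adm D s2 -> sf_adm D (sf_lin a s1 s2).
Proof. by move=> h1 h2 i /=; case: fintype.split. Qed.

Lemma cvge0_lt (f : nat -> \bar R) (e : R) : f @ \oo --> 0%E -> 0 < e ->
  exists N, forall n, (N <= n)%N -> (f n < e%:E)%E.
Proof.
move=> f0 e0.
have [] := f0 [set x | (x < e%:E)%E].
  by apply: open_nbhs_nbhs; split; [exact: open_ereal_lt_ereal|rewrite /= lte_fin].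
by move=> N _ h; exists N.
Qed.

Lemma sf_eval_Bmeas s : sf_adm Tper s -> Bmeas (sf_eval s).
Proof. by move=> h; apply/Bmeas_fsimple/fsimple_sf_eval => i; have [] := h i. Qed.

Lemma L1norm_ge0 u : (0 <= L1norm u)%E.
Proof. by apply: integral_ge0 => t _; rewrite lee_fin nrm_ge0. Qed.

Lemma L1norm_le u v : (forall t, Tper t -> nrm (u t) <= nrm (v t)) -> (L1norm u <= L1norm v)%E.
Proof.
move=> uv; apply: ge0_le_integral_nomeas => t Tt; rewrite lee_fin ?nrm_ge0//.
exact: uv.
Qed.

Lemma measurable_EFin_nrm u (D : set R) : Bmeas u ->
  measurable_fun D (fun t => (nrm (u t))%:E).
Proof. by move=> bu; apply/measurable_EFinP; exact: measurable_nrm_Bmeas. Qed.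

Lemma L1normD_le u v : Bmeas u -> Bmeas v ->
  (L1norm (fun t => u t + v t)%R <= L1norm u + L1norm v)%E.
Proof.
move=> bu bv; have mT := @mTper R.
rewrite /L1norm -ge0_integralD//; first last.
- exact: measurable_EFin_nrm.
- by move=> t _; rewrite lee_fin nrm_ge0.
- exact: measurable_EFin_nrm.
- by move=> t _; rewrite lee_fin nrm_ge0.
apply: ge0_le_integral_nomeas => t _; first by rewrite lee_fin nrm_ge0.
by rewrite -EFinD lee_fin nrmD.
Qed.

Lemma L1norm_ae u v : Bmeas v -> {ae leb, forall t, Tper t -> u t = v t} -> L1norm u = L1norm v.
Proof.
move=> bv uv.
apply: ge0_ae_eq_integral_nomeas; first exact: mTper.
- exact: measurable_EFin_nrm.
- by move=> t _; rewrite lee_fin nrm_ge0.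
- by move=> t _; rewrite lee_fin nrm_ge0.
by apply: ae_imp uv => t h Tt; rewrite h.
Qed.

Lemma L1normZ (a : R[i]) u : Bmeas u ->
  (L1norm (fun t => a *: u t)%R = (complex.Re `|a|)%:E * L1norm u)%E.
Proof.
move=> bu; rewrite /L1norm -ge0_integralZl//; first last.
- by have := normr_ge0 a; rewrite lecE lee_fin => /andP[].
- by move=> t _; rewrite lee_fin nrm_ge0.
- exact: measurable_EFin_nrm.
- exact: mTper.
by apply: eq_integral => t _; rewrite nrmZ EFinM.
Qed.

Lemma strongly_measurable_ae u v : {ae leb, forall t, Tper t -> u t = v t} ->
  strongly_measurable Tper u -> strongly_measurable Tper v.
Proof.
move=> uv /(strongly_measurableP _ mTper)[w [bw uw]].
apply/(strongly_measurableP _ mTper); exists w; split => //.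
by apply: ae_imp (ae_and uv uw) => t [h1 h2] Tt; rewrite -h1// h2.
Qed.

Lemma strongly_measurable_lin (a : R[i]) u v :
  strongly_measurable Tper u -> strongly_measurable Tper v ->
  strongly_measurable Tper (fun t => a *: u t + v t).
Proof.
move=> /(strongly_measurableP _ mTper)[u' [bu uu']] /(strongly_measurableP _ mTper)[v' [bv vv']].
apply/(strongly_measurableP _ mTper); exists (fun t => a *: u' t + v' t); split.
  by apply: BmeasD => //; exact: BmeasZ.
by apply: ae_imp (ae_and uu' vv') => t [h1 h2] Tt; rewrite h1// h2.
Qed.

(** Moves [L1norm] estimates for [u], whose norm may fail to be measurable, to the representative
    [w], where the triangle inequality [L1normD_le] is available. *)
Lemma L1norm_sfB s u w : sf_adm Tper s -> Bmeas w ->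
  {ae leb, forall t, Tper t -> u t = w t} ->
  Bmeas (fun t => sf_eval s t - w t) /\
  L1norm (fun t => sf_eval s t - u t) = L1norm (fun t => sf_eval s t - w t).
Proof.
move=> as_ bw uw; have b : Bmeas (fun t => sf_eval s t - w t).
  by apply: BmeasB => //; exact: sf_eval_Bmeas.
by split => //; apply: L1norm_ae => //; apply: ae_imp uw => t h Tt; rewrite h.
Qed.

Lemma bochner_ae u v c : {ae leb, forall t, Tper t -> u t = v t} ->
  bochner_integral Tper u c -> bochner_integral Tper v c.
Proof.
move=> uv [mu_ [s [as_ [su ic]]]]; split; first exact: strongly_measurable_ae mu_.
exists s; split => //; split => //.
have {}su : (fun n => L1norm (fun t => sf_eval (s n) t - u t)) @ \oo --> 0%E by [].
have /(strongly_measurableP _ mTper)[w [bw uw]] := mu_.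
suff : (fun n => L1norm (fun t => sf_eval (s n) t - v t)) @ \oo --> 0%E by [].
rewrite (_ : (fun n => _) = (fun n => L1norm (fun t => sf_eval (s n) t - u t)))//.
have vw : {ae leb, forall t, Tper t -> v t = w t}.
  by apply: ae_imp (ae_and uv uw) => t [h1 h2] Tt; rewrite -h1// h2.
by apply/funext => n; rewrite (L1norm_sfB (as_ n) bw uw).2 (L1norm_sfB (as_ n) bw vw).2.
Qed.

Lemma bochner_lin (a : R[i]) u v c d : bochner_integral Tper u c ->
  bochner_integral Tper v d ->
  bochner_integral Tper (fun t => a *: u t + v t) (a *: c + d).
Proof.
move=> [mu_ [s [as_ [su ic]]]] [mv [s' [as' [sv id_]]]].
have {}su : (fun n => L1norm (fun t => sf_eval (s n) t - u t)) @ \oo --> 0%E by [].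
have {}sv : (fun n => L1norm (fun t => sf_eval (s' n) t - v t)) @ \oo --> 0%E by [].
split; first exact: strongly_measurable_lin.
exists (fun n => sf_lin a (s n) (s' n)); split; first by move=> n; exact: sf_lin_adm.
have /(strongly_measurableP _ mTper)[u' [bu uu']] := mu_.
have /(strongly_measurableP _ mTper)[v' [bv vv']] := mv.
split; last first.
  under eq_fun do rewrite sf_lin_int.
  by apply: cvgD => //; exact: cvgZl_tmp.
suff : (fun n => L1norm (fun t => sf_eval (sf_lin a (s n) (s' n)) t - (a *: u t + v t)))
  @ \oo --> 0%E by [].
apply: (@squeeze_cvge _ _ _ _ (fun=> 0%E) _ (fun n =>
   (complex.Re `|a|)%:E * (L1norm (fun t => sf_eval (s n) t - u t)%R) +
   L1norm (fun t => sf_eval (s' n) t - v t)%R)%E).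
- apply: nearW => n; rewrite L1norm_ge0 /=.
  have [bsu ->] := L1norm_sfB (as_ n) bu uu'.
  have [bsv ->] := L1norm_sfB (as' n) bv vv'.
  rewrite -L1normZ//; apply: le_trans (L1normD_le _ bsv); last exact: BmeasZ.
  rewrite le_eqVlt; apply/orP; left; apply/eqP; apply: L1norm_ae.
    by apply: BmeasD => //; exact: BmeasZ.
  apply: ae_imp (ae_and uu' vv') => t [h1 h2] Tt; rewrite h1// h2// sf_lin_eval.
  by rewrite scalerBr opprD addrACA.
- exact: cvg_cst.
- rewrite -[X in _ --> X](_ : ((complex.Re `|a|)%:E * 0 + 0 = 0)%E); last by rewrite mule0 adde0.
  by apply: cvgeD => //; apply: cvgeZl.
Qed.

Lemma nrm_bochner_le u c : bochner_integral Tper u c -> ((nrm c)%:E <= L1norm u)%E.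
Proof.
move=> [mu_ [s [as_ [su ic]]]].
have {}su : (fun n => L1norm (fun t => sf_eval (s n) t - u t)) @ \oo --> 0%E by [].
have /(strongly_measurableP _ mTper)[w [bw uw]] := mu_.
apply/lee_addgt0Pr => e e0; have e20 : 0 < e / 2 by rewrite divr_gt0.
have [N hN] := cvge0_lt su e20.
have /cvgrPdist_lt /(_ _ e20)[M _ hM] := cvg_nrm ic.
pose n := maxn N M.
have hn1 := hN n (leq_maxl _ _); have /= hn2 := hM n (leq_maxr _ _).
have [bsu nE] := L1norm_sfB (as_ n) bw uw.
apply: (@le_trans _ _ ((nrm (sf_int (s n)))%:E + (e / 2)%:E)%E).
  rewrite -EFinD lee_fin -lerBlDl (le_trans (ler_norm _))// ltW//.
apply: (@le_trans _ _ ((L1norm u + (e / 2)%:E) + (e / 2)%:E)%E); last first.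
  by rewrite -addeA -EFinD -splitr.
apply: leeD => //; apply: (le_trans (nrm_sf_int_le (as_ n))).
rewrite (L1norm_ae bw uw).
apply: (@le_trans _ _ (L1norm w + L1norm (fun t => sf_eval (s n) t - w t)%R)%E).
  apply: le_trans (L1normD_le bw bsu).
  by apply: L1norm_le => t _; rewrite addrC subrK.
by apply: leeD => //; rewrite -nE ltW.
Qed.

(** By linearity [c - d] is a Bochner integral of the zero function, and the norm of an integral is
    at most the L1 norm. *)
Lemma bochner_unique u c d : bochner_integral Tper u c ->
  bochner_integral Tper u d -> c = d.
Proof.
move=> uc ud; have := nrm_bochner_le (bochner_lin (-1) ud uc).
rewrite /L1norm integral0_eq; last by move=> t _; rewrite scaleN1r addNr nrm0.
rewrite lee_fin => h; apply/eqP; rewrite -subr_eq0 -nrm_eq0.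
by rewrite eq_le nrm_ge0 andbT addrC -scaleN1r.
Qed.

Lemma L1_approx u : strongly_measurable Tper u -> (L1norm u < +oo)%E ->
  exists s : nat -> @Defs.sfun R X, (forall n, sf_adm Tper (s n)) /\
    (fun n => L1norm (fun t => sf_eval (s n) t - u t)) @ \oo --> 0%E.
Proof.
move=> /(strongly_measurableP _ mTper)[w [bw uw]]; rewrite (L1norm_ae bw uw) => wfin.
have mT := @mTper R.
have [phi [sphi phiw]] := bw.
have mw : measurable_fun setT (fun t => nrm (w t)) by exact: measurable_nrm_Bmeas.
(* Truncation supplies a dominating function: an approximant larger than [nrm (w t) + 1] is replaced
   by [0]. At each [t] this stops happening for large [n], so the pointwise limit is unchanged, and
   the error is at most [2 * nrm (w t) + 1], integrable over the bounded period. *)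
pose E n := [set t | nrm (phi n t) <= nrm (w t) + 1].
have mE n : measurable (E n).
  rewrite (_ : E n = setT `&` [set t | nrm (phi n t) <= nrm (w t) + 1]); last by rewrite setTI.
  apply: measurable_fun_le => //; last by apply: measurable_funD.
  by apply: measurable_nrm_Bmeas; exact: Bmeas_fsimple.
pose psi n t := if `[< E n t >] then phi n t else 0.
have spsi n : fsimple (psi n).
  apply: (@fsimple_comp2 _ _ _ _ (fun (b : bool) (x : X) => if b then x else 0)) => //.
  exact: fsimple_set.
have psiw t : (fun n => psi n t) @ \oo --> w t.
  apply: cvg_trans (phiw t); apply: near_eq_cvg.
  have /cvgrPdist_lt /(_ 1 ltr01) := cvg_nrm (phiw t).
  apply: filterS => n h; rewrite /psi asboolT// /E /= -lerBlDl.
  by rewrite ltW// (le_lt_trans _ h)// distrC ler_norm.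
have /choice[s hs] n := sfun_of_fsimple mT (spsi n).
have as_ n : sf_adm Tper (s n) by apply/sf_admP; have [] := hs n.
exists s; split => //.
have bpw n : Bmeas (fun t => psi n t - w t).
  by apply: BmeasB => //; exact: Bmeas_fsimple.
rewrite (_ : (fun n => _) = (fun n => L1norm (fun t => psi n t - w t))); last first.
  apply/funext => n; apply: L1norm_ae => //.
  by apply: ae_imp uw => t h Tt; rewrite h//; have [_ ->] := hs n.
have := @dominated_convergence _ _ _ leb Tper mT
  (fun n t => (nrm (psi n t - w t))%:E) (fun=> 0%E)
  (fun t => ((nrm (w t) + 1) + nrm (w t))%:E).
case.
- by move=> n; exact: measurable_EFin_nrm.
- exact: measurable_cst.
- apply: aeW => t _; have /cvg_nrmP h := psiw t.
  by apply/fine_cvgP; split => //; exact: nearW.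
- under eq_fun do rewrite !EFinD.
  have iw : leb.-integrable Tper (fun t => (nrm (w t))%:E).
    apply/integrableP; split; first exact: measurable_EFin_nrm.
    by under eq_integral do rewrite gee0_abs ?lee_fin ?nrm_ge0//.
  apply: integrableD => //; apply: integrableD => //.
  apply/integrableP; split; first exact: measurable_cst.
  have h : (leb Tper < +oo)%E by rewrite leb_Tper ltry.
  by rewrite /= normr1 integral_cst// mul1e; exact: h.
- apply: aeW => t n _; rewrite gee0_abs ?lee_fin ?nrm_ge0//.
  rewrite (le_trans (ler_nrmB _ _))// lerD2r /psi.
  by case: asboolP => //; rewrite nrm0 addr_ge0 ?nrm_ge0.
by move=> _ _; rewrite integral0.
Qed.

Lemma bochner_exists u : strongly_measurable Tper u -> (L1norm u < +oo)%E ->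
  exists c, bochner_integral Tper u c.
Proof.
move=> mu_ fu; have [s [as_ su]] := L1_approx mu_ fu.
have /(strongly_measurableP _ mTper)[w [bw uw]] := mu_.
suff /cvg_ex[c ic] : cvgn (fun n => sf_int (s n)).
  by exists c; split => //; exists s.
apply: nrm_cauchy_cvg => e e0; have e20 : 0 < e / 2 by rewrite divr_gt0.
have [N hN] := cvge0_lt su e20; exists N => m n /hN hm /hN hn.
(* The difference of two approximants is again a simple function, so its integral is controlled by
   its L1 norm; hence the integrals form a Cauchy sequence. *)
have aS := sf_lin_adm (a := -1) (as_ n) (as_ m).
suff : (L1norm (sf_eval (sf_lin (-1)%R (s n) (s m))) < e%:E)%E.
  move=> h; have := le_lt_trans (nrm_sf_int_le aS) h.
  by rewrite lte_fin sf_lin_int scaleN1r addrC.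
rewrite [e]splitr EFinD; apply: le_lt_trans (lteD hn hm).
have [bn ->] := L1norm_sfB (as_ n) bw uw.
have [bm ->] := L1norm_sfB (as_ m) bw uw.
have -> : L1norm (fun t => sf_eval (s n) t - w t) =
  L1norm (fun t => - 1 *: (sf_eval (s n) t - w t)).
  by apply: eq_integral => t _; rewrite scaleN1r nrmN.
apply: le_trans (L1normD_le (BmeasZ _ bn) bm).
apply: L1norm_le => t _; rewrite sf_lin_eval !scaleN1r opprB.
by rewrite [w t - _ + _]addrC subrKA addrC.
Qed.

Lemma bochner_cst (x : X) : bochner_integral Tper (fun=> x) ((2 * pi)%:C *: x).
Proof.
split.
  by apply: Bmeas_strongly_measurable; [exact: mTper|apply: Bmeas_fsimple; exact: fsimple_cst].
pose s : @Defs.sfun R X := @SFun R X 1 (fun=> Tper) (fun=> x).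
exists (fun=> s); split; first by move=> _; apply/sf_admP => i; split=> //; exact: mTper.
split.
  rewrite (_ : (fun n : nat => _) = (fun=> 0%E)); first exact: cvg_cst.
  apply/funext => n; apply: integral0_eq => t Tt.
  by rewrite /sf_eval /= big_ord1 asboolT// subrr nrm0.
rewrite (_ : sf_int s = (2 * pi)%:C *: x); first exact: cvg_cst.
by rewrite /sf_int /= big_ord1 leb_Tper.
Qed.

Lemma bochner_addr u c (a : R) : periodic2pi u -> bochner_integral Tper u c ->
  bochner_integral Tper (fun t => u (t + a)) c.
Proof.
move=> pu [mu_ [s [as_ [su ic]]]]; have mT := @mTper R.
have {}su : (fun n => L1norm (fun t => sf_eval (s n) t - u t)) @ \oo --> 0%E by [].
have [w [bw pw uw]] := periodic_Bmeas pu mu_.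
have mma : measurable_fun [set: R] (fun t : R => modT (t + a)).
  apply: (@measurableT_comp _ _ _ _ _ _ modT); first exact: measurable_modT.
  exact: measurable_addr.
have uaw : {ae leb, forall t, Tper t -> u (t + a) = w (t + a)}.
  by apply: ae_imp (ae_addr a uw).
have tmod : {ae leb, forall t, Tper t -> modT t = t}.
  apply: ae_imp (ae_neq (2 * pi)) => t t2.
  rewrite /Tper /= in_itv /= => /andP[t0]; rewrite le_eqVlt => /orP[/eqP//|t1].
  by rewrite modT_id// t0 t1.
split.
  apply/(strongly_measurableP _ mT); exists (fun t => w (t + a)); split => //.
  by apply: Bmeas_precomp => //; exact: measurable_addr.
(* The translated pieces are wrapped around modulo the period and cut to [Tper], so that the new
   simple functions stay admissible. *)
pose s' n : @Defs.sfun R X := @SFun R X (sN (s n))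
  (fun i => Tper `&` (fun t => modT (t + a)) @^-1` sA (s n) i) (fun i => sc (s n) i).
have ms n i : measurable (sA (s n) i) by have [] := as_ n i.
have ms' n i : measurable ((fun t => modT (t + a)) @^-1` sA (s n) i).
  by rewrite -[X in measurable X]setTI; apply: mma.
exists s'; split.
  by move=> n; apply/sf_admP => i; split; [exact: measurableI|exact: subIsetl].
split.
  suff : (fun n => L1norm (fun t => sf_eval (s' n) t - u (t + a))) @ \oo --> 0%E by [].
  rewrite (_ : (fun n => _) = (fun n => L1norm (fun t => sf_eval (s n) t - u t)))//.
  apply/funext => n.
  have bF : Bmeas (fun t => sf_eval (s n) (modT t) - w t).
    by apply: BmeasB => //; apply: Bmeas_precomp; [exact: measurable_modT|exact: sf_eval_Bmeas].
  rewrite [RHS](L1norm_ae bF); last first.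
    by apply: ae_imp (ae_and uw tmod) => t [h1 h2] Tt; rewrite h1 h2.
  (* Precomposing the simple function with [modT] makes the approximation error periodic, so its
     integral over one period is translation invariant. *)
  rewrite -[RHS](@integral_periodic _ (fun t => (nrm (sf_eval (s n) (modT t) - w t))%:E) a).
  - apply: (@L1norm_ae _ (fun t => sf_eval (s n) (modT (t + a)) - w (t + a))).
      by apply: Bmeas_precomp bF; exact: measurable_addr.
    apply: ae_imp uaw => t h Tt; rewrite h//; congr (_ - _).
    apply: eq_bigr => i _ /=; congr (if _ then _ else _).
    by apply/asboolP/asboolP => [[]|].
  - exact: measurable_EFin_nrm.
  - by move=> t; rewrite lee_fin nrm_ge0.
  - by move=> t; rewrite modTD pw.
rewrite (_ : (fun n => _) = (fun n => sf_int (s n)))//.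
apply/funext => n; apply: eq_bigr => i _ /=; congr ((fine _)%:C *: _).
have sT : sA (s n) i `<=` Tper by have [_ []] := as_ n i.
transitivity (\int[leb]_(t in Tper) (\1_(sA (s n) i) (modT (t + a)))%:E)%E.
  rewrite -int_Tper_indic//; first last.
    exact: measurableI.
  apply: eq_integral => t /set_mem Tt; rewrite !indicE; congr ((_ : bool)%:R%:E).
  by apply/idP/idP => /set_mem h; apply/mem_set => //; case: h.
rewrite (@integral_periodic _ (fun t => (\1_(sA (s n) i) (modT t))%:E) a).
- transitivity (\int[leb]_(t in Tper) (\1_(sA (s n) i) t)%:E)%E; last exact: int_Tper_indic.
  apply: ge0_ae_eq_integral_nomeas => //.
  + by apply/measurable_EFinP; apply: measurable_indic; exact: (ms n i).
  + by apply: ae_imp tmod => t h Tt; rewrite h.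
- by apply/measurable_EFinP; apply: measurableT_comp => //; exact: measurable_modT.
- by move=> t; rewrite lee_fin.
- by move=> t; rewrite modTD.
Qed.

End Bochner.

(** * The L^p seminorm and Minkowski's inequality *)

Section LpNorm.
Context {R : realType} {X : completeNormedModType R[i]} (p : R).
Hypothesis p1 : 1 <= p.
Notation leb := (@lebesgue_measure R).
Implicit Types (u v w : R -> X).

Let p0 : 0 < p. Proof. exact: lt_le_trans p1. Qed.

Definition Lpint u : \bar R := (\int[leb]_(t in Tper) (nrm (u t) `^ p)%:E)%E.

(** Since [fine] sends [+oo] to [0], a bound on [Lpnorm u] carries information only together with
    finiteness of [Lpint u]. *)
Definition Lpnorm u : R := fine (Lpint u) `^ p^-1.

Lemma LpnormE u : Lpnorm u = fine (Lpint u) `^ p^-1.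
Proof. by []. Qed.

Lemma Lpnorm_ge0 u : 0 <= Lpnorm u.
Proof. exact: powR_ge0. Qed.

Opaque Lpnorm.

Lemma Lpint_ge0 u : (0 <= Lpint u)%E.
Proof. by apply: integral_ge0 => t _; rewrite lee_fin powR_ge0. Qed.

Lemma powRVK (x : R) : 0 <= x -> (x `^ p^-1) `^ p = x.
Proof. by move=> x0; rewrite -powRrM mulVf ?gt_eqF// powRr1. Qed.

Lemma LpintE u : (Lpint u < +oo)%E -> Lpint u = (Lpnorm u `^ p)%:E.
Proof.
move=> fu; rewrite LpnormE powRVK ?fine_ge0 ?Lpint_ge0// fineK// ge0_fin_numE//.
exact: Lpint_ge0.
Qed.

Lemma Lpint_Lpnorm_le u (c : R) : 0 <= c -> (Lpint u <= (c `^ p)%:E)%E -> Lpnorm u <= c.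
Proof.
move=> c0 h; have fu : (Lpint u < +oo)%E by rewrite (le_lt_trans h) ?ltry.
move: h; rewrite LpintE// lee_fin => h.
have := @ge0_ler_powR _ p^-1; rewrite invr_ge0 (ltW p0) => /(_ isT) mono.
have /mono : Lpnorm u `^ p \in Num.nneg by rewrite nnegrE powR_ge0.
move=> /(_ (c `^ p)); rewrite nnegrE powR_ge0 => /(_ isT h).
have K (z : R) : 0 <= z -> (z `^ p) `^ p^-1 = z.
  by move=> z0; rewrite -powRrM divff ?gt_eqF// powRr1.
by rewrite (K _ (Lpnorm_ge0 u)) (K _ c0).
Qed.

Lemma Lpnorm_Lpint_le u (c : R) : (Lpint u < +oo)%E -> Lpnorm u <= c -> (Lpint u <= (c `^ p)%:E)%E.
Proof.
move=> fu uc; rewrite LpintE// lee_fin ge0_ler_powR ?nnegrE ?(ltW p0) ?Lpnorm_ge0//.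
by rewrite (le_trans _ uc)// Lpnorm_ge0.
Qed.

Lemma measurable_nrm_powR u (D : set R) : Bmeas u ->
  measurable_fun D (fun t => (nrm (u t) `^ p)%:E).
Proof.
move=> bu; apply/measurable_EFinP.
apply: (@measurableT_comp _ _ _ _ _ _ (fun x : R => x `^ p)) => //.
exact: measurable_nrm_Bmeas.
Qed.

Lemma Lpint_ae u v : Bmeas v -> {ae leb, forall t, Tper t -> u t = v t} -> Lpint u = Lpint v.
Proof.
move=> bv uv; apply: ge0_ae_eq_integral_nomeas; first exact: mTper.
- exact: measurable_nrm_powR.
- by move=> t _; rewrite lee_fin powR_ge0.
- by move=> t _; rewrite lee_fin powR_ge0.
by apply: ae_imp uv => t h Tt; rewrite h.
Qed.

(** Convexity of the p-th power at the points [x / a] and [y / b], with weights [a / (a + b)] and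
    [b / (a + b)]. Integrating it, with [a] and [b] bounding the norms of two functions, gives
    Minkowski's inequality. *)
Lemma convex_powR_scaled (a b x y : R) : 0 < a -> 0 < b -> 0 <= x -> 0 <= y ->
  (x + y) `^ p <=
  (a + b) `^ p * (a / (a + b) * (x `^ p / a `^ p) + b / (a + b) * (y `^ p / b `^ p)).
Proof.
move=> a0 b0 x0 y0; have ab0 : 0 < a + b by rewrite addr_gt0.
have t01 : 0 <= a / (a + b) <= 1.
  apply/andP; split; first by rewrite divr_ge0// ltW.
  by rewrite ler_pdivrMr// mul1r lerDl ltW.
have hx : x / a \in `[0, +oo[%classic.
  by apply/mem_set; rewrite /= in_itv /= andbT divr_ge0// ltW.
have hy : y / b \in `[0, +oo[%classic.
  by apply/mem_set; rewrite /= in_itv /= andbT divr_ge0// ltW.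
have /andP[t0 t1] := t01.
have : (a / (a + b) * (x / a) + (1 - a / (a + b)) * (y / b)) `^ p <=
    a / (a + b) * (x / a) `^ p + (1 - a / (a + b)) * (y / b) `^ p.
  by have := convex_powR p1 (Itv01 t0 t1) hx hy; rewrite !convRE.
have -> : 1 - a / (a + b) = b / (a + b) by field; rewrite gt_eqF.
have -> : a / (a + b) * (x / a) + b / (a + b) * (y / b) = (x + y) / (a + b).
  by field; rewrite !gt_eqF.
rewrite !powRM ?invr_ge0 ?addr_ge0// ?(ltW a0) ?(ltW b0)//.
have V (z : R) : 0 < z -> z^-1 `^ p = (z `^ p)^-1.
  by move=> z0; rewrite -(powR_inv1 (ltW z0)) -powRrM mulN1r powRN.
rewrite !V// => h.
rewrite -ler_pdivrMl ?powR_gt0// mulrC; exact: h.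
Qed.

Lemma LpintD_le u v (a b : R) : Bmeas u -> Bmeas v -> 0 < a -> 0 < b ->
  (Lpint u <= (a `^ p)%:E)%E -> (Lpint v <= (b `^ p)%:E)%E ->
  (Lpint (fun t => u t + v t)%R <= ((a + b) `^ p)%:E)%E.
Proof.
move=> bu bv a0 b0 ua vb; have ab0 : 0 < a + b by rewrite addr_gt0.
have mT := @mTper R.
pose al := (a + b) `^ p * (a / (a + b)) / a `^ p.
pose be := (a + b) `^ p * (b / (a + b)) / b `^ p.
have al0 : 0 <= al by rewrite !mulr_ge0 ?invr_ge0 ?powR_ge0// ltW.
have be0 : 0 <= be by rewrite !mulr_ge0 ?invr_ge0 ?powR_ge0// ltW.
apply: (@le_trans _ _ (al%:E * Lpint u + be%:E * Lpint v)%E).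
  rewrite /Lpint -ge0_integralZl ?lee_fin//; last 2 first.
  - exact: measurable_nrm_powR.
  - by move=> t _; rewrite lee_fin powR_ge0.
  rewrite -ge0_integralZl ?lee_fin//; last 2 first.
  - exact: measurable_nrm_powR.
  - by move=> t _; rewrite lee_fin powR_ge0.
  rewrite -ge0_integralD//; first last.
  - by apply: measurable_funeM; exact: measurable_nrm_powR.
  - by move=> t _; rewrite mule_ge0 ?lee_fin ?powR_ge0.
  - by apply: measurable_funeM; exact: measurable_nrm_powR.
  - by move=> t _; rewrite mule_ge0 ?lee_fin ?powR_ge0.
  apply: ge0_le_integral_nomeas => t _; first by rewrite lee_fin powR_ge0.
  rewrite -!EFinM -EFinD lee_fin.
  apply: (@le_trans _ _ ((nrm (u t) + nrm (v t)) `^ p)).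
    by rewrite ge0_ler_powR ?nnegrE ?(ltW p0) ?nrm_ge0 ?addr_ge0 ?nrm_ge0// nrmD.
  rewrite (le_trans (convex_powR_scaled a0 b0 (nrm_ge0 _) (nrm_ge0 _)))//.
  by rewrite /al /be le_eqVlt; apply/orP; left; apply/eqP; ring.
apply: (@le_trans _ _ (al%:E * (a `^ p)%:E + be%:E * (b `^ p)%:E)%E).
  by apply: leeD; apply: lee_wpmul2l => //; rewrite lee_fin.
rewrite -!EFinM -EFinD lee_fin /al /be !divfK ?gt_eqF ?powR_gt0//.
by rewrite -mulrDr -mulrDl divff ?gt_eqF// mulr1.
Qed.

Lemma LpintZ (a : R[i]) u : Bmeas u ->
  (Lpint (fun t => a *: u t)%R = ((complex.Re `|a|) `^ p)%:E * Lpint u)%E.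
Proof.
move=> bu; rewrite /Lpint -ge0_integralZl//; first last.
- by rewrite lee_fin powR_ge0.
- by move=> t _; rewrite lee_fin powR_ge0.
- exact: measurable_nrm_powR.
- exact: mTper.
apply: eq_integral => t _; rewrite nrmZ powRM ?EFinM ?nrm_ge0//.
by have := normr_ge0 a; rewrite lecE => /andP[].
Qed.

(* Integrate [x <= 1 + x^p] at [x := nrm (u t) / c]. *)
Lemma L1norm_Lpnorm_le u (c : R) : strongly_measurable Tper u -> 0 < c ->
  (Lpint u <= (c `^ p)%:E)%E -> (L1norm u <= ((2 * pi + 1) * c)%:E)%E.
Proof.
move=> /(strongly_measurableP _ mTper)[w [bw uw]] c0.
rewrite (Lpint_ae bw uw) (L1norm_ae bw uw) => wc; have mT := @mTper R.
apply: (@le_trans _ _ (\int[leb]_(t in Tper) c%:E +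
   (c / c `^ p)%:E * Lpint w)%E); last first.
  apply: (@le_trans _ _ (c%:E * (2 * pi)%:E + (c / c `^ p)%:E * (c `^ p)%:E)%E).
    apply: leeD; first by rewrite integral_cst// -leb_Tper.
    by apply: lee_wpmul2l => //; rewrite lee_fin divr_ge0 ?powR_ge0 ?ltW.
  rewrite -!EFinM -EFinD lee_fin divfK ?gt_eqF ?powR_gt0//.
  by rewrite le_eqVlt; apply/orP; left; apply/eqP; ring.
rewrite /Lpint -ge0_integralZl//; first last.
- by rewrite lee_fin divr_ge0 ?powR_ge0 ?ltW.
- by move=> t _; rewrite lee_fin powR_ge0.
- exact: measurable_nrm_powR.
rewrite -ge0_integralD//; first last.
- by apply: measurable_funeM; exact: measurable_nrm_powR.
- by move=> t _; rewrite mule_ge0 ?lee_fin ?powR_ge0 ?divr_ge0 ?powR_ge0 ?ltW.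
- by move=> t _; rewrite lee_fin ltW.
apply: ge0_le_integral_nomeas => t _; first by rewrite lee_fin nrm_ge0.
rewrite -EFinM -EFinD lee_fin.
have [xc|xc] := leP (nrm (w t)) c.
  by rewrite (le_trans xc)// lerDl mulr_ge0 ?divr_ge0 ?powR_ge0 ?ltW.
rewrite (@le_trans _ _ (c / c `^ p * nrm (w t) `^ p))//; last by rewrite lerDr ltW.
rewrite mulrAC -mulrA -powR_inv1 ?powR_ge0// -powRrM mulrN1.
have x1 : 1 <= nrm (w t) / c by rewrite ler_pdivlMr// mul1r ltW.
have h : nrm (w t) / c <= (nrm (w t) / c) `^ p.
  by rewrite -[X in X <= _]powRr1 ?(le_trans _ x1)// ler_powR.
rewrite -ler_pdivrMl// mulrC (le_trans h)//.
rewrite powRM ?invr_ge0 ?nrm_ge0 ?(ltW c0)// -[c^-1](powR_inv1 (ltW c0)).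
by rewrite -powRrM mulN1r mulrC.
Qed.

Lemma Lp_Lpint u : Lp_per p u -> (Lpint u < +oo)%E.
Proof. by move=> [_ []]. Qed.

Lemma Lp_rep u : Lp_per p u ->
  exists w, [/\ Bmeas w, periodic2pi w, {ae leb, forall t, u t = w t} & Lpint u = Lpint w].
Proof.
move=> [pu [mu_ fu]]; have [w [bw pw uw]] := periodic_Bmeas pu mu_.
by exists w; split=> //; apply: Lpint_ae => //; apply: ae_imp uw.
Qed.

Lemma Lp_ae u v : periodic2pi v -> {ae leb, forall t, Tper t -> u t = v t} ->
  Lp_per p u -> Lp_per p v /\ Lpnorm v = Lpnorm u.
Proof.
move=> pv uv [pu [mu_ fu]].
have /(strongly_measurableP _ mTper)[w [bw uw]] := mu_.
have vw : {ae leb, forall t, Tper t -> v t = w t}.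
  by apply: ae_imp (ae_and uv uw) => t [h1 h2] Tt; rewrite -h1// h2.
have E : Lpint v = Lpint u by rewrite (Lpint_ae bw vw) (Lpint_ae bw uw).
split; last by rewrite !LpnormE E.
split => //; split; first exact: strongly_measurable_ae mu_.
by move: fu; rewrite -/(Lpint u) -E.
Qed.

Lemma LpD u v : Lp_per p u -> Lp_per p v ->
  Lp_per p (fun t => u t + v t) /\ Lpnorm (fun t => u t + v t) <= Lpnorm u + Lpnorm v.
Proof.
move=> Lu Lv; have [u' [bu pu' uu' Eu]] := Lp_rep Lu.
have [v' [bv pv' vv' Ev]] := Lp_rep Lv.
have Ew : Lpint (fun t => u t + v t) = Lpint (fun t => u' t + v' t).
  by apply: Lpint_ae; [exact: BmeasD|apply: ae_imp (ae_and uu' vv') => t [-> ->]].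
(* The slack [e] is split in two so that both radii passed to [LpintD_le] are strictly positive,
   even when a norm vanishes. *)
have key (e : R) : 0 < e -> (Lpint (fun t => u t + v t)%R <= ((Lpnorm u + Lpnorm v + e) `^ p)%:E)%E.
  move=> e0; rewrite Ew.
  have -> : Lpnorm u + Lpnorm v + e = (Lpnorm u + e / 2) + (Lpnorm v + e / 2).
    by rewrite addrACA -splitr.
  have e20 : 0 < e / 2 by rewrite divr_gt0.
  have ua := ltr_wpDl (Lpnorm_ge0 u) e20; have va := ltr_wpDl (Lpnorm_ge0 v) e20.
  apply: (LpintD_le bu bv ua va).
    by rewrite -Eu; apply: Lpnorm_Lpint_le; [exact: Lp_Lpint|rewrite lerDl ltW].
  by rewrite -Ev; apply: Lpnorm_Lpint_le; [exact: Lp_Lpint|rewrite lerDl ltW].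
have [pu [mu_ _]] := Lu; have [pv [mv _]] := Lv.
split.
  split; first by move=> t; rewrite pu pv.
  split; last by have := key 1 ltr01; move/le_lt_trans; apply; rewrite ltry.
  have := strongly_measurable_lin 1 mu_ mv.
  by under [X in strongly_measurable _ X]eq_fun do rewrite scale1r.
apply/ler_addgt0Pr => e e0; apply: Lpint_Lpnorm_le; last exact: key.
by rewrite !addr_ge0 ?Lpnorm_ge0// ltW.
Qed.

Lemma LpZ (a : R[i]) u : Lp_per p u ->
  Lp_per p (fun t => a *: u t) /\ Lpnorm (fun t => a *: u t) = complex.Re `|a| * Lpnorm u.
Proof.
move=> Lu; have [u' [bu pu' uu' Eu]] := Lp_rep Lu.
have Ew : Lpint (fun t => a *: u t) = (((complex.Re `|a|) `^ p)%:E * Lpint u)%E.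
  rewrite Eu -(LpintZ a bu); apply: Lpint_ae; first exact: BmeasZ.
  by apply: ae_imp uu' => t ->.
have a0 : 0 <= complex.Re `|a| by have := normr_ge0 a; rewrite lecE => /andP[].
have [pu [mu_ fu]] := Lu; split.
  split; first by move=> t; rewrite pu.
  split.
    have := strongly_measurable_lin a mu_ (Bmeas_strongly_measurable mTper (Bmeas_fsimple (fsimple_cst 0))).
    by under [X in strongly_measurable _ X]eq_fun do rewrite addr0.
  rewrite -/(Lpint _) Ew LpintE; last exact: Lp_Lpint.
  by rewrite -EFinM ltry.
rewrite [LHS]LpnormE Ew LpintE; last exact: Lp_Lpint.
rewrite -EFinM /= -powRM ?Lpnorm_ge0// -powRrM divff ?gt_eqF// powRr1//.
by rewrite mulr_ge0 ?Lpnorm_ge0.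
Qed.

Lemma Lp0 : Lp_per p (fun=> 0 : X) /\ Lpnorm (fun=> 0) = 0.
Proof.
have i0 : Lpint (fun=> 0) = 0%E.
  by apply: integral0_eq => t _; rewrite nrm0 powR0// gt_eqF.
split; last by rewrite LpnormE i0 /= powR0// invr_eq0 gt_eqF.
split=> //; split; last by rewrite -/(Lpint _) i0.
exact: (Bmeas_strongly_measurable mTper (Bmeas_fsimple (fsimple_cst 0))).
Qed.

Lemma LpB u v : Lp_per p u -> Lp_per p v ->
  Lp_per p (fun t => u t - v t) /\ Lpnorm (fun t => u t - v t) <= Lpnorm u + Lpnorm v.
Proof.
move=> Lu Lv; have [Lv' Nv'] := LpZ (-1) Lv.
have [L N] := LpD Lu Lv'.
have E : (fun t => u t + -1 *: v t) = (fun t => u t - v t).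
  by apply/funext => t; rewrite scaleN1r.
by rewrite E Nv' normrN1 mul1r in L N.
Qed.

Lemma Lp_sum (I : Type) (l : seq I) (F : I -> R -> X) :
  (forall i, Lp_per p (F i)) ->
  Lp_per p (fun t => \sum_(i <- l) F i t) /\
  Lpnorm (fun t => \sum_(i <- l) F i t) <= \sum_(i <- l) Lpnorm (F i).
Proof.
move=> LF; elim: l => [|i l [L N]].
  under [X in Lp_per _ X]eq_fun do rewrite big_nil.
  under [X in Lpnorm X]eq_fun do rewrite big_nil.
  by rewrite big_nil; have [? ->] := Lp0.
under [X in Lp_per _ X]eq_fun do rewrite big_cons.
under [X in Lpnorm X]eq_fun do rewrite big_cons.
have [? h] := LpD (LF i) L; split => //.
by rewrite big_cons (le_trans h)// lerD2l.
Qed.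

Lemma Lpnorm0_ae u : Lp_per p u -> Lpnorm u = 0 -> {ae leb, forall t, u t = 0}.
Proof.
move=> Lu Nu; have [w [bw pw uw E]] := Lp_rep Lu.
have iw : Lpint w = 0%E by rewrite -E LpintE ?Nu ?powR0 ?gt_eqF//; exact: Lp_Lpint.
suff h : {ae leb, forall t, Tper t -> w t = 0}.
  have pw0 : {ae leb, forall t, w t = 0}.
    by apply: ae_periodic h => t; rewrite pw.
  by apply: ae_imp (ae_and uw pw0) => t [-> ->].
have := @ae_eq_integral_abs _ _ _ leb Tper (@mTper R) (fun t => (nrm (w t) `^ p)%:E)
  (measurable_nrm_powR bw).
move=> [h _].
have : ae_eq leb Tper (fun t => (nrm (w t) `^ p)%:E) (cst 0%E).
  apply: h; rewrite -[RHS]iw; apply: eq_integral => t _.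
  by rewrite gee0_abs// lee_fin powR_ge0.
apply: ae_imp => t h' Tt; have [] := h' Tt => /eqP.
rewrite powR_eq0 nrm_eq0 => /andP[/eqP//].
Qed.

End LpNorm.

(** * Convergence of series in L^p, and completeness *)

Section LpSeries.
Context {R : realType} {X : completeNormedModType R[i]} (p : R).
Hypothesis p1 : 1 <= p.
Notation leb := (@lebesgue_measure R).
Implicit Types (u v w : R -> X).

Let p0 : 0 < p. Proof. exact: lt_le_trans p1. Qed.

Lemma cvg_powR (a : nat -> R) (l : R) : (forall n, 0 <= a n) -> a @ \oo --> l ->
  (fun n => a n `^ p) @ \oo --> l `^ p.
Proof.
move=> a0 al; have l0 : 0 <= l.
  rewrite -(cvg_lim _ al)//; apply: limr_ge; first by apply/cvg_ex; exists l.
  exact: nearW.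
have [l0'|] := eqVneq l 0; last first.
  move=> ln0; have lp : 0 < l by rewrite lt_def ln0.
  apply: (@cvg_comp _ _ _ a (fun x : R => x `^ p) _ _ _ al).
  have : derivable (fun x : R => x `^ p) l 1.
    by apply: derivable_powR; rewrite in_itv /= andbT.
  by move/derivable1_diffP/differentiable_continuous.
(* The limit [0] lies outside the open half-line where the power is differentiated. Here the p-th
   power of [a n] is at most [a n] once [a n <= 1], because [1 <= p]. *)
rewrite l0' powR0 ?gt_eqF//; rewrite l0' in al.
apply: (squeeze_cvgr _ (cvg_cst 0) al).
move/cvgrPdist_le : al => /(_ 1 ltr01); apply: filterS => n.
rewrite sub0r normrN ger0_norm// => an1; rewrite powR_ge0 /=.
have [->|an0] := eqVneq (a n) 0; first by rewrite powR0// gt_eqF.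
rewrite -[X in _ <= X]powRr1//; apply: ger_powR => //.
by rewrite an1 andbT lt_def an0 a0.
Qed.

(** Bounds that at least halve at each step are the form of summability used from here on: the tail
    starting at [n] sums to at most [2 * r n]. *)
Lemma halving_sum (r : nat -> R) (n m : nat) : (forall n, 0 < r n) ->
  (forall n, r n.+1 <= r n / 2) -> \sum_(i < m) r (n + i)%N <= 2 * r n.
Proof.
move=> r0 rh.
(* The induction needs the sharper bound, with the remaining tail subtracted. *)
suff h : \sum_(i < m) r (n + i)%N <= 2 * r n - 2 * r (n + m)%N.
  by rewrite (le_trans h)// gerBl mulr_ge0// ltW.
elim: m => [|m ih]; first by rewrite big_ord0 addn0 subrr.
rewrite big_ord_recr /= addnS; have := rh (n + m)%N; have := r0 (n + m)%N.
by move: ih; move: (\sum_(i < m) _) => S; lra.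
Qed.

Lemma halving_cvg0 (r : nat -> R) : (forall n, 0 < r n) ->
  (forall n, r n.+1 <= r n / 2) -> r @ \oo --> (0 : R).
Proof.
move=> r0 rh.
have : cvgn (series r).
  apply: nondecreasing_is_cvgn.
    by apply: nondecreasing_series => n _ _; exact: ltW.
  exists (2 * r 0%N) => _ [n _ <-]; have := halving_sum 0 n r0 rh.
  by rewrite /series /= big_mkord.
exact: cvg_series_cvg_0.
Qed.

(** The sum of the norms has integral at most [2 * r 0] by monotone convergence, so it is finite
    a.e., which gives absolute convergence there. *)
Lemma summable_ae (f : nat -> R -> X) (r : nat -> R) :
  (forall n, 0 < r n) -> (forall n, r n.+1 <= r n / 2) ->
  (forall n, Bmeas (f n)) -> (forall n, (L1norm (f n) <= (r n)%:E)%E) ->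
  {ae leb, forall t, Tper t -> cvgn (series (fun n => nrm (f n t)))}.
Proof.
move=> r0 rh bf nf; have mT := @mTper R.
pose g t : \bar R := (\sum_(n <oo) (nrm (f n t))%:E)%E.
have g0 t : (0 <= g t)%E by apply: nneseries_ge0 => n _ _; rewrite lee_fin nrm_ge0.
have mg : measurable_fun Tper g.
  apply: ge0_emeasurable_sum => // n; first by move=> t _ _; rewrite lee_fin nrm_ge0.
  by move=> _; exact: measurable_EFin_nrm.
have ig : leb.-integrable Tper g.
  apply/integrableP; split => //.
  under eq_integral do rewrite gee0_abs//.
  rewrite /g integral_nneseries//; last 2 first.
  - by move=> n; exact: measurable_EFin_nrm.
  - by move=> n t _; rewrite lee_fin nrm_ge0.
  apply: (@le_lt_trans _ _ (2 * r 0%N)%:E); last exact: ltry.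
  apply: lime_le.
    by apply: is_cvg_nneseries => n _ _; exact: L1norm_ge0.
  apply: nearW => n; apply: (@le_trans _ _ (\sum_(0 <= i < n) (r i)%:E)%E).
    by apply: lee_sum => i _; exact: nf.
  by rewrite sumEFin lee_fin big_mkord; exact: (halving_sum 0 n r0 rh).
have fg : {ae leb, forall t, Tper t -> g t \is a fin_num} .
  exact: (@integrable_ae _ _ R leb Tper mT g ig).
apply: ae_imp fg => t h Tt.
have gf := h Tt.
apply: nondecreasing_is_cvgn.
  by apply: nondecreasing_series => n _ _; exact: nrm_ge0.
exists (fine (g t)) => _ [n _ <-].
rewrite -lee_fin fineK// /series /= -sumEFin.
by apply: nneseries_lim_ge => i _ _; rewrite lee_fin nrm_ge0.
Qed.

Lemma Lp_L1norm u : Lp_per p u -> (L1norm u < +oo)%E.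
Proof.
move=> Lu; have [_ [mu_ _]] := Lu.
have c0 : 0 < Lpnorm p u + 1 by rewrite ltr_wpDl// Lpnorm_ge0.
have /(L1norm_Lpnorm_le p1 mu_ c0)/le_lt_trans : (Lpint p u <= ((Lpnorm p u + 1) `^ p)%:E)%E.
  by apply: Lpnorm_Lpint_le => //; [exact: Lp_Lpint|rewrite lerDl].
by apply; rewrite ltry.
Qed.

Definition psum (f : nat -> R -> X) n (t : R) : X := \sum_(i < n) f i t.

Lemma series_psum (f : nat -> R -> X) t : series (fun n => f n t) = psum f ^~ t.
Proof. by apply/funext => n; rewrite /series /= big_mkord. Qed.

Lemma Lp_psum (f : nat -> R -> X) n : (forall n, Lp_per p (f n)) ->
  Lp_per p (psum f n).
Proof. by move=> Lf; exact: (Lp_sum p1 (index_enum 'I_n) (fun i : 'I_n => Lf i)).1. Qed.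

Lemma psum_tail_Lpnorm (f : nat -> R -> X) (r : nat -> R) n m :
  (forall n, Lp_per p (f n)) -> (forall n, 0 < r n) ->
  (forall n, r n.+1 <= r n / 2) -> (forall n, Lpnorm p (f n) <= r n) ->
  Lpnorm p (fun t => psum f (n + m) t - psum f n t) <= 2 * r n.
Proof.
move=> Lf r0 rh Nf.
have -> : (fun t => psum f (n + m) t - psum f n t) =
    (fun t => \sum_(i < m) f (n + i)%N t).
  by apply/funext => t; rewrite /psum [X in X - _]big_split_ord /= addrAC subrr add0r.
rewrite (le_trans (Lp_sum p1 _ (fun i : 'I_m => Lf (n + i)%N)).2)//.
by rewrite (le_trans (ler_sum _ (fun (i : 'I_m) _ => Nf (n + i)%N)))// halving_sum.
Qed.

(** On the bounded period an L^p bound implies an L^1 bound up to the factor [2 * pi + 1], and this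
    factor preserves halving; so [summable_ae] applies to representatives of the terms. *)
Lemma Lp_series_ae (f : nat -> R -> X) (r : nat -> R) :
  (forall n, Lp_per p (f n)) -> (forall n, 0 < r n) ->
  (forall n, r n.+1 <= r n / 2) -> (forall n, Lpnorm p (f n) <= r n) ->
  {ae leb, forall t, cvgn (psum f ^~ t)}.
Proof.
move=> Lf r0 rh Nf.
have /choice[w hw] n : exists w, [/\ Bmeas w, periodic2pi w,
   {ae leb, forall t, f n t = w t} & Lpint p (f n) = Lpint p w] by exact: Lp_rep.
have K0 : 0 < 2 * pi + 1 :> R by rewrite addr_gt0// twopi_gt0.
have nw n : (L1norm (w n) <= ((2 * pi + 1) * r n)%:E)%E.
  have [bw _ fw _] := hw n.
  have [_ [mf _]] := Lf n.
  rewrite -(@L1norm_ae _ _ (f n) _ bw); last by apply: ae_imp fw.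
  by apply: (L1norm_Lpnorm_le p1) => //; apply: Lpnorm_Lpint_le => //; exact: Lp_Lpint.
have h : {ae leb, forall t, Tper t -> cvgn (series (fun n => nrm (w n t)))}.
  apply: (@summable_ae _ (fun n => (2 * pi + 1) * r n)) => //.
  - by move=> n; rewrite mulr_gt0.
  - by move=> n; rewrite -mulrA ler_wpM2l// ltW.
  - by move=> n; have [] := hw n.
have h' : {ae leb, forall t, cvgn (series (fun n => nrm (w n t)))}.
  have E t : (fun n => nrm (w n (t + 2 * pi))) = (fun n => nrm (w n t)).
    by apply/funext => n; have [_ -> _ _] := hw n.
  by apply: ae_periodic h => t; rewrite E.
have fw : {ae leb, forall t, forall n, f n t = w n t}.
  by apply: ae_foralln => n; have [] := hw n.
apply: ae_imp (ae_and h' fw) => t [/cvg_nrm_series ct ft].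
rewrite -series_psum (_ : (fun n => f n t) = (fun n => w n t))//.
by apply/funext.
Qed.

Lemma Lp_series_limit (f : nat -> R -> X) (r : nat -> R) u :
  (forall n, Lp_per p (f n)) -> (forall n, 0 < r n) ->
  (forall n, r n.+1 <= r n / 2) -> (forall n, Lpnorm p (f n) <= r n) ->
  periodic2pi u -> {ae leb, forall t, psum f ^~ t @ \oo --> u t} ->
  Lp_per p u /\ forall n, Lpnorm p (fun t => u t - psum f n t) <= 2 * r n.
Proof.
move=> Lf r0 rh Nf pu cu; have mT := @mTper R.
have LS n := Lp_psum n Lf.
have mu_ : strongly_measurable Tper u.
  (* Each partial sum is approximated in L^1 within [e n] by a simple function. These errors are
     summable, so they tend to [0] a.e., and the simple functions converge a.e. to the same limit
     [u]. *)
  pose e n : R := 2^-1 ^+ n.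
  have e0 n : 0 < e n by rewrite exprn_gt0// invr_gt0.
  have eh n : e n.+1 <= e n / 2 by rewrite /e exprS mulrC.
  have /choice[s hs] (n : nat) : exists s : @Defs.sfun R X, sf_adm Tper s /\
      (L1norm (fun t => sf_eval s t - psum f n t)%R <= (e n)%:E)%E.
    have [s [as_ s0]] := L1_approx (LS n).2.1 (Lp_L1norm (LS n)).
    have [N hN] := cvge0_lt s0 (e0 n).
    by exists (s N); split => //; apply: ltW; exact: hN.
  have /choice[w hw] n : exists w, [/\ Bmeas w, periodic2pi w,
     {ae leb, forall t, psum f n t = w t} & Lpint p (psum f n) = Lpint p w].
    exact: Lp_rep.
  have h : {ae leb, forall t, Tper t ->
      cvgn (series (fun n => nrm (sf_eval (s n) t - w n t)))}.
    apply: (@summable_ae (fun n t => sf_eval (s n) t - w n t) e) => // n.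
      by apply: BmeasB; [exact: sf_eval_Bmeas (hs n).1|have [] := hw n].
    have [bw _ fw _] := hw n.
    have fw' : {ae leb, forall t, Tper t -> psum f n t = w n t} by apply: ae_imp fw.
    by rewrite -(L1norm_sfB (hs n).1 bw fw').2; exact: (hs n).2.
  have fw : {ae leb, forall t, forall n, psum f n t = w n t}.
    by apply: ae_foralln => n; have [] := hw n.
  exists s; split; first by move=> n i; have [] := (hs n).1 i.
  apply: ae_imp (ae_and h (ae_and fw cu)) => t [h1 [h2 h3]] Tt.
  have d0 : (fun n => sf_eval (s n) t - w n t) @ \oo --> (0 : X).
    apply/cvg_nrmP; under eq_fun do rewrite subr0.
    exact: cvg_series_cvg_0 (h1 Tt).
  rewrite (_ : (fun n => sf_eval (s n) t) =
     (fun n => (sf_eval (s n) t - w n t) + psum f n t)); last first.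
    by apply/funext => n; rewrite h2 subrK.
  by rewrite -[u t]add0r; exact: cvgD.
have [w [bw pw uw]] := periodic_Bmeas pu mu_.
have key n : (Lpint p (fun t => u t - psum f n t)%R <= ((2 * r n) `^ p)%:E)%E.
  have /choice[z hz] m : exists z, [/\ Bmeas z, periodic2pi z,
     {ae leb, forall t, psum f m t = z t} & Lpint p (psum f m) = Lpint p z].
    exact: Lp_rep (LS m).
  have fz : {ae leb, forall t, forall m, psum f m t = z m t}.
    by apply: ae_foralln => m; have [] := hz m.
  have bz m : Bmeas (z m) by have [] := hz m.
  (* Fatou's lemma in [m], with [n] fixed: the differences of partial sums beyond [n] are uniformly
     bounded in L^p and tend a.e. to [u] minus the [n]-th partial sum. *)
  pose g m t := (nrm (z (n + m)%N t - z n t) `^ p)%:E.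
  have mg m : measurable_fun Tper (g m).
    by apply: measurable_nrm_powR; exact: BmeasB.
  have bwz : Bmeas (fun t => w t - z n t) by exact: BmeasB.
  have -> : Lpint p (fun t => u t - psum f n t) = Lpint p (fun t => w t - z n t).
    by apply: Lpint_ae => //; apply: ae_imp (ae_and uw fz) => t [-> ->].
  have gl : {ae leb, forall t, Tper t ->
      limn_einf (g ^~ t) = (nrm (w t - z n t) `^ p)%:E}.
    apply: ae_imp (ae_and uw (ae_and fz cu)) => t [h1 [h2 h3]] _.
    have c1 : (fun m => nrm (z (n + m)%N t - z n t)) @ \oo --> nrm (w t - z n t).
      apply: cvg_nrm; apply: cvgB; last exact: cvg_cst.
      rewrite -h1; move: h3; rewrite (_ : psum f ^~ t = z ^~ t); last exact/funext.
      rewrite -(cvg_shiftn n); apply: cvg_trans.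
      by apply: near_eq_cvg; apply: nearW => m; rewrite addnC.
    have c2 : g ^~ t @ \oo --> (nrm (w t - z n t) `^ p)%:E.
      apply/fine_cvgP; split; first exact: nearW.
      by apply: cvg_powR => // m; exact: nrm_ge0.
    rewrite is_cvg_limn_einfE; last by apply/cvg_ex; eexists; exact: c2.
    exact/cvg_lim.
  have gL m : (\int[leb]_(t in Tper) g m t <= ((2 * r n) `^ p)%:E)%E.
    have -> : (\int[leb]_(t in Tper) g m t)%E =
        Lpint p (fun t => psum f (n + m) t - psum f n t).
      apply/esym; apply: Lpint_ae; first exact: BmeasB.
      by apply: ae_imp fz => t h _; rewrite !h.
    have [L _] := LpB p1 (LS (n + m)%N) (LS n).
    apply: Lpnorm_Lpint_le => //; first exact: Lp_Lpint.
    exact: psum_tail_Lpnorm.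
  have g0 m t : Tper t -> (0 <= g m t)%E by rewrite lee_fin powR_ge0.
  have le0 t : Tper t -> (0 <= limn_einf (g ^~ t))%E.
    move=> Tt; rewrite limn_einf_lim; apply: lime_ge; first exact: is_cvg_einfs.
    apply: nearW => m; apply: le_ereal_inf_tmp => _ [k /= _ <-]; exact: g0.
  rewrite -[leLHS](@ge0_ae_eq_integral_nomeas _ _ _ leb Tper
    (fun t => limn_einf (g ^~ t)) (fun t => (nrm (w t - z n t) `^ p)%:E))//; first last.
  - by move=> t _; rewrite lee_fin powR_ge0.
  - exact: measurable_nrm_powR.
  apply: (le_trans (fatou leb mT mg g0)).
  rewrite limn_einf_lim; apply: lime_le; first exact: is_cvg_einfs.
  apply: nearW => m; apply: le_trans (gL m).
  by apply: ereal_inf_lbound; exists m => /=.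
have Lu : Lp_per p u.
  split => //; split => //.
  (* The partial sum of index [0] is empty, so this instance bounds the integral of [u] itself. *)
  have := key 0%N; rewrite (_ : (fun t => _) = u); last first.
    by apply/funext => t; rewrite /psum big_ord0 subr0.
  by move/le_lt_trans; apply; rewrite ltry.
split => // n; have c0 : 0 <= 2 * r n by rewrite mulr_ge0// ltW.
exact: (Lpint_Lpnorm_le p1 c0 (key n)).
Qed.

Lemma Lp_complete (f : nat -> R -> X) (r : nat -> R) :
  (forall n, Lp_per p (f n)) -> (forall n, 0 < r n) ->
  (forall n, r n.+1 <= r n / 2) -> (forall n, Lpnorm p (f n) <= r n) ->
  exists u, Lp_per p u /\ forall n, Lpnorm p (fun t => u t - psum f n t) <= 2 * r n.
Proof.
move=> Lf r0 rh Nf; have ca := Lp_series_ae Lf r0 rh Nf.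
(* Even where the series diverges, this value depends only on the sequence of partial sums at [t],
   so [u] is periodic at every point. *)
pose u t := lim (psum f ^~ t @ \oo).
have pf t : psum f ^~ (t + 2 * pi) = psum f ^~ t.
  by apply/funext => n; apply: eq_bigr => i _; rewrite (Lf i).1.
exists u; apply: Lp_series_limit => //.
by move=> t; rewrite /u pf.
Qed.

End LpSeries.

(** * Fourier coefficients *)

Section Fourier.
Context {R : realType} {X : completeNormedModType R[i]} (p : R).
Hypothesis p1 : 1 <= p.
Notation leb := (@lebesgue_measure R).
Implicit Types (u v w : R -> X).

Definition modul (k : int) u (s : R) : X := expi (- (k%:~R * s)) *: u s.

Lemma Bmeas_modul k u : Bmeas u -> Bmeas (modul k u).
Proof.
move=> bu; rewrite /modul (_ : (fun _ => _) = (fun s => expi ((- k%:~R) * s) *: u s)).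
  exact: Bmeas_expi.
by apply/funext => s; rewrite mulNr.
Qed.

Lemma strongly_measurable_modul k u : strongly_measurable Tper u ->
  strongly_measurable Tper (modul k u).
Proof.
move=> /(strongly_measurableP _ mTper)[w [bw uw]].
apply/(strongly_measurableP _ mTper); exists (modul k w); split.
  exact: Bmeas_modul.
by apply: ae_imp uw => t h Tt; rewrite /modul h.
Qed.

Lemma L1norm_modul k u : L1norm (modul k u) = L1norm u.
Proof. by apply: eq_integral => t _; rewrite nrm_expi. Qed.

(** [xget] selects some Bochner integral whenever one exists; uniqueness identifies it with the
    given [c]. *)
Lemma fcoefE u k c : bochner_integral Tper (modul k u) c ->
  fcoef u k = ((2 * pi)^-1)%:C *: c.
Proof.
move=> bc; rewrite /fcoef; congr (_ *: _).
by apply: (bochner_unique _ bc); apply: (@xgetPex X); exists c.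
Qed.

Lemma scale_twopiK (x : X) : (2 * pi : R)%:C *: (((2 * pi)^-1 : R)%:C *: x) = x.
Proof. by rewrite scalerA -rmorphM divff ?scale1r// gt_eqF// twopi_gt0. Qed.

Lemma scale_twopiVK (x : X) : ((2 * pi)^-1 : R)%:C *: ((2 * pi : R)%:C *: x) = x.
Proof. by rewrite scalerA -rmorphM mulVf ?scale1r// gt_eqF// twopi_gt0. Qed.

Lemma fcoef_bochner u k : Lp_per p u ->
  bochner_integral Tper (modul k u) ((2 * pi)%:C *: fcoef u k).
Proof.
move=> Lu; have [_ [mu_ _]] := Lu.
have [c bc] : exists c, bochner_integral Tper (modul k u) c.
  apply: bochner_exists; first exact: strongly_measurable_modul.
  by rewrite L1norm_modul; exact: Lp_L1norm Lu.
by rewrite (fcoefE bc) scale_twopiK.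
Qed.

Lemma fcoef_lin (a : R[i]) u v k : Lp_per p u -> Lp_per p v ->
  fcoef (fun t => a *: u t + v t) k = a *: fcoef u k + fcoef v k.
Proof.
move=> Lu Lv.
have h := bochner_lin a (fcoef_bochner k Lu) (fcoef_bochner k Lv).
rewrite (@fcoefE _ _ (a *: ((2 * pi)%:C *: fcoef u k) + (2 * pi)%:C *: fcoef v k)).
  by rewrite scalerDr scalerA mulrC -scalerA !scale_twopiVK.
move: h; rewrite (_ : (fun t => _) = modul k (fun t => a *: u t + v t))//.
by apply/funext => t; rewrite /modul scalerDr scalerA mulrC -scalerA.
Qed.

(** Continuity of the coefficients in the L^p seminorm, which lets the relation between a function
    and its derivative pass to limits. *)
Lemma nrm_fcoef_le u k (c : R) : Lp_per p u -> 0 < c -> Lpnorm p u <= c ->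
  nrm (fcoef u k) <= (2 * pi)^-1 * ((2 * pi + 1) * c).
Proof.
move=> Lu c0 uc; have [_ [mu_ _]] := Lu.
have := nrm_bochner_le (fcoef_bochner k Lu).
rewrite L1norm_modul => h.
have := le_trans h (L1norm_Lpnorm_le p1 mu_ c0 (Lpnorm_Lpint_le p1 (Lp_Lpint Lu) uc)).
rewrite lee_fin nrmZr ger0_norm ?(ltW twopi_gt0)// => h'.
by rewrite ler_pdivlMl// twopi_gt0.
Qed.

Lemma fcoef_ae u v k : Lp_per p u -> {ae leb, forall t, Tper t -> u t = v t} ->
  fcoef v k = fcoef u k.
Proof.
move=> Lu uv; rewrite (@fcoefE v k ((2 * pi)%:C *: fcoef u k)) ?scale_twopiVK//.
apply: bochner_ae (fcoef_bochner k Lu).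
by apply: ae_imp uv => t h Tt; rewrite /modul h.
Qed.

Lemma bochnerZ (a : R[i]) u c : bochner_integral Tper u c ->
  bochner_integral Tper (fun t => a *: u t) (a *: c).
Proof.
move=> h; have := bochner_lin a h (bochner_cst 0).
rewrite scaler0 addr0 (_ : (fun t => _) = (fun t => a *: u t))//.
by apply/funext => t; rewrite addr0.
Qed.

Lemma periodic_modul k u : periodic2pi u -> periodic2pi (modul k u).
Proof.
move=> pu t; rewrite /modul pu mulrDr opprD expiD; congr (_ *: _).
by rewrite -[in X in _ * X]mulNr -mulrNz expi_2pi_int mulr1.
Qed.

Lemma fcoef_addr u (a : R) k : Lp_per p u ->
  fcoef (fun t => u (t + a)) k = expi (k%:~R * a) *: fcoef u k.
Proof.
move=> Lu; have [pu _] := Lu.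
have h := bochner_addr a (periodic_modul k pu) (fcoef_bochner k Lu).
have := bochnerZ (expi (k%:~R * a)) h.
rewrite (_ : (fun t => _) = modul k (fun t => u (t + a))); last first.
  apply/funext => t; rewrite /modul scalerA; congr (_ *: _).
  by rewrite -expiD; congr expi; ring.
by move/fcoefE => ->; rewrite scalerA mulrC -scalerA scale_twopiVK.
Qed.

Lemma Lp_addr u (a : R) : Lp_per p u -> Lp_per p (fun t => u (t + a)).
Proof.
move=> Lu; have [pu [mu_ fu]] := Lu; have [w [bw pw uw E]] := Lp_rep Lu.
have bwa : Bmeas (fun t => w (t + a)).
  by apply: Bmeas_precomp => //; exact: measurable_addr.
have uwa : {ae leb, forall t, Tper t -> u (t + a) = w (t + a)}.
  by apply: ae_imp (ae_addr a uw).
split; first by move=> t; rewrite addrAC pu.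
split.
  by apply/(strongly_measurableP _ mTper); exists (fun t => w (t + a)).
rewrite -/(Lpint p (fun t => u (t + a))) (Lpint_ae p bwa uwa).
rewrite /Lpint (@integral_periodic _ (fun t => (nrm (w t) `^ p)%:E) a).
- by rewrite -/(Lpint p w) -E.
- exact: measurable_nrm_powR.
- by move=> t; rewrite lee_fin powR_ge0.
- by move=> t; rewrite pw.
Qed.

Lemma periodic_expi (m : int) (z : X) : periodic2pi (fun t => expi (m%:~R * t) *: z).
Proof. by move=> t; rewrite mulrDr expiD expi_2pi_int mulr1. Qed.

Lemma Lp_expi (m : int) (z : X) : Lp_per p (fun t => expi (m%:~R * t) *: z).
Proof.
split; first exact: periodic_expi.
split.
  apply: Bmeas_strongly_measurable; first exact: mTper.
  by apply: (@Bmeas_expi _ _ _ (fun=> z)); apply: Bmeas_fsimple; exact: fsimple_cst.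
rewrite (eq_integral (fun=> (nrm z `^ p)%:E)); last by move=> t _; rewrite nrm_expi.
have h : (leb Tper = (2 * pi)%:E)%E by rewrite leb_Tper.
rewrite integral_cst//; last exact: mTper.
by apply: (@le_lt_trans _ _ ((nrm z `^ p)%:E * (2 * pi)%:E)%E); [rewrite -h|rewrite -EFinM ltry].
Qed.

(** For [k] different from [m], translation by [a = pi / (m - k)] multiplies the k-th coefficient by
    [expi (k a)]. It also multiplies the function itself by [expi (m a)], which is the opposite
    number. The coefficient therefore equals its own negative up to a unimodular factor, and
    vanishes. *)
Lemma fcoef_expi (m k : int) (z : X) :
  fcoef (fun t => expi (m%:~R * t) *: z) k = if k == m then z else 0.
Proof.
case: eqP => [->|/eqP km].
  rewrite (@fcoefE _ _ ((2 * pi)%:C *: z)) ?scale_twopiVK//.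
  have := bochner_cst z; rewrite (_ : (fun=> z) = modul m (fun t => expi (m%:~R * t) *: z))//.
  by apply/funext => t; rewrite /modul scalerA expiN_mul scale1r.
set u := (fun t => _); have Lu : Lp_per p u := Lp_expi m z.
have mk0 : (m - k)%:~R != 0 :> R by rewrite intr_eq0 subr_eq0 eq_sym.
pose a : R := pi / (m - k)%:~R.
have E1 := fcoef_addr a k Lu.
have E2 : fcoef (fun t => u (t + a)) k = expi (m%:~R * a) *: fcoef u k.
  have [L0 _] := @Lp0 R X p p1.
  have := fcoef_lin (expi (m%:~R * a)) k Lu L0.
  rewrite (_ : (fun t => _) = (fun t => u (t + a))); last first.
    by apply/funext => t; rewrite addr0 /u scalerA -expiD; congr (expi _ *: _); ring.
  move=> ->; have := fcoef_lin (-1) k L0 L0.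
  rewrite (_ : (fun t => _) = (fun=> 0)); last by apply/funext => t; rewrite scaler0 addr0.
  by rewrite scaleN1r addNr => ->; rewrite addr0.
have ea : expi (m%:~R * a) = - expi (k%:~R * a) :> R[i].
  have -> : m%:~R * a = k%:~R * a + pi by rewrite /a intrB in mk0 *; field.
  by rewrite (expiD (k%:~R * a) pi) expi_pi mulrN1.
move: E2; rewrite E1 ea scaleNr => /eqP; rewrite -addr_eq0 -scalerDr -mulr2n.
rewrite scaler_eq0 => /orP[|].
  by rewrite -normr_eq0 norm_expi oner_eq0.
by rewrite -scaler_nat scaler_eq0 pnatr_eq0 /= => /eqP.
Qed.

End Fourier.

(** * The open mapping theorem for a linear relation *)

Section OpenMapping.
Context {R : realType} (W Z : lmodType R[i]).
(** To be used with plain functions: [LW] stands for membership in L^p, [N] for its seminorm, [Sol]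
    for the solution relation, and [M] for the sum of the seminorms of a solution and of its
    derivative. [Sol] is a relation because one datum has many a.e. equal solutions. *)
Variables (LW : W -> Prop) (N : W -> R) (Sol : W -> Z -> Prop) (M : Z -> R).
Hypothesis LW0 : LW 0.
Hypothesis N0 : N 0 = 0.
Hypothesis LWD : forall f g, LW f -> LW g -> LW (f + g) /\ N (f + g) <= N f + N g.
Hypothesis LWZ : forall (a : R[i]) f, LW f -> LW (a *: f) /\
  N (a *: f) = complex.Re `|a| * N f.
Hypothesis N_complete : forall (g : nat -> W) (r : nat -> R),
  (forall n, LW (g n)) -> (forall n, 0 < r n) -> (forall n, r n.+1 <= r n / 2) ->
  (forall n, N (g n) <= r n) ->
  exists f, LW f /\ forall n, N (f - \sum_(i < n) g i) <= 2 * r n.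
Hypothesis SolW : forall f z, Sol f z -> LW f.
Hypothesis SolD : forall f g z y, Sol f z -> Sol g y ->
  Sol (f + g) (z + y) /\ M (z + y) <= M z + M y.
Hypothesis SolZ : forall (a : R[i]) f z, Sol f z -> Sol (a *: f) (a *: z) /\
  M (a *: z) = complex.Re `|a| * M z.
Hypothesis Sol_ex : forall f, LW f -> exists z, Sol f z.
(** Closedness of the graph, stated for series with halving bounds. The constant 4 is 2 + 2: [M]
    will add the seminorms of two limits, each obeying the factor 2 of a halving series. *)
Hypothesis Sol_closed : forall (f : W) (g : nat -> W) (z : nat -> Z) (r d : nat -> R),
  LW f -> (forall n, Sol (g n) (z n)) ->
  (forall n, 0 < r n) -> (forall n, r n.+1 <= r n / 2) ->
  (forall n, 0 < d n) -> (forall n, d n.+1 <= d n / 2) ->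
  (forall n, N (g n) <= r n) -> (forall n, M (z n) <= d n) ->
  (forall n, N (f - \sum_(i < n) g i) <= 2 * r n) ->
  exists y, Sol f y /\ M y <= 4 * d 0%N.

Lemma LWB f g : LW f -> LW g -> LW (f - g) /\ N (f - g) <= N f + N g.
Proof.
move=> Lf Lg; have [Lg' Ng'] := LWZ (-1) Lg; have := LWD Lf Lg'.
by rewrite Ng' normrN1 mul1r scaleN1r.
Qed.

Lemma SolB f g z y : Sol f z -> Sol g y ->
  Sol (f - g) (z - y) /\ M (z - y) <= M z + M y.
Proof.
move=> Lf Lg; have [Lg' Ng'] := SolZ (-1) Lg; have := SolD Lf Lg'.
by rewrite Ng' normrN1 mul1r !scaleN1r.
Qed.

Lemma N_distC f g : LW f -> LW g -> N (f - g) = N (g - f).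
Proof.
move=> Lf Lg; have [L _] := LWB Lf Lg; have [_] := LWZ (-1) L.
by rewrite scaleN1r opprB normrN1 mul1r.
Qed.

Lemma ReC_pos (a : R) : 0 < a -> complex.Re `|a%:C| = a.
Proof. by move=> a0; rewrite normc_def /= expr0n /= addr0 sqrtr_sqr gtr0_norm. Qed.

(* Baire's argument: otherwise a sequence of nested balls avoids, one after the
   other, the closures of the sets of right-hand sides solved with norm at most n. *)
Lemma approx_dense : exists (n : nat) (r : R), 0 < r /\
  forall f, LW f -> N f <= r -> forall e, 0 < e ->
  exists g z, [/\ Sol g z, M z <= n%:R & N (f - g) <= e].
Proof.
apply: contrapT => /forallNP H.
have cen (n : nat) (h : W) (r : R) : LW h -> 0 < r -> exists h' e,
    [/\ LW h', N (h' - h) <= r, 0 < e &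
      forall g z, Sol g z -> M z <= n%:R -> e < N (h' - g)].
  move=> Lh r0; apply: contrapT => H'.
  have A h' : LW h' -> N (h' - h) <= r -> forall e, 0 < e ->
      exists g z, [/\ Sol g z, M z <= n%:R & N (h' - g) <= e].
    move=> Lh' h'r e e0; apply: contrapT => H''; apply: H'.
    exists h', e; split => // g z sgz Mz; rewrite ltNge; apply/negP => c.
    by apply: H''; exists g, z.
  (* If a whole ball around [h] were approximable with norms at most [n], then subtracting an
     approximation of [h] from one of [h + f] would approximate every small [f] with norms at most
     [n + n], against [H]. *)
  apply: (H (n + n)%N); exists r; split => // f Lf fr e e0.
  have e20 : 0 < e / 2 by rewrite divr_gt0.
  have [g1 [z1 [s1 m1 n1_]]] : exists g z,
      [/\ Sol g z, M z <= n%:R & N (h - g) <= e / 2].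
    by apply: A => //; rewrite subrr N0 ltW.
  have [Lhf _] := LWD Lh Lf.
  have [g2 [z2 [s2 m2 n2_]]] : exists g z,
      [/\ Sol g z, M z <= n%:R & N (h + f - g) <= e / 2].
    by apply: A => //; rewrite addrC addKr.
  have [s m] := SolB s2 s1.
  exists (g2 - g1), (z2 - z1); split => //.
    by rewrite (le_trans m)// natrD lerD.
  rewrite (_ : f - _ = (h + f - g2) - (h - g1)); last first.
    rewrite !opprB [h + f]addrC -!addrA; congr (f + _).
    by rewrite [RHS]addrC [X in _ = X + h]addrA subrK addrC.
  have [L2 _] := LWB Lhf (SolW s2); have [L1 _] := LWB Lh (SolW s1).
  by rewrite (le_trans (LWB L2 L1).2)// [e]splitr lerD.
have /choice[F hF] (x : nat * W * R) : exists y : W * R, LW x.1.2 -> 0 < x.2 ->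
    [/\ LW y.1, N (y.1 - x.1.2) <= x.2, 0 < y.2 &
      forall g z, Sol g z -> M z <= x.1.1%:R -> y.2 < N (y.1 - g)].
  case: x => -[n h] r /=; have [[Lh r0]|nL] := pselect (LW h /\ 0 < r).
    by have [h' [e he]] := cen n h r Lh r0; exists (h', e).
  by exists (0, 0) => Lh r0; exfalso; apply: nL.
(* The state is a centre and a radius. Step [m] avoids the data solved with norm at most [m]. The
   radius is halved so that [N_complete] applies to the increments, and kept below half the
   avoidance gap so that the later steps, which move by at most twice the radius in all, never close
   that gap. *)
pose st := fix st (n : nat) : W * R := if n is m.+1 then
   let y := F (m, (st m).1, (st m).2) in (y.1, Num.min ((st m).2 / 2) (y.2 / 2))
   else (0, 1).
have stP n : LW (st n).1 /\ 0 < (st n).2.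
  elim: n => [|n [ih1 ih2]]; first by split => //=; exact: ltr01.
  have [/= h1 h2 h3 h4] := hF (n, (st n).1, (st n).2) ih1 ih2.
  by split => //=; rewrite lt_min !divr_gt0.
pose g n := (st n.+1).1 - (st n).1.
have Sg n : \sum_(i < n) g i = (st n).1.
  elim: n => [|n ih]; first by rewrite big_ord0.
  by rewrite big_ord_recr /= ih /g addrC subrK.
have [f [Lf Nf]] : exists f, LW f /\ forall n, N (f - \sum_(i < n) g i) <= 2 * (st n).2.
  apply: N_complete.
  - by move=> n; have [] := LWB (stP n.+1).1 (stP n).1.
  - by move=> n; have [] := stP n.
  - by move=> n; rewrite /= ge_min lexx.
  - move=> n; have [ih1 ih2] := stP n.
    by have [] := hF (n, (st n).1, (st n).2) ih1 ih2.
have [z sz] := Sol_ex Lf.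
(* The limit [f] has a solution of norm at most this [n], yet step [n] kept the limit away from all
   such data. *)
pose n := Num.bound `|M z|.
have Mn : M z <= n%:R.
  by rewrite (le_trans (ler_norm _))// ltW// archi_boundP.
have [ih1 ih2] := stP n.
have [/= h1 h2 h3 h4] := hF (n, (st n).1, (st n).2) ih1 ih2.
have := h4 _ _ sz Mn; rewrite N_distC// ltNge => /negP; apply.
have := Nf n.+1; rewrite Sg => /le_trans; apply => /=.
rewrite mulrC -ler_pdivlMr// ge_min lexx orbT//.
Qed.

(** Successive approximation: each residual is solved up to half of its size bound, and the
    corrections are summed. The estimate uses a positive [e], at least [N f], so that rescaling
    remains possible when [N f = 0]. *)
Lemma open_mapping : exists C : R, 0 < C /\ forall f (e : R), 0 < e -> LW f ->
  N f <= e -> exists z, Sol f z /\ M z <= C * e.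
Proof.
have [n [r [r0 H]]] := approx_dense.
exists (4 * (n.+1%:R / r)); split; first by rewrite mulr_gt0// divr_gt0.
move=> f e e0 Lf Nf.
pose ek k := e * 2^-1 ^+ k.
have ek0 k : 0 < ek k by rewrite mulr_gt0// exprn_gt0// invr_gt0.
have ekS k : ek k.+1 = ek k / 2 by rewrite /ek exprS [2^-1 * _]mulrC mulrA.
(* The residual is rescaled to size at most [r], approximated within [r / 2], and scaled back. The
   bound has [n.+1] in place of [n] to be strictly positive, as [Sol_closed] requires. *)
have stp k (h : W) : exists y : W * Z, LW h -> N h <= ek k ->
    [/\ Sol y.1 y.2, M y.2 <= n.+1%:R / r * ek k & N (h - y.1) <= ek k.+1].
  have [[Lh Nh]|nL] := pselect (LW h /\ N h <= ek k); last first.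
    by exists (0, 0) => Lh Nh; exfalso; apply: nL.
  have c0 : 0 < r / ek k by rewrite divr_gt0.
  have c0' : 0 < ek k / r by rewrite divr_gt0.
  have cc : (ek k / r)%:C * (r / ek k)%:C = 1 :> R[i].
    by rewrite -rmorphM mulrA divfK ?gt_eqF// divff ?gt_eqF.
  have [Lch Nch] := LWZ (r / ek k)%:C Lh.
  have Nch' : N ((r / ek k)%:C *: h) <= r.
    by rewrite Nch ReC_pos// -ler_pdivlMl// invf_div divfK ?gt_eqF.
  have e1 : 0 < r / 2 by rewrite divr_gt0.
  have [g [z [sg mz ng]]] := H _ Lch Nch' _ e1.
  have [sg' mz'] := SolZ (ek k / r)%:C sg.
  exists ((ek k / r)%:C *: g, (ek k / r)%:C *: z) => _ _; split => //=.
    have -> : n.+1%:R / r * ek k = ek k / r * n.+1%:R by rewrite mulrC mulrA mulrAC.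
    by rewrite mz' ReC_pos// ler_wpM2l ?(ltW c0')// (le_trans mz)// ler_nat.
  have -> : h - (ek k / r)%:C *: g = (ek k / r)%:C *: ((r / ek k)%:C *: h - g).
    by rewrite scalerBr scalerA cc scale1r.
  have [Ld _] := LWB Lch (SolW sg).
  have [_ ->] := LWZ (ek k / r)%:C Ld.
  by rewrite ReC_pos// -ler_pdivlMl// invf_div ekS mulrA divfK ?gt_eqF.
have /choice[F hF] (x : nat * W) : exists y : W * Z, LW x.2 -> N x.2 <= ek x.1 ->
    [/\ Sol y.1 y.2, M y.2 <= n.+1%:R / r * ek x.1 & N (x.2 - y.1) <= ek x.1.+1].
  exact: stp.
pose fk := fix fk (k : nat) : W := if k is m.+1 then fk m - (F (m, fk m)).1 else f.
have fkP k : LW (fk k) /\ N (fk k) <= ek k.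
  elim: k => [|k [ih1 ih2]]; first by rewrite /= /ek expr0 mulr1.
  have [/= h1 h2 h3] := hF (k, fk k) ih1 ih2; split => //=.
  by have [] := LWB ih1 (SolW h1).
pose g k := (F (k, fk k)).1; pose z k := (F (k, fk k)).2.
have hg k : [/\ Sol (g k) (z k), M (z k) <= n.+1%:R / r * ek k & N (fk k - g k) <= ek k.+1].
  by have [h1 h2] := fkP k; exact: (hF (k, fk k) h1 h2).
have Sg k : f - \sum_(i < k) g i = fk k.
  elim: k => [|k ih]; first by rewrite big_ord0 subr0.
  by rewrite big_ord_recr /= opprD addrA ih.
have nr0 : 0 < n.+1%:R / r by rewrite divr_gt0.
(* Each correction is a residual minus the next one, of size at most [ek k + ek k.+1]; hence the
   bound [2 * ek k] on the data. *)
have [y [sy My]] : exists y, Sol f y /\ M y <= 4 * (n.+1%:R / r * ek 0%N).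
  apply: (@Sol_closed f g z (fun k => 2 * ek k) (fun k => n.+1%:R / r * ek k)) => //.
  - by move=> k; have [] := hg k.
  - by move=> k; rewrite mulr_gt0.
  - by move=> k; rewrite ekS mulrA.
  - by move=> k; rewrite mulr_gt0.
  - by move=> k; rewrite ekS mulrA.
  - move=> k; have [h1 h2 h3] := hg k; have [l1 l2] := fkP k.
    have -> : g k = fk k - (fk k - g k) by rewrite opprB addrC subrK.
    have [l3 _] := LWB l1 (SolW h1).
    rewrite (le_trans (LWB l1 l3).2)//.
    rewrite (@le_trans _ _ (ek k + ek k.+1)) ?lerD//.
    by have := ek0 k; rewrite ekS; move: (ek k) => a a0; lra.
  - by move=> k; have [] := hg k.
  - move=> k; rewrite Sg; have [_ h] := fkP k; rewrite (le_trans h)//.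
    by have := ek0 k; move: (ek k) => a a0; lra.
exists y; split => //; move: My; rewrite /ek expr0 mulr1 mulrA//.
Qed.

End OpenMapping.

(** * The solution relation: linearity, closed graph and a priori bound *)

Lemma quarter_le (R : realType) (c e : R) : c < e / 4 -> 2 * c + 2 * c <= e.
Proof. lra. Qed.

Lemma ae_shifts (R : realType) (n : nat) (r : 'I_n -> R) (P : R -> Prop) :
  {ae (@lebesgue_measure R), forall t, P t} ->
  {ae (@lebesgue_measure R), forall t, forall j, P (t - r j)}.
Proof.
move=> aP.
have h (m : nat) : {ae (@lebesgue_measure R), forall t, forall j : 'I_n,
    nat_of_ord j = m -> P (t - r j)}.
  have [mn|mn] := ltnP m n; last first.
    by apply: aeW => t j jm; have := ltn_ord j; rewrite jm ltnNge mn.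
  apply: ae_imp (ae_addr (- r (Ordinal mn)) aP) => t ht j jm.
  by have -> : j = Ordinal mn by exact/val_inj.
by apply: ae_imp (ae_foralln h) => t h' j; exact: h'.
Qed.

Section Equation.
Context {R : realType} {X : completeNormedModType R[i]}.
Variables (p : R) (DA : set X) (A B : X -> X) (n : nat) (r : 'I_n -> R).
Hypothesis p1 : 1 <= p.
Hypothesis cA : closed_linear_op DA A.
Hypothesis bB : bounded_op B.
Notation leb := (@lebesgue_measure R).

(* [z] is the pair of a solution and its derivative. *)
Definition Sol (f : R -> X) (z : (R -> X) * (R -> X)) :=
  [/\ Lp_per p f, H1p_deriv p z.1 z.2, (forall t, DA (z.1 t)) &
   {ae leb, forall t, z.2 t = A (z.1 t) + \sum_(j < n) B (z.1 (t - r j)) + f t}].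

Lemma strong_solP f x : Lp_per p f ->
  strong_sol p DA A B r f x <-> exists v, Sol f (x, v).
Proof.
move=> Lf; split=> [[v [h1 [h2 h3]]]|[v [_ h1 h2 h3]]]; exists v; first by split.
by split.
Qed.

Lemma DA_lin (a : R[i]) x y : DA x -> DA y -> DA (a *: x + y).
Proof. by have [_ [h _]] := cA; exact: h. Qed.

Lemma A_lin (a : R[i]) x y : DA x -> DA y -> A (a *: x + y) = a *: A x + A y.
Proof. by have [_ [_ [h _]]] := cA; exact: h. Qed.

Lemma DA0 : DA 0. Proof. by have [] := cA. Qed.

Lemma A0 : A 0 = 0.
Proof.
have := A_lin (-1) DA0 DA0; rewrite scaler0 addr0 => ->.
by rewrite scaleN1r addNr.
Qed.

Lemma B_lin (a : R[i]) x y : B (a *: x + y) = a *: B x + B y.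
Proof. by have [h _] := bB; exact: h. Qed.

Lemma B0 : B 0 = 0.
Proof. by have := B_lin (-1) 0 0; rewrite scaler0 addr0 => ->; rewrite scaleN1r addNr. Qed.

Lemma DAZ (a : R[i]) x : DA x -> DA (a *: x) /\ A (a *: x) = a *: A x.
Proof.
move=> Dx; have := DA_lin a Dx DA0; have := A_lin a Dx DA0.
by rewrite !addr0 A0 addr0.
Qed.

Lemma BZ (a : R[i]) x : B (a *: x) = a *: B x.
Proof. by have := B_lin a x 0; rewrite !addr0 B0 addr0. Qed.

Lemma Lp_lin (a : R[i]) (u v : R -> X) : Lp_per p u -> Lp_per p v ->
  Lp_per p (fun t => a *: u t + v t).
Proof. by move=> Lu Lv; have [] := LpD p1 (LpZ p1 a Lu).1 Lv. Qed.

Lemma Sol_lin (a : R[i]) f g z y : Sol f z -> Sol g y ->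
  Sol (a *: f + g) (a *: z + y).
Proof.
move=> [Lf [Lx [Lv fx]] Dx ex] [Lg [Lx' [Lv' fx']] Dx' ex'].
split; [exact: (Lp_lin a Lf Lg)| |by move=> t; exact: (DA_lin a (Dx t) (Dx' t))|].
  split; [exact: (Lp_lin a Lx Lx')|split; [exact: (Lp_lin a Lv Lv')|]] => k.
  rewrite (_ : (a *: z + y).2 = (fun t => a *: z.2 t + y.2 t))//.
  rewrite (_ : (a *: z + y).1 = (fun t => a *: z.1 t + y.1 t))//.
  rewrite (fcoef_lin p1 a k Lv Lv') (fcoef_lin p1 a k Lx Lx').
  by rewrite fx fx' scalerDr; congr (_ + _); rewrite !scalerA [a * _]mulrC.
apply: ae_imp (ae_and ex ex') => t [h1 h2].
have -> : (a *: z + y).2 t = a *: z.2 t + y.2 t by [].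
have E s : (a *: z + y).1 s = a *: z.1 s + y.1 s by [].
rewrite h1 h2 E A_lin//; under [in RHS]eq_bigr do rewrite E B_lin.
rewrite big_split /= -scaler_sumr.
have -> : (a *: f + g) t = a *: f t + g t by [].
by rewrite !scalerDr addrACA; congr (_ + _); rewrite addrACA.
Qed.

Lemma Sol0 : Sol 0 0.
Proof.
have [L0 _] := @Lp0 R X p p1.
have f0 k : fcoef (fun=> 0 : X) k = 0.
  have := fcoef_lin p1 (-1) k L0 L0.
  rewrite (_ : (fun t => _) = (fun=> 0)); last by apply/funext => t; rewrite scaler0 addr0.
  by move=> ->; rewrite scaleN1r addNr.
split => //; first by split => //; split => // k; rewrite !f0 scaler0.
  by move=> t; exact: DA0.
apply: aeW => t /=; rewrite A0 add0r big1 ?add0r// => j _; exact: B0.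
Qed.

Lemma SolD f g z y : Sol f z -> Sol g y -> Sol (f + g) (z + y).
Proof. by move=> h1 h2; have := Sol_lin 1 h1 h2; rewrite !scale1r. Qed.

Lemma SolZ (a : R[i]) f z : Sol f z -> Sol (a *: f) (a *: z).
Proof. by move=> h; have := Sol_lin a h Sol0; rewrite !addr0. Qed.

Lemma Sol_sum (I : Type) (l : seq I) (f : I -> R -> X)
    (z : I -> (R -> X) * (R -> X)) : (forall i, Sol (f i) (z i)) ->
  Sol (\sum_(i <- l) f i) (\sum_(i <- l) z i).
Proof.
move=> h; elim: l => [|i l ih]; first by rewrite !big_nil; exact: Sol0.
by rewrite !big_cons; exact: SolD.
Qed.

Lemma sum_pair1 (I : Type) (l : seq I) (z : I -> (R -> X) * (R -> X)) t :
  (\sum_(i <- l) z i).1 t = \sum_(i <- l) (z i).1 t.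
Proof. by elim/big_rec2: _ => // i a b _ <-. Qed.

Lemma sum_pair2 (I : Type) (l : seq I) (z : I -> (R -> X) * (R -> X)) t :
  (\sum_(i <- l) z i).2 t = \sum_(i <- l) (z i).2 t.
Proof. by elim/big_rec2: _ => // i a b _ <-. Qed.

Lemma sum_fct (I : Type) (l : seq I) (f : I -> R -> X) t :
  (\sum_(i <- l) f i) t = \sum_(i <- l) f i t.
Proof. by rewrite fct_sumE. Qed.

Lemma cvg_B (u : nat -> X) l : u @ \oo --> l -> (fun m => B (u m)) @ \oo --> B l.
Proof. by move=> ul; have [_ cB] := bB; exact: (cvg_comp _ _ ul (cB l)). Qed.

Lemma cvg_sum_seq (I : Type) (l : seq I) (u : I -> nat -> X) (a : I -> X) :
  (forall i, u i @ \oo --> a i) ->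
  (fun m => \sum_(i <- l) u i m) @ \oo --> \sum_(i <- l) a i.
Proof.
move=> h; elim: l => [|i l ih].
  by under eq_fun do rewrite big_nil; rewrite big_nil; exact: cvg_cst.
by under eq_fun do rewrite big_cons; rewrite big_cons; exact: cvgD.
Qed.

Lemma fcoef_psum_cvg (f : nat -> R -> X) (d : nat -> R) u k :
  (forall m, Lp_per p (f m)) -> (forall m, 0 < d m) -> d @ \oo --> (0 : R) ->
  Lp_per p u -> (forall m, Lpnorm p (fun t => u t - psum f m t) <= 2 * d m) ->
  (fun m => fcoef (psum f m) k) @ \oo --> fcoef u k.
Proof.
move=> Lf d0 dc Lu h.
apply: (@cvg_nrm_squeeze _ _ _ _ (fun m => (2 * pi)^-1 * ((2 * pi + 1) * (2 * d m)))).
  move=> m; have Lp := Lp_psum p1 m Lf.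
  have [Ld _] := LpB p1 Lu Lp.
  rewrite nrmB; have -> : fcoef u k - fcoef (psum f m) k = fcoef (fun t => u t - psum f m t) k.
    have := fcoef_lin p1 (-1) k Lp Lu; rewrite scaleN1r addrC => <-.
    by congr fcoef; apply/funext => t; rewrite scaleN1r addrC.
  by apply: (nrm_fcoef_le p1) => //; rewrite mulr_gt0.
rewrite -[X in _ --> X](_ : (2 * pi)^-1 * ((2 * pi + 1) * (2 * 0)) = 0); last by rewrite !mulr0.
by apply: cvgM; [exact: cvg_cst|apply: cvgM; [exact: cvg_cst|apply: cvgM => //; exact: cvg_cst]].
Qed.

Lemma fsub_psum (f : R -> X) (g : nat -> R -> X) m :
  f - \sum_(i < m) g i = (fun t => f t - psum g m t).
Proof.
apply/funext => t; transitivity (f t - (\sum_(i < m) g i) t); first by [].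
by rewrite sum_fct.
Qed.

(** The series converges a.e. to some [u]. Both [f] and [u] are within [2 * d m] of the [m]-th
    partial sum in seminorm, so their distance is at most [4 * d m] for every [m], and they agree
    a.e. *)
Lemma Lp_limit_unique (g : nat -> R -> X) (d : nat -> R) f :
  (forall m, Lp_per p (g m)) -> (forall m, 0 < d m) -> (forall m, d m.+1 <= d m / 2) ->
  (forall m, Lpnorm p (g m) <= d m) -> Lp_per p f ->
  (forall m, Lpnorm p (fun t => f t - psum g m t) <= 2 * d m) ->
  {ae leb, forall t, psum g ^~ t @ \oo --> f t}.
Proof.
move=> Lg d0 dh Ng Lf Nf; have dc := halving_cvg0 d0 dh.
have ca := Lp_series_ae p1 Lg d0 dh Ng.
pose u t := lim (psum g ^~ t @ \oo).
have pg t : psum g ^~ (t + 2 * pi) = psum g ^~ t.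
  by apply/funext => m; apply: eq_bigr => i _; rewrite (Lg i).1.
have pu : periodic2pi u by move=> t; rewrite /u pg.
have cu : {ae leb, forall t, psum g ^~ t @ \oo --> u t} by apply: ae_imp ca.
have [Lu Nu] := Lp_series_limit p1 Lg d0 dh Ng pu cu.
have [Lfu _] := LpB p1 Lf Lu.
have N0 : Lpnorm p (fun t => f t - u t) = 0.
  apply/eqP; rewrite eq_le Lpnorm_ge0 andbT.
  apply/ler_addgt0Pr => e e0; rewrite add0r.
  have e40 : 0 < e / 4 by rewrite divr_gt0.
  move/cvgrPdist_lt : dc => /(_ _ e40)[m _ /(_ m)] /= /(_ (leqnn _)).
  rewrite sub0r normrN gtr0_norm// => dm.
  have Lp := Lp_psum p1 m Lg.
  have [L1 _] := LpB p1 Lf Lp; have [L2 _] := LpB p1 Lu Lp.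
  have [_ h] := LpB p1 L1 L2.
  have E : (fun t => (f t - psum g m t) - (u t - psum g m t)) = (fun t => f t - u t).
    by apply/funext => t; rewrite opprB addrA subrK.
  rewrite E in h; rewrite (le_trans h)//.
  rewrite (le_trans (lerD (Nf m) (Nu m)))//.
  exact: quarter_le.
have fu := Lpnorm0_ae p1 Lfu N0.
apply: ae_imp (ae_and cu fu) => t [h1 /eqP]; rewrite subr_eq0 => /eqP -> //.
Qed.

Lemma Sol_closed (f : R -> X) (g : nat -> R -> X) (z : nat -> (R -> X) * (R -> X))
    (e d : nat -> R) :
  Lp_per p f -> (forall m, Sol (g m) (z m)) ->
  (forall m, 0 < e m) -> (forall m, e m.+1 <= e m / 2) ->
  (forall m, 0 < d m) -> (forall m, d m.+1 <= d m / 2) ->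
  (forall m, Lpnorm p (g m) <= e m) -> (forall m, Lpnorm p (z m).1 + Lpnorm p (z m).2 <= d m) ->
  (forall m, Lpnorm p (f - \sum_(i < m) g i) <= 2 * e m) ->
  exists y, Sol f y /\ Lpnorm p y.1 + Lpnorm p y.2 <= 4 * d 0%N.
Proof.
move=> Lf sg e0 eh d0 dh Ng Mz Nf; have dc := halving_cvg0 d0 dh.
pose x m := (z m).1; pose v m := (z m).2.
have Lg m : Lp_per p (g m) by have [] := sg m.
have Lx m : Lp_per p (x m) by have [_ []] := sg m.
have Lv m : Lp_per p (v m) by have [_ [_ []]] := sg m.
have Nx m : Lpnorm p (x m) <= d m.
  by rewrite (le_trans _ (Mz m))// lerDl Lpnorm_ge0.
have Nv m : Lpnorm p (v m) <= d m.
  by rewrite (le_trans _ (Mz m))// lerDr Lpnorm_ge0.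
have gf : {ae leb, forall t, psum g ^~ t @ \oo --> f t}.
  have Nf' m : Lpnorm p (fun t => f t - psum g m t) <= 2 * e m by rewrite -fsub_psum.
  exact: (Lp_limit_unique Lg e0 eh Ng Lf Nf').
have cx := Lp_series_ae p1 Lx d0 dh Nx.
have cv := Lp_series_ae p1 Lv d0 dh Nv.
have SS m : Sol (psum g m) (psum x m, psum v m).
  have := Sol_sum (index_enum 'I_m) (fun i : 'I_m => sg i).
  rewrite (_ : \sum_(i < m) g i = psum g m); last by apply/funext => t; rewrite sum_fct.
  rewrite [X in Sol _ X]surjective_pairing.
  rewrite (_ : (\sum_(i < m) z i).1 = psum x m); last by apply/funext => t; rewrite sum_pair1.
  by rewrite (_ : (\sum_(i < m) z i).2 = psum v m)//; apply/funext => t; rewrite sum_pair2.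
have eqS m : {ae leb, forall t, psum v m t = A (psum x m t) +
    \sum_(j < n) B (psum x m (t - r j)) + psum g m t} by have [] := SS m.
have DS m t : DA (psum x m t) by have [_ _ h _] := SS m; exact: h.
have fS m k : fcoef (psum v m) k = (0 +i* k%:~R) *: fcoef (psum x m) k.
  by have [_ [_ [_ h]] _ _] := SS m; exact: h.
pose xl t := lim (psum x ^~ t @ \oo); pose vl t := lim (psum v ^~ t @ \oo).
(* A solution must take values in [DA] at every [t], while the limit does so only a.e.; elsewhere it
   is replaced by [0], an element of [DA]. *)
pose x' t := if `[< DA (xl t) >] then xl t else 0.
have px t : psum x ^~ (t + 2 * pi) = psum x ^~ t.
  by apply/funext => m; apply: eq_bigr => i _; rewrite (Lx i).1.
have pv t : psum v ^~ (t + 2 * pi) = psum v ^~ t.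
  by apply/funext => m; apply: eq_bigr => i _; rewrite (Lv i).1.
have pvl : periodic2pi vl by move=> t; rewrite /vl pv.
have px' : periodic2pi x' by move=> t; rewrite /x' /xl px.
(* The delayed terms require convergence at every [t - r j] as well, which fails only on finitely
   many translates of a null set. *)
have cxj : {ae leb, forall t, forall j, psum x ^~ (t - r j) @ \oo --> xl (t - r j)}.
  exact: (@ae_shifts _ _ _ (fun t => psum x ^~ t @ \oo --> xl t)).
have eqa : {ae leb, forall t, forall m, psum v m t = A (psum x m t) +
    \sum_(j < n) B (psum x m (t - r j)) + psum g m t}.
  exact: ae_foralln.
have key : {ae leb, forall t, DA (xl t) /\
    vl t = A (xl t) + \sum_(j < n) B (xl (t - r j)) + f t}.
  apply: ae_imp (ae_and (ae_and gf cxj) (ae_and (ae_and cx cv) eqa)).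
  move=> t [[gt xj] [[xt vt] et]].
  (* The equation for the partial sums expresses [A] of them through convergent terms, so closedness
     of [A] applies at this fixed [t]. *)
  have cAx : (A \o (psum x ^~ t)) @ \oo -->
      vl t - f t - \sum_(j < n) B (xl (t - r j)).
    rewrite (_ : A \o _ = (fun m => psum v m t - psum g m t -
       \sum_(j < n) B (psum x m (t - r j)))); last first.
      by apply/funext => m /=; rewrite et addrK addrK.
    apply: cvgB; first exact: cvgB.
    by apply: (@cvg_sum_seq _ _ (fun j m => B (psum x m (t - r j)))) => j; exact: cvg_B.
  have [_ [_ [_ clA]]] := cA.
  have [? ->] := clA _ _ _ (fun m => DS m t) xt cAx.
  by split => //; rewrite subrK subrK.
have xx' : {ae leb, forall t, xl t = x' t}.
  by apply: ae_imp key => t [h _]; rewrite /x' asboolT.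
have cx' : {ae leb, forall t, psum x ^~ t @ \oo --> x' t}.
  by apply: ae_imp (ae_and cx xx') => t [h <-].
have cvl : {ae leb, forall t, psum v ^~ t @ \oo --> vl t} by apply: ae_imp cv.
have [Lx' Nx'] := Lp_series_limit p1 Lx d0 dh Nx px' cx'.
have [Lvl Nvl] := Lp_series_limit p1 Lv d0 dh Nv pvl cvl.
exists (x', vl); split; last first.
  (* At index [0] the partial sum is empty, so the bounds for the solution and for its derivative
     both read [2 * d 0]; together they give [4 * d 0]. *)
  have e1 (u : R -> X) (w : nat -> R -> X) : (fun t => u t - psum w 0 t) = u.
    by apply/funext => t; rewrite /psum big_ord0 subr0.
  have := Nx' 0%N; have := Nvl 0%N; rewrite !e1 /= => h1 h2.
  rewrite (le_trans (lerD h2 h1))//.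
  by rewrite -mulrDl -natrD.
split => //=.
- split => //; split => // k.
  have l1 := fcoef_psum_cvg (k := k) Lv d0 dc Lvl Nvl.
  have l2 := fcoef_psum_cvg (k := k) Lx d0 dc Lx' Nx'.
  have l3 : (fun m => fcoef (psum v m) k) @ \oo --> (0 +i* k%:~R) *: fcoef x' k.
    by under eq_fun do rewrite fS; exact: cvgZl_tmp.
  exact: (cvg_unique _ l1 l3).
- by move=> t; rewrite /x'; case: asboolP => // _; exact: DA0.
have xj' : {ae leb, forall t, forall j, xl (t - r j) = x' (t - r j)}.
  exact: (@ae_shifts _ _ _ (fun t => xl t = x' t)).
apply: ae_imp (ae_and key (ae_and xx' xj')) => t [[_ ->] [<- h]].
by congr (_ + _ + _); apply: eq_bigr => j _; rewrite h.
Qed.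

Hypothesis well_posed : forall f : R -> X, Lp_per p f ->
  (exists x, strong_sol p DA A B r f x) /\
  (forall x1 x2, strong_sol p DA A B r f x1 -> strong_sol p DA A B r f x2 ->
     {ae leb, forall t, x1 t = x2 t}).

(** Well-posedness determines only the solution. The derivative is then determined a.e. by the
    equation, whose right-hand side involves only [f] and [z.1]. *)
Lemma Sol_unique f z y : Sol f z -> Sol f y ->
  {ae leb, forall t, z.1 t = y.1 t /\ z.2 t = y.2 t}.
Proof.
move=> sz sy; have [Lf _ _ ez] := sz; have [_ _ _ ey] := sy.
have h : {ae leb, forall t, z.1 t = y.1 t}.
  have [_ u] := well_posed Lf.
  by apply: u; apply/strong_solP => //; [exists z.2|exists y.2];
    rewrite -surjective_pairing.
have hj : {ae leb, forall t, forall j, z.1 (t - r j) = y.1 (t - r j)}.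
  exact: (@ae_shifts _ _ _ (fun t => z.1 t = y.1 t)).
apply: ae_imp (ae_and (ae_and ez ey) (ae_and h hj)) => t [[-> ->] [h1 h2]].
split => //; rewrite h1; congr (_ + _ + _).
by apply: eq_bigr => j _; rewrite h2.
Qed.

Lemma Sol_bound : exists C : R, 0 < C /\ forall f z, Sol f z ->
  Lpnorm p z.1 <= C * Lpnorm p f /\ Lpnorm p z.2 <= C * Lpnorm p f.
Proof.
have [L0 N0] := @Lp0 R X p p1.
have [C [C0 hC]] : exists C : R, 0 < C /\ forall (f : R -> X) (e : R), 0 < e -> Lp_per p f ->
    Lpnorm p f <= e -> exists z, Sol f z /\ Lpnorm p z.1 + Lpnorm p z.2 <= C * e.
  apply: (@open_mapping _ (R -> X) ((R -> X) * (R -> X))%type (Lp_per p) (Lpnorm p) Sol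
    (fun z => Lpnorm p z.1 + Lpnorm p z.2)).
  - exact: L0.
  - exact: N0.
  - by move=> f g Lf Lg; exact: LpD.
  - by move=> a f Lf; exact: LpZ.
  - move=> g e Lg e0 eh Ng; have [f [Lf Nf]] := Lp_complete p1 Lg e0 eh Ng.
    by exists f; split; [exact: Lf|move=> m; rewrite fsub_psum; exact: Nf].
  - by move=> f z [].
  - move=> f g z y sz sy; split; first exact: SolD.
    have [_ [Lz1 [Lz2 _]] _ _] := sz; have [_ [Ly1 [Ly2 _]] _ _] := sy.
    by rewrite addrACA; apply: lerD; [exact: (LpD p1 Lz1 Ly1).2|exact: (LpD p1 Lz2 Ly2).2].
  - move=> a f z sz; split; first exact: SolZ.
    have [_ [Lz1 [Lz2 _]] _ _] := sz.
    have h1 := (LpZ p1 a Lz1).2; have h2 := (LpZ p1 a Lz2).2.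
    by rewrite mulrDr; congr (_ + _); [exact: h1|exact: h2].
  - move=> f Lf; have [[x /(strong_solP _ Lf)[v s]] _] := well_posed Lf.
    by exists (x, v).
  - by move=> f g z e d; exact: Sol_closed.
exists C; split; first exact: C0.
move=> f z sz; have [Lf [Lz1 [Lz2 _]] _ _] := sz.
(* The open mapping theorem bounds some solution [y] for the datum [f]; uniqueness transfers the
   bound to the given [z]. The positive [e] is then taken close to [Lpnorm p f]. *)
have key (e : R) : 0 < e -> Lpnorm p f <= e -> Lpnorm p z.1 <= C * e /\ Lpnorm p z.2 <= C * e.
  move=> e0 fe; have [y [sy My]] := hC f e e0 Lf fe.
  have u := Sol_unique sy sz.
  have [_ [Ly1 [Ly2 _]] _ _] := sy.
  have u1 : {ae leb, forall t, Tper t -> y.1 t = z.1 t} by apply: ae_imp u => t [].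
  have u2 : {ae leb, forall t, Tper t -> y.2 t = z.2 t} by apply: ae_imp u => t [].
  have [_ ->] := Lp_ae Lz1.1 u1 Ly1.
  have [_ ->] := Lp_ae Lz2.1 u2 Ly2.
  have h1 : Lpnorm p y.1 <= Lpnorm p y.1 + Lpnorm p y.2 by rewrite lerDl; exact: Lpnorm_ge0.
  have h2 : Lpnorm p y.2 <= Lpnorm p y.1 + Lpnorm p y.2 by rewrite lerDr; exact: Lpnorm_ge0.
  by split; [exact: le_trans h1 My|exact: le_trans h2 My].
have key' (d : R) : 0 < d -> Lpnorm p z.1 <= C * Lpnorm p f + d /\ Lpnorm p z.2 <= C * Lpnorm p f + d.
  move=> d0; have dC : 0 < d / C by rewrite divr_gt0.
  have e0 : 0 < Lpnorm p f + d / C by apply: ltr_wpDl dC; exact: Lpnorm_ge0.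
  have fe : Lpnorm p f <= Lpnorm p f + d / C by rewrite lerDl ltW.
  by have := key _ e0 fe; rewrite mulrDr [C * (d / C)]mulrC divfK ?gt_eqF.
split; apply/ler_addgt0Pr => d d0; have [h1 h2] := key' d d0; first exact: h1.
exact: h2.
Qed.

End Equation.

(** * Functions invariant a.e. under every translation *)

Section TranslationInvariance.
Context {R : realType} {X : completeNormedModType R[i]}.
Notation leb := (@lebesgue_measure R).

Lemma ae_ex (P : R -> Prop) : {ae leb, forall t, P t} -> exists t, P t.
Proof.
move=> [N [mN N0 sN]]; apply: contrapT => nP.
have TN : Tper `<=` N by move=> t _; apply: sN => Pt; apply: nP; exists t.
have := le_leb (@mTper R) mN TN; rewrite leb_Tper N0 lee_fin leNgt.
by rewrite twopi_gt0.
Qed.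

(** Joint measurability in both variables, as Tonelli's theorem requires: the pair of cells
    containing the two points takes finitely many values. *)
Lemma measurable_diff_fsimple (phi : R -> X) : fsimple phi ->
  measurable_fun [set: measurableTypeR R * measurableTypeR R]
    (fun ts => nrm (phi (ts.1 + ts.2) - phi ts.1)).
Proof.
move=> [I [q [c [mq cq]]]].
pose q' (ts : measurableTypeR R * measurableTypeR R) := (q (ts.1 + ts.2), q ts.1).
rewrite (_ : (fun ts => _) = (fun ts => nrm (c (q' ts).1 - c (q' ts).2))); last first.
  by apply/funext => ts; rewrite !cq.
apply: (fin_measurable_fun (fun ij : I * I => nrm (c ij.1 - c ij.2))) => -[i j].
rewrite setTI (_ : q' @^-1` _ =
  (fun ts : measurableTypeR R * measurableTypeR R => ts.1 + ts.2) @^-1` (q @^-1` [set i])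
  `&` fst @^-1` (q @^-1` [set j])); last first.
  apply/seteqP; split => ts /=; first by move=> [h1 h2].
  by move=> [h1 h2]; rewrite /q' h1 h2.
apply: measurableI.
  rewrite -[X in measurable X]setTI.
  have h : measurable_fun [set: measurableTypeR R * measurableTypeR R]
     (fun ts : measurableTypeR R * measurableTypeR R => ts.1 + ts.2 : R).
    by apply: measurable_funD; [exact: measurable_fst|exact: measurable_snd].
  by apply: h => //; exact: mq.
rewrite -[X in measurable X]setTI.
by apply: measurable_fst => //; exact: mq.
Qed.

(** Integrating [nrm (g (t + s) - g t)] in [t] first gives [0] for every [s]. By Tonelli the
    integral in [s] then vanishes for a.e. [t], so [g] agrees a.e. with its value at such a [t]. *)
Lemma ae_translation_constant (g : R -> X) : Bmeas g ->
  (forall s, {ae leb, forall t, g (t + s) = g t}) ->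
  {ae leb, forall t, {ae leb, forall s, g (t + s) = g t}}.
Proof.
move=> [phi [sphi phig]] gs.
pose h (ts : measurableTypeR R * measurableTypeR R) : \bar R :=
  (nrm (g (ts.1 + ts.2) - g ts.1))%:E.
have mh : measurable_fun setT h.
  apply/measurable_EFinP.
  apply: (@measurable_fun_cvg _ (measurableTypeR R * measurableTypeR R)%type R setT
    (fun (n : nat) (ts : measurableTypeR R * measurableTypeR R) => nrm (phi n (ts.1 + ts.2) - phi n ts.1))).
    by move=> n; exact: measurable_diff_fsimple.
  by move=> ts _; apply: cvg_nrm; apply: cvgB; exact: phig.
have h0 ts : (0 <= h ts)%E by rewrite lee_fin nrm_ge0.
have := @fubini_tonelli _ _ _ _ _ leb leb h mh h0.
rewrite [X in _ = X -> _](_ : _ = 0%E); last first.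
  apply: integral0_eq => s _.
  transitivity (\int[leb]_(t in setT) (cst 0%E : _ -> \bar R) t)%E; last exact: integral0.
  apply: ge0_ae_eq_integral_nomeas => //.
  by apply: ae_imp (gs s) => t ht _; rewrite /h /= ht subrr nrm0.
move=> F0.
have mF : measurable_fun setT (fun t => \int[leb]_s h (t, s))%E.
  exact: (@measurable_fun_fubini_tonelli_F _ _ _ _ _ leb h mh h0).
have F0' t : (0 <= \int[leb]_s h (t, s))%E by exact: integral_ge0.
have aeF : {ae leb, forall t, (\int[leb]_s h (t, s) = 0)%E}.
  have [H _] := @ae_eq_integral_abs _ _ _ leb setT measurableT _ mF.
  have : ae_eq leb setT (fun t => \int[leb]_s h (t, s))%E (cst 0%E).
    by apply: H; rewrite -[RHS]F0; apply: eq_integral => t _; rewrite gee0_abs.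
  by apply: ae_imp => t; apply.
apply: ae_imp aeF => t Ft.
have mht : measurable_fun setT (fun s => h (t, s)).
  exact: (measurableT_comp mh (measurable_pair1 t)).
have [H _] := @ae_eq_integral_abs _ _ _ leb setT measurableT _ mht.
have : ae_eq leb setT (fun s => h (t, s)) (cst 0%E).
  by apply: H; rewrite -[RHS]Ft; apply: eq_integral => s _; rewrite gee0_abs.
apply: ae_imp => s /(_ I) [] /eqP.
by rewrite nrm_eq0 subr_eq0 => /eqP.
Qed.

End TranslationInvariance.

(** * Random signs and the contraction principle *)

Section Signs.
Context {R : realType} {X : completeNormedModType R[i]} (p : R) (m : nat).
Hypothesis p1 : 1 <= p.
Notation leb := (@lebesgue_measure R).
Implicit Types (y : 'I_m -> X) (eps : {ffun 'I_m -> bool}).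

Let p0 : 0 < p. Proof. exact: lt_le_trans p1. Qed.

Definition sgb (b : bool) : R := if b then 1 else -1.

Definition ssum y eps : X := \sum_(l < m) (sgb (eps l))%:C *: y l.

(** Up to the factor 2^m, the expected p-th power of the norm of a Rademacher sum. *)
Definition sign_moment y : R := \sum_(eps : {ffun 'I_m -> bool}) nrm (ssum y eps) `^ p.

Lemma sign_moment_ge0 y : 0 <= sign_moment y.
Proof. by apply: sumr_ge0 => e _; exact: powR_ge0. Qed.

Lemma convex_powR2 (a b x y : R) : 0 <= a -> 0 <= b -> a + b = 1 ->
  0 <= x -> 0 <= y -> (a * x + b * y) `^ p <= a * x `^ p + b * y `^ p.
Proof.
move=> a0 b0 ab x0 y0.
have a1 : a <= 1 by rewrite -ab lerDl.
have hx : x \in `[0, +oo[%classic by apply/mem_set; rewrite /= in_itv /= andbT.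
have hy : y \in `[0, +oo[%classic by apply/mem_set; rewrite /= in_itv /= andbT.
have -> : b = 1 - a by rewrite -ab addrC addKr.
by have := convex_powR p1 (Itv01 a0 a1) hx hy; rewrite !convRE.
Qed.

Definition flip (l0 : 'I_m) eps : {ffun 'I_m -> bool} :=
  [ffun l => if l == l0 then ~~ eps l else eps l].

Lemma flipK l0 : involutive (flip l0).
Proof.
by move=> e; apply/ffunP => l; rewrite !ffunE; case: eqP => // _; rewrite negbK.
Qed.

(* Scaling one vector by [a] averages the sign sum with its flip, with weights
   [(1 + a) / 2] and [(1 - a) / 2]. *)
Lemma sign_moment_scale1 y (l0 : 'I_m) (a : R) : `|a| <= 1 ->
  sign_moment (fun l => if l == l0 then a%:C *: y l else y l) <= sign_moment y.
Proof.
move=> a1; have /andP[am ap] : -1 <= a <= 1 by rewrite -ler_norml.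
pose al := (1 + a) / 2; pose be : R := (1 - a) / 2.
have al0 : 0 <= al by rewrite /al; lra.
have be0 : 0 <= be by rewrite /be; lra.
have ab : al + be = 1 by rewrite /al /be; lra.
have key e : nrm (ssum (fun l => if l == l0 then a%:C *: y l else y l) e) `^ p <=
    al * nrm (ssum y e) `^ p + be * nrm (ssum y (flip l0 e)) `^ p.
  apply: le_trans (convex_powR2 al0 be0 ab (nrm_ge0 _) (nrm_ge0 _)).
  have nn : 0 <= al * nrm (ssum y e) + be * nrm (ssum y (flip l0 e)).
    by rewrite addr_ge0// mulr_ge0// nrm_ge0.
  rewrite ge0_ler_powR ?nnegrE ?(ltW p0) ?nrm_ge0 ?nn//.
  have -> : ssum (fun l => if l == l0 then a%:C *: y l else y l) e =
      al%:C *: ssum y e + be%:C *: ssum y (flip l0 e).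
    rewrite /ssum !scaler_sumr -big_split /=; apply: eq_bigr => l _.
    rewrite ffunE !scalerA -scalerDl; case: eqP => _; rewrite ?scalerA; congr (_ *: _);
      rewrite -!rmorphM -?rmorphD; congr (_%:C); rewrite /sgb /al /be;
      by case: (e l) => /=; lra.
  by rewrite (le_trans (nrmD _ _))// !nrmZr !ger0_norm.
apply: (le_trans (ler_sum _ (fun e _ => key e))).
rewrite big_split /= -!mulr_sumr.
rewrite [X in _ + be * X](_ : _ = sign_moment y); first by rewrite -mulrDl ab mul1r.
by rewrite /sign_moment [RHS](reindex_inj (inv_inj (flipK l0))).
Qed.

Lemma sign_moment_real y (a : 'I_m -> R) : (forall l, `|a l| <= 1) ->
  sign_moment (fun l => (a l)%:C *: y l) <= sign_moment y.
Proof.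
move=> a1.
(* The factors are inserted one index at a time; [uniq] ensures that none is inserted twice. *)
have key (s : seq 'I_m) : uniq s ->
    sign_moment (fun l => if l \in s then (a l)%:C *: y l else y l) <= sign_moment y.
  elim: s => [_|l0 s ih /= /andP[l0s us]]; first by [].
  apply: le_trans (ih us).
  rewrite (_ : (fun l => _) = (fun l => if l == l0 then (a l0)%:C *:
     (if l \in s then (a l)%:C *: y l else y l) else
     (if l \in s then (a l)%:C *: y l else y l))).
    exact: sign_moment_scale1.
  apply/funext => l; rewrite in_cons; case: eqP => [->|_] //=.
  by rewrite (negbTE l0s).
have := key _ (enum_uniq 'I_m).
rewrite (_ : (fun l => _) = (fun l => (a l)%:C *: y l))//.
by apply/funext => l; rewrite mem_enum.
Qed.

(** [expi] is cosine plus [i] times sine, and each part is a real contraction. Convexity gives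
    [(a + b)^p <= 2^p * (a^p + b^p) / 2], so the two halves recombine with the constant [2^p]. *)
Lemma sign_moment_expi y (th : 'I_m -> R) :
  sign_moment (fun l => expi (th l) *: y l) <= 2 `^ p * sign_moment y.
Proof.
pose y1 l := (cos (th l))%:C *: y l; pose y2 l := (sin (th l))%:C *: y l.
have h1 : sign_moment y1 <= sign_moment y by apply: sign_moment_real => l; rewrite ler_norml cos_geN1 cos_le1.
have h2 : sign_moment y2 <= sign_moment y by apply: sign_moment_real => l; rewrite ler_norml sin_geN1 sin_le1.
have key e : nrm (ssum (fun l => expi (th l) *: y l) e) `^ p <=
    2 `^ p * (2^-1 * nrm (ssum y1 e) `^ p + 2^-1 * nrm (ssum y2 e) `^ p).
  have h12 : 0 <= 2^-1 :> R by rewrite invr_ge0.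
  have h11 : 2^-1 + 2^-1 = 1 :> R by lra.
  have c := convex_powR2 h12 h12 h11 (nrm_ge0 (ssum y1 e)) (nrm_ge0 (ssum y2 e)).
  apply: le_trans (ler_wpM2l (powR_ge0 _ _) c).
  rewrite -powRM ?addr_ge0 ?mulr_ge0 ?nrm_ge0//.
  rewrite mulrDr !mulrA divff ?pnatr_eq0// !mul1r.
  rewrite ge0_ler_powR ?nnegrE ?(ltW p0) ?nrm_ge0 ?addr_ge0 ?nrm_ge0//.
  have -> : ssum (fun l => expi (th l) *: y l) e =
      ssum y1 e + (0 +i* 1) *: ssum y2 e.
    rewrite /ssum scaler_sumr -big_split /=; apply: eq_bigr => l _.
    rewrite expi_scale scalerDr; congr (_ + _).
    by rewrite !scalerA; congr (_ *: _); ring.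
  rewrite (le_trans (nrmD _ _))// lerD2l nrmZ normc_def /= expr0n /= add0r expr1n.
  by rewrite sqrtr1 mul1r.
apply: (le_trans (ler_sum _ (fun e _ => key e))).
rewrite -mulr_sumr ler_wpM2l ?powR_ge0// big_split /= -!mulr_sumr -mulrDr.
rewrite -[leLHS]/(2^-1 * (sign_moment y1 + sign_moment y2)).
by rewrite ler_pdivrMl// mulr2n mulrDl mul1r lerD.
Qed.

(** By independence and symmetry every sign pattern occurs with the same measure [W], so the
    integral is [W] times the sum over all patterns. As [W] does not depend on [y], it is common to
    both sides of the R-boundedness inequality. *)
Lemma rademacher_int (rv : 'I_m -> R -> R) : rademacher_family rv ->
  exists W : R, 0 <= W /\ forall y,
    (\int[leb]_(t in I01) (nrm (\sum_(l < m) (rv l t)%:C *: y l) `^ p)%:E)%E =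
    (W * sign_moment y)%:E.
Proof.
move=> [mrv [rv1 [rvs rvi]]].
have N11 : (-1 == 1 :> R) = false.
  by rewrite eq_sym -addr_eq0 -mulr2n pnatr_eq0.
have mI : measurable (I01 : set R) by exact: measurable_itv.
pose q t : {ffun 'I_m -> bool} := [ffun l => rv l t == 1].
have sgbq t l : I01 t -> rv l t = sgb (q t l).
  move=> It; rewrite ffunE /sgb; have [->|->] := rv1 l t It; first by rewrite eqxx.
  by rewrite N11.
pose w l := leb (I01 `&` rv l @^-1` [set 1]).
have ml l (b : R) : measurable (I01 `&` rv l @^-1` [set b]).
  by apply: mrv => //; exact: measurable_set1.
have qE e : I01 `&` q @^-1` [set e] =
    I01 `&` \bigcap_(l in [set l | l \in [set: 'I_m]%SET]) (rv l @^-1` [set sgb (e l)]).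
  apply/seteqP; split => [t [It /= <-]|t [It h]]; split => //.
    by move=> l _ /=; exact: sgbq.
  apply/ffunP => l; have /= := h l; rewrite inE => /(_ isT).
  rewrite ffunE => ->; rewrite /sgb; case: (e l); first by rewrite eqxx.
  exact: N11.
have we e : leb (I01 `&` q @^-1` [set e]) = (\prod_(l < m) w l)%E.
  rewrite qE rvi; last by move=> l; exact: measurable_set1.
  rewrite (eq_bigl xpredT); last by move=> l; rewrite inE.
  by apply: eq_bigr => l _; rewrite /sgb; case: (e l) => //; rewrite -rvs.
have mq e : measurable (I01 `&` q @^-1` [set e]).
  rewrite (_ : _ `&` _ = I01 `&` \bigcap_(l in [set: 'I_m])
      (I01 `&` rv l @^-1` [set sgb (e l)])).
    apply: measurableI => //; apply: fin_bigcap_measurable; first exact: finite_finset.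
    by move=> l _; exact: ml.
  rewrite qE; apply/seteqP; split => t [It h]; split => // l _.
    by split => //; apply: h; rewrite /= inE.
  by have [] := h l I.
have wf : ((\prod_(l < m) w l)%E \is a fin_num) && (0 <= \prod_(l < m) w l)%E.
  rewrite -(we [ffun=> true]); apply/andP; split => //.
  rewrite ge0_fin_numE//; apply: (@le_lt_trans _ _ (leb I01)); first exact: le_leb.
  by rewrite lebesgue_measure_itv /= lte_fin ltr01 oppr0 adde0 ltry.
have /andP[wfin w0] := wf.
exists (fine (\prod_(l < m) w l)%E); split; first exact: fine_ge0.
move=> y.
transitivity (\int[leb]_(t in I01) ((fun e => nrm (ssum y e) `^ p) (q t))%:E)%E.
  apply: eq_integral => t /set_mem It /=; congr ((nrm _ `^ p)%:E).
  by apply: eq_bigr => l _; rewrite -sgbq.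
transitivity (\sum_(e : {ffun 'I_m -> bool}) (nrm (ssum y e) `^ p)%:E *
    leb (I01 `&` q @^-1` [set e]))%E.
  by apply: (leb_fin_integral (F := fun e => nrm (ssum y e) `^ p)) => // e; exact: powR_ge0.
under eq_bigr do rewrite we -(fineK wfin) -EFinM.
by rewrite sumEFin -mulr_suml mulrC.
Qed.

End Signs.

(** * Bounded invertibility of [Delta] *)

Section Resolvent.
Context {R : realType} {X : completeNormedModType R[i]}.
Variables (p : R) (DA : set X) (A B : X -> X) (n : nat) (r : 'I_n -> R).
Hypothesis p1 : 1 <= p.
Hypothesis cA : closed_linear_op DA A.
Hypothesis bB : bounded_op B.
Notation leb := (@lebesgue_measure R).
Hypothesis well_posed : forall f : R -> X, Lp_per p f ->
  (exists x, strong_sol p DA A B r f x) /\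
  (forall x1 x2, strong_sol p DA A B r f x1 -> strong_sol p DA A B r f x2 ->
     {ae leb, forall t, x1 t = x2 t}).

Notation Sol := (Sol p DA A B r).
Notation Delta := (Delta A B r).
Notation ik k := (0 +i* k%:~R : R[i]).

Let p0 : 0 < p. Proof. exact: lt_le_trans p1. Qed.

Lemma Delta_lin k (a : R[i]) x y : DA x -> DA y ->
  Delta k (a *: x + y) = a *: Delta k x + Delta k y.
Proof.
move=> Dx Dy; rewrite /Defs.Delta (A_lin cA)//.
under eq_bigr do rewrite (B_lin bB) scalerDr.
rewrite big_split /= !scalerBr scalerDr.
have -> : \sum_(j < n) expi (- (k%:~R * r j)) *: (a *: B x) =
    a *: \sum_(j < n) expi (- (k%:~R * r j)) *: B x.
  by rewrite scaler_sumr; apply: eq_bigr => j _; rewrite !scalerA mulrC.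
rewrite [ik k *: (a *: x)]scalerA [ik k * a]mulrC -scalerA.
have gen (P Q U V S T : X) : P + Q - (U + V) - (S + T) = P - U - S + (Q - V - T).
  by rewrite !opprD (addrACA P) (addrACA (P - U)).
exact: gen.
Qed.

(** Links the operator to the equation: a shift by [r j] multiplies an exponential by the scalar
    that appears in [Delta]. Injectivity, the bound on the inverse and the R-bound all start from
    these explicit solutions. *)
Lemma Sol_expi k x : DA x ->
  Sol (fun t => expi (k%:~R * t) *: Delta k x)
    ((fun t => expi (k%:~R * t) *: x), (fun t => expi (k%:~R * t) *: (ik k *: x))).
Proof.
move=> Dx; split => /=.
- exact: Lp_expi.
- split; [exact: Lp_expi|split; [exact: Lp_expi|]] => k'.
  rewrite !(fcoef_expi p1); case: eqP => [->//|_]; by rewrite scaler0.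
- by move=> t; have [] := DAZ cA (expi (k%:~R * t)) Dx.
apply: aeW => t; have [_ ->] := DAZ cA (expi (k%:~R * t)) Dx.
have -> : \sum_(j < n) B (expi (k%:~R * (t - r j)) *: x) =
    expi (k%:~R * t) *: \sum_(j < n) expi (- (k%:~R * r j)) *: B x.
  rewrite scaler_sumr; apply: eq_bigr => j _.
  by rewrite (BZ bB) scalerA -expiD mulrBr.
rewrite -!scalerDr /Defs.Delta; congr (_ *: _).
by rewrite -[_ - A x - _]addrA -opprD [RHS]addrC subrK.
Qed.

Lemma Sol_addr f z (s : R) : Sol f z ->
  Sol (fun t => f (t + s)) ((fun t => z.1 (t + s)), (fun t => z.2 (t + s))).
Proof.
move=> [Lf [Lx [Lv fx]] Dx ex]; split => /=.
- exact: Lp_addr.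
- split; [exact: Lp_addr|split; [exact: Lp_addr|]] => k.
  by rewrite (fcoef_addr p1 s k Lv) (fcoef_addr p1 s k Lx) fx !scalerA [expi _ * _]mulrC.
- by move=> t; exact: Dx.
apply: ae_imp (ae_addr s ex) => t ->; congr (_ + _ + _).
by apply: eq_bigr => j _; rewrite addrAC.
Qed.

Lemma Delta_onto k y : exists x, DA x /\ Delta k x = y.
Proof.
pose f t := expi (k%:~R * t) *: y.
have Lf : Lp_per p f by exact: Lp_expi.
have [[x sx'] _] := well_posed Lf.
have [v sx] := (@strong_solP R X p DA A B n r f x Lf).1 sx'.
have [_ [Lx [Lv fx]] Dx ex] := sx; rewrite /= in Lx Lv fx Dx ex.
have inv s : {ae leb, forall t, expi (- (k%:~R * s)) *: x (t + s) = x t}.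
  have h := SolZ p1 cA bB (expi (- (k%:~R * s))) (Sol_addr s sx).
  have Ef : (expi (- (k%:~R * s)) *: (fun t => f (t + s)) : R -> X) = f.
    apply/funext => t; rewrite -[LHS]/(expi (- (k%:~R * s)) *: f (t + s)).
    by rewrite /f scalerA -expiD; congr (expi _ *: _); ring.
  rewrite Ef in h.
  by apply: ae_imp (Sol_unique well_posed h sx) => t [].
have [w [bw pw xw _]] := Lp_rep Lx.
pose g := modul k w.
have bg : Bmeas g by exact: Bmeas_modul.
have ginv s : {ae leb, forall t, g (t + s) = g t}.
  apply: ae_imp (ae_and (inv s) (ae_and xw (ae_addr s xw))) => t [h1 [h2 h3]].
  rewrite /g /modul -h2 -h3 -h1 scalerA -expiD; congr (expi _ *: _); ring.
(* At one point [t0] both a.e. properties hold. There [w] agrees with [x], whose values all lie in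
   [DA], so the constant value [g t0] lies in [DA] too. *)
have [t0 [ht0 xt0]] := ae_ex (ae_and (ae_translation_constant bg ginv) xw).
pose x0 := g t0.
have x0E : x0 = expi (- (k%:~R * t0)) *: x t0 by rewrite /x0 /g /modul -xt0.
have Dx0 : DA x0 by rewrite x0E; have [] := DAZ cA (expi (- (k%:~R * t0))) (Dx t0).
have xE : {ae leb, forall t, x t = expi (k%:~R * t) *: x0}.
  apply: ae_imp (ae_and (ae_addr (- t0) ht0) xw) => t [h1 h2].
  have <- : g t = x0 by rewrite /x0 -h1; congr g; ring.
  by rewrite /g /modul scalerA expi_mulN scale1r.
exists x0; split => //.
have xj : {ae leb, forall t, forall j, x (t - r j) = expi (k%:~R * (t - r j)) *: x0}.
  exact: (@ae_shifts _ _ _ (fun t => x t = expi (k%:~R * t) *: x0)).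
(* Substituting the exponential into the equation shows that the derivative is a.e.
   [expi (k t) *: zz]. The coefficient relation then reads [zz = ik x0], which is
   [Delta k x0 = y]. *)
pose zz := A x0 + \sum_(j < n) expi (- (k%:~R * r j)) *: B x0 + y.
have vE : {ae leb, forall t, v t = expi (k%:~R * t) *: zz}.
  apply: ae_imp (ae_and ex (ae_and xE xj)) => t [-> [-> hj]].
  have [_ ->] := DAZ cA (expi (k%:~R * t)) Dx0.
  rewrite /zz !scalerDr /f; congr (_ + _ + _); rewrite scaler_sumr.
  by apply: eq_bigr => j _; rewrite hj (BZ bB) scalerA -expiD mulrBr.
have F1 : fcoef v k = zz.
  rewrite -(@fcoef_ae _ _ p p1 v _ k Lv (ae_imp (fun t h _ => h) vE)).
  by rewrite (fcoef_expi p1) eqxx.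
have F2 : fcoef x k = x0.
  rewrite -(@fcoef_ae _ _ p p1 x _ k Lx (ae_imp (fun t h _ => h) xE)).
  by rewrite (fcoef_expi p1) eqxx.
have := fx k; rewrite F1 F2 /zz => E.
by rewrite /Defs.Delta -E -[LHS]addrA -opprD [LHS]addrC addKr.
Qed.

Lemma Delta_inj k x : DA x -> Delta k x = 0 -> x = 0.
Proof.
move=> Dx Dk; have s := Sol_expi k Dx.
have E : (fun t => expi (k%:~R * t) *: Delta k x) = 0 :> (R -> X).
  by apply/funext => t; rewrite Dk scaler0.
rewrite E in s.
have [t [h _]] := ae_ex (Sol_unique well_posed s (Sol0 r p1 cA bB)).
move: h => /= h; have : nrm (expi (k%:~R * t) *: x) = 0 by rewrite h nrm0.
by rewrite nrm_expi => /eqP; rewrite nrm_eq0 => /eqP.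
Qed.

Lemma Lpnorm_expi k (z : X) :
  Lpnorm p (fun t => expi (k%:~R * t) *: z) = (2 * pi) `^ p^-1 * nrm z.
Proof.
have -> : Lpnorm p (fun t => expi (k%:~R * t) *: z) = Lpnorm p (fun=> z).
  by rewrite !LpnormE; congr (fine _ `^ _); apply: eq_integral => t _; rewrite nrm_expi.
have iE : Lpint p (fun=> z) = (2 * pi * nrm z `^ p)%:E.
  rewrite /Lpint integral_cst; last exact: mTper.
  rewrite [(2 * pi * _)%R]mulrC EFinM; congr (_ * _)%E; exact: leb_Tper.
rewrite LpnormE iE /= powRM ?(ltW twopi_gt0) ?powR_ge0// -powRrM divff ?gt_eqF//.
by rewrite powRr1// nrm_ge0.
Qed.

Lemma continuous_linear_nrm (T : X -> X) (C : R) : 0 < C -> is_linear_op T ->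
  (forall y, nrm (T y) <= C * nrm y) -> continuous T.
Proof.
move=> C0 lT bT y0; apply/cvgrPdist_lt => e e0.
have eE : e = (complex.Re e)%:C.
  by move: e0; case: (e) => a b; rewrite ltcE /= => /andP[/eqP-> _].
move: e0; rewrite eE ltcR => e0.
have d0 : 0 < (complex.Re e / C)%:C by rewrite ltcR divr_gt0.
have := nbhsx_ballx y0 _ d0; apply: filterS => y.
rewrite -ball_normE /= !norm_nrm !ltcR => h.
have -> : T y0 - T y = T (y0 - y).
  by rewrite addrC -scaleN1r -lT scaleN1r addrC.
by rewrite (le_lt_trans (bT _))// -ltr_pdivlMl// mulrC.
Qed.

Lemma Delta_inverse : exists (Dinv : int -> X -> X) (C : R),
  [/\ 0 < C, forall k, bounded_inverse DA (Delta k) (Dinv k) &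
    forall f z, Sol f z -> Lpnorm p z.2 <= C * Lpnorm p f].
Proof.
have [C [C0 hC]] := Sol_bound p1 cA bB well_posed.
have /choice[F hF] (ky : int * X) : exists x, DA x /\ Delta ky.1 x = ky.2.
  exact: Delta_onto.
pose Dinv k y := F (k, y).
have D1 k y : DA (Dinv k y) by have [] := hF (k, y).
have D2 k y : Delta k (Dinv k y) = y by have [] := hF (k, y).
have inj k x x' : DA x -> DA x' -> Delta k x = Delta k x' -> x = x'.
  move=> Dx Dx' E; apply/eqP; rewrite -subr_eq0; apply/eqP.
  have -> : x - x' = -1 *: x' + x by rewrite scaleN1r addrC.
  apply: (@Delta_inj k); first exact: (DA_lin cA).
  by rewrite Delta_lin// E scaleN1r addNr.
exists Dinv, C; split => // [k|f z sz]; last by have [] := hC _ _ sz.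
have lin : is_linear_op (Dinv k).
  move=> a x y; apply: (@inj k) => //; first exact: (DA_lin cA).
  by rewrite Delta_lin// !D2.
split; last first.
  split; first by move=> x; split; [exact: D1|exact: D2].
  by move=> y Dy; apply: (@inj k) => //; rewrite D2.
split => //; apply: (continuous_linear_nrm C0) => // y.
(* The half of the a priori bound that concerns the solution itself, applied to an exponential: the
   common factor from [Lpnorm_expi] cancels and leaves [nrm (Dinv k y) <= C * nrm y]. *)
have [h _] := hC _ _ (Sol_expi k (D1 k y)).
move: h; rewrite /= D2 !Lpnorm_expi mulrCA ler_pM2l//.
by rewrite powR_gt0// twopi_gt0.
Qed.

End Resolvent.

(** * R-boundedness of the multipliers *)

Section RBound.
Context {R : realType} {X : completeNormedModType R[i]}.
Variables (p : R) (DA : set X) (A B : X -> X) (n : nat) (r : 'I_n -> R).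
Hypothesis p1 : 1 <= p.
Hypothesis cA : closed_linear_op DA A.
Hypothesis bB : bounded_op B.
Notation leb := (@lebesgue_measure R).
Notation Sol := (Sol p DA A B r).
Notation ik k := (0 +i* k%:~R : R[i]).
Variables (Dinv : int -> X -> X) (C : R).
Hypothesis C0 : 0 < C.
Hypothesis DinvP : forall k y, DA (Dinv k y) /\ Delta A B r k (Dinv k y) = y.
Hypothesis Sol_le : forall f z, Sol f z -> Lpnorm p z.2 <= C * Lpnorm p f.

Let p0 : 0 < p. Proof. exact: lt_le_trans p1. Qed.

Lemma Bmeas_sum (I : Type) (l : seq I) (F : I -> R -> X) :
  (forall i, Bmeas (F i)) -> Bmeas (fun t => \sum_(i <- l) F i t).
Proof.
move=> bF; elim: l => [|i l ih].
  by under eq_fun do rewrite big_nil; apply: Bmeas_fsimple; exact: fsimple_cst.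
by under eq_fun do rewrite big_cons; exact: BmeasD.
Qed.

Section Fixed.
Variables (m : nat) (K : 'I_m -> int).

Definition trig (y : 'I_m -> X) (t : R) (l : 'I_m) : X := expi ((K l)%:~R * t) *: y l.

Lemma Bmeas_trig y e : Bmeas (fun t => ssum (trig y t) e).
Proof.
apply: Bmeas_sum => l; apply: BmeasZ.
by apply: (@Bmeas_expi _ _ _ (fun=> y l)); apply: Bmeas_fsimple; exact: fsimple_cst.
Qed.

Lemma Lp_trig y e : Lp_per p (fun t => ssum (trig y t) e).
Proof.
have h (l : 'I_m) : Lp_per p (fun t => (sgb (e l))%:C *: trig y t l).
  by have [] := LpZ p1 (sgb (e l))%:C (Lp_expi p (K l) (y l)).
exact: (Lp_sum p1 _ h).1.
Qed.

Lemma int_sign_moment_trig y :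
  (\int[leb]_(t in Tper) (sign_moment p (trig y t))%:E)%E =
  (\sum_(e : {ffun 'I_m -> bool}) Lpnorm p (fun t => ssum (trig y t) e) `^ p)%:E.
Proof.
rewrite -sumEFin.
transitivity (\int[leb]_(t in Tper) \sum_(e <- index_enum {ffun 'I_m -> bool})
    (nrm (ssum (trig y t) e) `^ p)%:E)%E.
  by apply: eq_integral => t _; rewrite /sign_moment sumEFin.
rewrite ge0_integral_sum//; first last.
- by move=> e t _; rewrite lee_fin powR_ge0.
- by move=> e; apply: measurable_nrm_powR; exact: Bmeas_trig.
- exact: mTper.
apply: eq_bigr => e _; rewrite -LpintE//; exact: Lp_Lpint (Lp_trig y e).
Qed.

(** For fixed signs both sides come from one solution: the datum is the signed sum of the
    [expi (K l t) *: x l], and the sum on the left is the derivative of its solution. The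
    frequencies [K l] may coincide. *)
Lemma Lpnorm_trig_le (x : 'I_m -> X) e :
  Lpnorm p (fun t => ssum (trig (fun l => ik (K l) *: Dinv (K l) (x l)) t) e) <=
  C * Lpnorm p (fun t => ssum (trig x t) e).
Proof.
have h l := SolZ p1 cA bB (sgb (e l))%:C (Sol_expi r p1 cA bB (K l) (DinvP (K l) (x l)).1).
(* [Sol_sum] forms its sums in a function space and in a product; [gen] restates the bound for their
   pointwise forms. *)
have gen (f : 'I_m -> R -> X) (z : 'I_m -> (R -> X) * (R -> X)) (g v : R -> X) :
    (forall l, Sol (f l) (z l)) -> (forall t, \sum_l f l t = g t) ->
    (forall t, \sum_l (z l).2 t = v t) -> Lpnorm p v <= C * Lpnorm p g.
  move=> hS hf hz.
  have <- : \sum_(l <- index_enum 'I_m) f l = g.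
    by apply/funext => t; rewrite sum_fct hf.
  have <- : (\sum_(l <- index_enum 'I_m) z l).2 = v.
    by apply/funext => t; rewrite sum_pair2 hz.
  by apply: Sol_le; exact: Sol_sum.
apply: (gen _ _ _ _ h) => t; apply: eq_bigr => l _; last by [].
rewrite -[LHS]/((sgb (e l))%:C *: (expi ((K l)%:~R * t) *: Delta A B r (K l) (Dinv (K l) (x l)))).
by have [_ ->] := DinvP (K l) (x l).
Qed.

Lemma int_cst_Tper (c : R) : (\int[leb]_(t in Tper) c%:E)%E = (c * (2 * pi))%:E.
Proof.
rewrite integral_cst; last exact: mTper.
by rewrite EFinM; congr (_ * _)%E; exact: leb_Tper.
Qed.

(** [J] sums over the signs the p-th powers of the norms of the signed trigonometric sums. At each
    fixed [t] the contraction principle compares these with the sums free of exponentials, losing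
    [2^p] on either side; with [C^p] in between, this is [(4 * C)^p]. *)
Lemma sign_moment_multiplier (x : 'I_m -> X) :
  sign_moment p (fun l => ik (K l) *: Dinv (K l) (x l)) <= (4 * C) `^ p * sign_moment p x.
Proof.
set M := (fun l => ik (K l) *: Dinv (K l) (x l)).
pose J y := \sum_(e : {ffun 'I_m -> bool}) Lpnorm p (fun t => ssum (trig y t) e) `^ p.
have tp0 : 0 < 2 `^ p :> R by rewrite powR_gt0.
(* Here the contraction principle is applied to the sums with exponentials, multiplied by the
   conjugate factors; this recovers [M] for every [t]. *)
have lower : (2 `^ p)^-1 * sign_moment p M * (2 * pi) <= J M.
  rewrite -lee_fin -int_cst_Tper -int_sign_moment_trig.
  apply: ge0_le_integral_nomeas => t _.
    by rewrite lee_fin mulr_ge0 ?invr_ge0 ?powR_ge0 ?sign_moment_ge0.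
  rewrite lee_fin ler_pdivrMl//.
  have := sign_moment_expi p1 (trig M t) (fun l => - ((K l)%:~R * t)).
  rewrite (_ : (fun l => _) = M)//.
  by apply/funext => l; rewrite /trig scalerA expiN_mul scale1r.
have upper : J x <= 2 `^ p * sign_moment p x * (2 * pi).
  rewrite -lee_fin -int_cst_Tper -int_sign_moment_trig.
  apply: ge0_le_integral_nomeas => t _; first by rewrite lee_fin sign_moment_ge0.
  by rewrite lee_fin; exact: sign_moment_expi.
have JJ : J M <= C `^ p * J x.
  rewrite /J mulr_sumr; apply: ler_sum => e _.
  rewrite -powRM ?Lpnorm_ge0// ?(ltW C0)//.
  rewrite ge0_ler_powR ?nnegrE ?(ltW p0) ?mulr_ge0 ?Lpnorm_ge0 ?(ltW C0)//.
  exact: Lpnorm_trig_le.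
have := le_trans lower (le_trans JJ (ler_wpM2l (powR_ge0 _ _) upper)).
have tp : 0 < 2 * pi :> R by exact: twopi_gt0.
move: tp; move: (2 * pi : R) => t t0 h.
have {h} : (2 `^ p)^-1 * sign_moment p M <= C `^ p * (2 `^ p * sign_moment p x).
  by rewrite -(ler_pM2r t0) -[X in _ <= X]mulrA.
rewrite ler_pdivrMl// => h; rewrite (le_trans h)//.
rewrite powRM ?(ltW C0)// (_ : 4 = 2 * 2 :> R); last by rewrite -natrM.
rewrite powRM//; move: (2 `^ p) (C `^ p) (sign_moment p x) => a b c.
by rewrite !mulrA [a * b * a]mulrAC.
Qed.

End Fixed.

Lemma R_bounded_multiplier :
  R_bounded [set T | exists k : int, T = (fun y => ik k *: Dinv k y)].
Proof.
exists (4 * C); split; first by rewrite mulr_gt0.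
(* The exponent of R-boundedness is [p] itself, so the moments compared are those that the solution
   bound controls. *)
exists p; split => // m T x rv hT rad.
have /choice[K hK] l : exists k : int, T l = (fun y => ik k *: Dinv k y) by exact: hT.
have [W [W0 hW]] := rademacher_int (X := X) p rad.
rewrite /Lq01_norm !hW /=.
have -> : (fun l => T l (x l)) = (fun l => ik (K l) *: Dinv (K l) (x l)).
  by apply/funext => l; rewrite hK.
have C40 : 0 <= 4 * C by rewrite mulr_ge0// ltW.
have E : 4 * C = ((4 * C) `^ p) `^ p^-1.
  by rewrite -powRrM divff ?gt_eqF// powRr1.
rewrite [X in _ <= X * _]E.
rewrite -powRM ?powR_ge0 ?mulr_ge0 ?sign_moment_ge0//.
apply: ge0_ler_powR; rewrite ?nnegrE ?invr_ge0 ?(ltW p0) ?mulr_ge0 ?powR_ge0 ?sign_moment_ge0//.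
by rewrite mulrCA ler_wpM2l// sign_moment_multiplier.
Qed.

End RBound.

Theorem theorem3p7 (R : realType) (X : completeNormedModType R[i])
    (DA : set X) (A : X -> X) (B : X -> X) (n : nat) (r : 'I_n -> R) (p : R) :
  closed_linear_op DA A -> bounded_op B -> (forall j, 0 <= r j) -> 1 <= p ->
  (forall f : R -> X, Lp_per p f ->
     (exists x, strong_sol p DA A B r f x) /\
     (forall x1 x2, strong_sol p DA A B r f x1 -> strong_sol p DA A B r f x2 ->
        {ae (@lebesgue_measure R), forall t, x1 t = x2 t})) ->
  exists Dinv : int -> X -> X,
    (forall k : int, bounded_inverse DA (Delta A B r k) (Dinv k)) /\
    R_bounded [set T | exists k : int, T = (fun y => (0 +i* k%:~R) *: Dinv k y)].
Proof.
move=> cA bB _ p1 wp.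
have [Dinv [C [C0 hD hS]]] := Delta_inverse p1 cA bB wp.
exists Dinv; split => //.
apply: (R_bounded_multiplier p1 cA bB C0 _ hS) => k y.
by have [_ [h _]] := hD k; exact: h.
Qed.
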